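(* $mnl(K_7) = 21$, where $K_7$ is the complete graph on $7$ vertices.
   Context: An embedding of a finite graph $G$ means a tame embedding of $G$ in $\mathbb{R}^3$. A cycle is a simple closed cycle of the graph. A link in an embedding is an unordered pair of vertex-disjoint cycles of $G$ whose images form a non-trivial (non-split) two-component link (no three pairwise disjoint cycles exist in the graph considered here, so all links have two components); links are counted as pairs of cycles. $mnl(G)$ is the minimal number of links in any embedding of $G$ in $\mathbb{R}^3$. *)

(* Defs.v *)
(* Graphs are finite and simple: a graph on n vertices is a symmetric
   irreflexive relation on 'I_n. *)
From HB Require Import structures.
From mathcomp Require Import all_boot all_order all_algebra.
From mathcomp Require Import all_classical all_reals all_analysis.

Set Implicit Arguments.
Unset Strict Implicit.
Unset Printing Implicit Defensive.
Import Order.TTheory GRing.Theory Num.Theory.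
Import numFieldNormedType.Exports.

Local Open Scope classical_set_scope.
Local Open Scope ring_scope.

Definition complete_graph (n : nat) : rel 'I_n := [rel i j | i != j].
Arguments complete_graph n : clear implicits.

(* A cycle is identified with its edge set, an edge being the two-element set
   of its endpoints; so neither base point nor direction matters. *)
Definition is_graph_cycle (n : nat) (e : rel 'I_n) (C : {set {set 'I_n}}) : Prop :=
  exists s : seq 'I_n,
    [/\ uniq s, (2 < size s)%N, path.cycle e s
      & C = [set [set x; next s x] | x in s]%SET].

Section Topology.
Variable R : realType.

Definition segment (m : nat) (a b : 'rV[R]_m) : set 'rV[R]_m :=
  [set (1 - t) *: a + t *: b | t in `[0, 1]].

(* Points of the geometric realization of a graph on 'I_n, inside the standard
   simplex of R^n: vertex i is the i-th unit vector. *)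
Definition vertex (n : nat) (i : 'I_n) : 'rV[R]_n := delta_mx 0 i.

Definition edge (n : nat) (i j : 'I_n) : set 'rV[R]_n :=
  segment (vertex i) (vertex j).

(* The union with the vertices only matters for isolated ones. *)
Definition realization (n : nat) (e : rel 'I_n) : set 'rV[R]_n :=
  [set vertex i | i in [set: 'I_n]] `|`
  [set x | exists i j, e i j /\ edge i j x].

Definition cycle_realization (n : nat) (C : {set {set 'I_n}}) : set 'rV[R]_n :=
  [set x | exists i j, [set i; j]%SET \in C /\ edge i j x].

Definition homeomorphism (h : 'rV[R]_3 -> 'rV[R]_3) : Prop :=
  continuous h /\
  exists g : 'rV[R]_3 -> 'rV[R]_3, [/\ continuous g, cancel h g & cancel g h].

Definition polygonal (A : set 'rV[R]_3) : Prop :=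
  exists s : seq ('rV[R]_3 * 'rV[R]_3),
    A = \bigcup_(p in [set` s]) segment p.1 p.2.

(* f is only meaningful on the realization, which is compact, so that a
   continuous injection is a homeomorphism onto its image.  Tameness: some
   homeomorphism of R^3 makes every edge a polygonal arc. *)
Definition tame_embedding (n : nat) (e : rel 'I_n)
    (f : 'rV[R]_n -> 'rV[R]_3) : Prop :=
  [/\ {within realization e, continuous f},
      {in realization e &, injective f}
    & exists2 h : 'rV[R]_3 -> 'rV[R]_3, homeomorphism h
        & forall i j, e i j -> polygonal (h @` (f @` edge i j))].

(* Squared Euclidean norm; the library's norm on row vectors is the sup norm. *)
Definition sqnorm (x : 'rV[R]_3) : R := \sum_i x 0 i ^+ 2.

(* The tame 2-sphere h(S^2) has A inside and B outside. *)
Definition sphere_separates (h : 'rV[R]_3 -> 'rV[R]_3) (A B : set 'rV[R]_3) :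
    Prop :=
  A `<=` h @` [set x | sqnorm x < 1] /\ B `<=` h @` [set x | 1 < sqnorm x].

(* Some tame 2-sphere in the complement has A and B on different sides. *)
Definition split_link (A B : set 'rV[R]_3) : Prop :=
  exists2 h : 'rV[R]_3 -> 'rV[R]_3, homeomorphism h
    & sphere_separates h A B \/ sphere_separates h B A.

(* Only two-component links are considered, which is all of them when the graph
   has no three pairwise disjoint cycles. *)
Definition is_link (n : nat) (e : rel 'I_n) (f : 'rV[R]_n -> 'rV[R]_3)
    (P : {set {set {set 'I_n}}}) : Prop :=
  exists C D : {set {set 'I_n}},
    [/\ is_graph_cycle e C, is_graph_cycle e D,
        (finset.cover C :&: finset.cover D = finset.set0)%SET,
        P = [set C; D]%SET
      & ~ split_link (f @` cycle_realization C) (f @` cycle_realization D)].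

Definition number_of_links (n : nat) (e : rel 'I_n)
    (f : 'rV[R]_n -> 'rV[R]_3) : nat :=
  #|[set P | `[< is_link e f P >]]%SET|.

(* The least element of the set of link counts of tame embeddings; the default
   0 would only be used if that set were empty. *)
Definition mnl (n : nat) (e : rel 'I_n) : nat :=
  let counts : set nat :=
    [set number_of_links e f | f in [set f | tame_embedding e f]] in
  xget 0%N (counts `&` lbound counts).

End Topology.

(* Main.v *)
Require Import Defs.
From mathcomp Require Import all_boot all_order all_algebra.
From mathcomp Require Import all_classical all_reals all_analysis.
From mathcomp Require Import ring lra zify.

(** Every embedding has 21 links for reasons of parity, and one has no others.

    ** The lower bound

    Linking is detected modulo 2.  Cut every edge into [n] pieces, replace it
    by the polygonal path through the images of the cutting points, and move
    these points a little so that they are in general position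
    ([near_in_general_position]).  For two disjoint edges [e] and [e'] let
    [W e e'] be the parity of the number of crossings, in the projection along
    the third axis, at which [e] passes over [e'].  For two disjoint cycles the
    sum of [W] over the edges of the first and those of the second is their
    linking number modulo 2.

    A split pair has linking parity 0 ([near_loops_over_split]).  One of the
    cycles lies inside a tame sphere and the other one outside, so the first
    contracts inside the sphere, by coning in the round ball; the subdivided
    cone is a union of triangles so small that the other cycle pierces none
    of them, and then crossings can be pushed up to the apex
    ([loops_over_contractible]).

    The numbers [W e e'] are not arbitrary: [W e e' + W e' e] is a planar
    crossing parity, and it is a sum of terms each of which depends on one edge
    and one vertex, or on two vertices ([path_crossing_parity]).  In some sums of
    linking parities these terms cancel, up to the 1 that the order of two
    vertices along the first axis and the opposite order add up to.  Hence, as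
    Conway, Gordon and Sachs found, among the ten pairs of triangles of a [K_6]
    an odd number is linked oddly ([odd_K6]), and the same holds for the nine
    pairs of a triangle and a 4-cycle of a [K_{3,3,1}] ([odd_K331]).  These
    come down to van Kampen's fact that drawings of [K_5] and [K_{3,3}] have an
    odd number of crossings of disjoint edges.

    Let [N3] and [N4] be the numbers of oddly linked pairs of two triangles and
    of a triangle and a 4-cycle.  Each pair of triangles lies in exactly one of
    the seven [K_6], so [N3] is odd.  Each triangle-square pair lies in six of
    the seventy [K_{3,3,1}], so [70 <= 6 * N4].  For a fixed triangle, the
    linking parity with cycles of the complementary [K_4] is additive, so
    either no 4-cycle and 0 or 4 triangles are linked with it, or two of
    each kind are.  If [p] triangles are of the latter sort, then [N4 = 2 * p],
    and [N3 = p + 2 * q] for some [q].  So [p] is odd and at least 6, hence at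
    least 7, and [N3 + N4 >= 3 * p >= 21] ([links_at_least_21]).

    ** The upper bound

    Seven explicit points span a straight-line embedding in which 154 of the 175
    pairs of disjoint cycles are split ([split_checkP], [size_linked_pairs]).
    In each of these, one of the two cycles bounds a disc missed by the other
    one: a flat triangle, or a quadrilateral bent along a diagonal.  Such a disc
    is star-shaped about a point, the thin neighbourhoods of it are balls
    bounded by star-shaped surfaces, and a radial homeomorphism carries the round
    sphere to such a surface ([split_by_gauge], [split_by_disc]).  That a
    segment misses a triangle is read from signs of integer determinants
    ([missedP]). *)

Set Implicit Arguments.
Unset Strict Implicit.
Unset Printing Implicit Defensive.
Import Order.TTheory GRing.Theory Num.Theory.
Import numFieldNormedType.Exports.
Local Open Scope classical_set_scope.
Local Open Scope ring_scope.

(** * Affine functions on an interval *)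

Section AffineFunctions.
Variable R : realFieldType.
Implicit Types (l m : R * R) (s : seq (R * R)) (a b t : R) (I : R -> bool).

Definition aff l t := l.1 + l.2 * t.
Definition aff_root l := - l.1 / l.2.

Definition all_pos s t := all (fun l => 0 < aff l t) s.

(** The parity of the number of ends, inside [I], of the interval on which all the
    functions are positive: such an end is the root of one function at which the
    others are positive.  The sign of a function already met is moved into [I]. *)
Fixpoint boundary_parity I s : bool :=
  if s is l :: s' then
    [&& l.2 != 0, I (aff_root l) & all_pos s' (aff_root l)]
      (+) boundary_parity (fun t => I t && (0 < aff l t)) s'
  else false.

Fixpoint no_common_root s : Prop :=
  if s is l :: s' then
    (forall m, m \in s' -> l.2 != 0 -> aff m (aff_root l) != 0)
      /\ no_common_root s'
  else True.

Lemma eq_boundary_parity I J s :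
  I =1 J -> boundary_parity I s = boundary_parity J s.
Proof.
elim: s I J => //= l s IH I J IJ; rewrite IJ; congr (_ (+) _).
by apply: IH => t; rewrite IJ.
Qed.

Lemma boundary_parity0 I s : (forall t, I t = false) -> boundary_parity I s = false.
Proof.
elim: s I => //= l s IH I I0; rewrite I0 andbF /=.
by apply: IH => t; rewrite I0.
Qed.

Lemma affine_neg_between p q a b t :
  a < t -> t < b -> p + q * a < 0 -> p + q * b < 0 -> p + q * t < 0.
Proof.
move=> at_ tb pa pb; have [q0|q0] := lerP 0 q.
  by have : q * t <= q * b by [rewrite ler_wpM2l // ltW]; lra.
have : q * t <= q * a by rewrite ler_wnM2l // ltW.
by lra.
Qed.

Lemma affine_pos_between p q a b t :
  a < t -> t < b -> 0 < p + q * a -> 0 < p + q * b -> 0 < p + q * t.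
Proof.
move=> at_ tb pa pb; have := @affine_neg_between (- p) (- q) a b t at_ tb.
by rewrite !mulNr; lra.
Qed.

(** The set where all the functions are positive is an interval.  If it is not
    empty, each of its two ends is either an end of [[a, b]] or a root counted by
    [boundary_parity].  By induction on the number of functions: a function
    that changes sign replaces one end of [[a, b]] by its root. *)
Lemma boundary_parity_even s a b :
    a < b -> no_common_root s ->
    (forall l, l \in s -> aff l a != 0 /\ aff l b != 0) ->
  all_pos s a (+) all_pos s b = boundary_parity (fun t => a < t < b) s.
Proof.
elim: s a b => [|[p q] s IH] a b ab //= [lm nc] ends.
have ab' : 0 < b - a by rewrite subr_gt0.
have [pa pb] := ends _ (mem_head _ _).
have ends' l : l \in s -> aff l a != 0 /\ aff l b != 0.
  by move=> ls; apply: ends; rewrite inE ls orbT.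
rewrite /aff_root /aff /= in lm pa pb *.
have rootE : q != 0 -> p + q * (- p / q) = 0 by move=> q0; field.
have rE t : q != 0 -> p + q * t = q * (t - (- p / q)) by move=> q0; field.
set c := - p / q in lm rootE rE *.
have [pa0|pa0] : p + q * a < 0 \/ 0 < p + q * a by lra.
  have [pb0|pb0] : p + q * b < 0 \/ 0 < p + q * b by lra.
  - rewrite [X in X && _]lt_gtF // [X in _ (+) (X && _)]lt_gtF //=.
    rewrite boundary_parity0 => [|t]; last first.
      apply/negP => /andP[/andP[at_ tb] pt].
      by have := affine_neg_between at_ tb pa0 pb0; rewrite ltNge (ltW pt).
    rewrite addbF; symmetry; apply/negP => /and3P[q0 /andP[ac cb] _].
    by have := affine_neg_between ac cb pa0 pb0; rewrite rootE // ltxx.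
  - have q0 : 0 < q by rewrite -(pmulr_rgt0 _ ab'); lra.
    have qn : q != 0 by rewrite gt_eqF.
    have ac : a < c by rewrite -subr_gt0 -(pmulr_rgt0 _ q0); move: (rE a qn); lra.
    have cb : c < b by rewrite -subr_gt0 -(pmulr_rgt0 _ q0); move: (rE b qn); lra.
    rewrite [X in X && _]lt_gtF // pb0 qn ac cb /=.
    rewrite (@eq_boundary_parity _ (fun t => c < t < b)) => [|t]; last first.
      rewrite rE // pmulr_rgt0 // subr_gt0; case: (ltP c t) => ct; rewrite ?andbT ?andbF //=.
      by rewrite (lt_trans ac ct).
    rewrite -IH //; first by case: all_pos; case: all_pos.
    by move=> l ls; split; [apply: lm | have [] := ends' _ ls].
have [pb0|pb0] : p + q * b < 0 \/ 0 < p + q * b by lra.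
- have q0 : q < 0 by rewrite -(pmulr_rlt0 _ ab'); lra.
  have qn : q != 0 by rewrite lt_eqF.
  have ac : a < c by rewrite -subr_lt0 -(nmulr_rgt0 _ q0); move: (rE a qn); lra.
  have cb : c < b by rewrite -subr_gt0 -(nmulr_rlt0 _ q0); move: (rE b qn); lra.
  rewrite pa0 [X in _ (+) (X && _)]lt_gtF // qn ac cb /=.
  rewrite (@eq_boundary_parity _ (fun t => a < t < c)) => [|t]; last first.
    rewrite rE // nmulr_rgt0 // subr_lt0; case: (ltP t c) => ct; rewrite ?andbT ?andbF //=.
    by rewrite (lt_trans ct cb) andbT.
  rewrite -IH //; first by case: all_pos; case: all_pos.
  by move=> l ls; split; [have [] := ends' _ ls | apply: lm].
- rewrite pa0 pb0 /= (@eq_boundary_parity _ (fun t => a < t < b)) => [|t]; last first.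
    case: (boolP (a < t < b)) => //= /andP[at_ tb].
    by have := affine_pos_between at_ tb pa0 pb0.
  rewrite -IH //; case: (boolP [&& _, _ & _]) => //= /and3P[q0 /andP[ac cb] _].
  by have := affine_pos_between ac cb pa0 pb0; rewrite rootE // ltxx.
Qed.

Lemma aff_root_existsP l (P : R -> bool) : aff l 0 != 0 ->
  [&& l.2 != 0, 0 < aff_root l < 1 & P (aff_root l)] =
  `[< exists t, [/\ 0 < t < 1, aff l t = 0 & P t] >].
Proof.
case: l => p q; rewrite /aff /aff_root /= mulr0 addr0 => p0.
apply/idP/asboolP => [/and3P[q0 r01 Pr]|[t [t01 rt Pt]]].
  by exists (- p / q); split=> //; field.
have q0 : q != 0 by apply: contraNneq p0 => q0; move: rt; rewrite q0 mul0r addr0 => ->.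
suff <- : t = - p / q by rewrite q0 t01.
by apply: (mulfI q0); rewrite mulrCA divff // mulr1; lra.
Qed.

Definition vanishing_under l s : bool :=
  `[< exists t, [/\ 0 < t < 1, aff l t = 0 & all_pos s t] >].

Lemma vanishing_underE l s : aff l 0 != 0 ->
  vanishing_under l s =
  [&& l.2 != 0, 0 < aff_root l < 1 & all_pos s (aff_root l)].
Proof. by move=> l0; rewrite (aff_root_existsP (all_pos s)). Qed.

Lemma aff_common_root l m :
  (forall t, aff l t = 0 -> aff m t <> 0) ->
  l.2 != 0 -> aff m (aff_root l) != 0.
Proof.
move=> lm l0; apply/eqP/lm; rewrite /aff /aff_root.
by case: l l0 {lm} => p q /= q0; field.
Qed.

(** The cases of three and four functions are those of the regions used below:
    the part of the plane above a segment, and the prism below a triangle. *)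
Lemma boundary_parity3 l1 l2 l3 :
    (forall l, l \in [:: l1; l2; l3] -> aff l 0 != 0 /\ aff l 1 != 0) ->
    (forall t, aff l1 t = 0 -> aff l2 t <> 0) ->
    (forall t, aff l1 t = 0 -> aff l3 t <> 0) ->
    (forall t, aff l2 t = 0 -> aff l3 t <> 0) ->
  all_pos [:: l1; l2; l3] 0 (+) all_pos [:: l1; l2; l3] 1 =
  vanishing_under l1 [:: l2; l3] (+)
    (vanishing_under l2 [:: l1; l3] (+) vanishing_under l3 [:: l1; l2]).
Proof.
move=> ends n12 n13 n23.
have e l : l \in [:: l1; l2; l3] -> aff l 0 != 0 by move=> /ends[].
rewrite (@boundary_parity_even _ 0 1 ltr01) //=; last first.
  split=> [m|]; last by split=> // m; rewrite inE => /eqP->; apply: aff_common_root.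
  by rewrite !inE => /orP[]/eqP->; apply: aff_common_root.
by rewrite addbF !vanishing_underE ?e ?inE ?eqxx ?orbT //= -!andbA.
Qed.

Lemma boundary_parity4 l1 l2 l3 l4 :
    (forall l, l \in [:: l1; l2; l3; l4] -> aff l 0 != 0 /\ aff l 1 != 0) ->
    (forall t, aff l1 t = 0 -> aff l2 t <> 0) ->
    (forall t, aff l1 t = 0 -> aff l3 t <> 0) ->
    (forall t, aff l1 t = 0 -> aff l4 t <> 0) ->
    (forall t, aff l2 t = 0 -> aff l3 t <> 0) ->
    (forall t, aff l2 t = 0 -> aff l4 t <> 0) ->
    (forall t, aff l3 t = 0 -> aff l4 t <> 0) ->
  all_pos [:: l1; l2; l3; l4] 0 (+) all_pos [:: l1; l2; l3; l4] 1 =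
  vanishing_under l1 [:: l2; l3; l4] (+)
    (vanishing_under l2 [:: l1; l3; l4] (+)
    (vanishing_under l3 [:: l1; l2; l4] (+)
     vanishing_under l4 [:: l1; l2; l3])).
Proof.
move=> ends n12 n13 n14 n23 n24 n34.
have e l : l \in [:: l1; l2; l3; l4] -> aff l 0 != 0 by move=> /ends[].
rewrite (@boundary_parity_even _ 0 1 ltr01) //=; last first.
  split=> [m|]; first by rewrite !inE => /or3P[]/eqP->; apply: aff_common_root.
  split=> [m|]; last by split=> // m; rewrite inE => /eqP->; apply: aff_common_root.
  by rewrite !inE => /orP[]/eqP->; apply: aff_common_root.
by rewrite addbF !vanishing_underE ?e ?inE ?eqxx ?orbT //= -!andbA.
Qed.

End AffineFunctions.

(** * Crossings of projected segments *)

Section Crossings.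
Variable R : realFieldType.
Implicit Types (p a b c : 'rV[R]_3) (l : R * R) (u v s t : R).

Definition xcoord p := p 0 0.
Definition ycoord p := p 0 1.
Definition zcoord p := p 0 2.

Definition lerp u v t := u + (v - u) * t.

(** An over-crossing of the diagram obtained by projecting along the third axis. *)
Definition crosses_over a0 a1 b0 b1 : bool :=
  `[< exists s t, [/\ 0 < s < 1, 0 < t < 1,
        lerp (xcoord a0) (xcoord a1) s = lerp (xcoord b0) (xcoord b1) t,
        lerp (ycoord a0) (ycoord a1) s = lerp (ycoord b0) (ycoord b1) t
      & lerp (zcoord b0) (zcoord b1) t < lerp (zcoord a0) (zcoord a1) s] >].

(** Here and in [lies_below], above and below refer to the second coordinate in the
    plane of projection. *)
Definition lies_above p b0 b1 : bool :=
  `[< exists t, [/\ 0 < t < 1, lerp (xcoord b0) (xcoord b1) t = xcoord p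
                 & lerp (ycoord b0) (ycoord b1) t < ycoord p] >].

Definition lies_below p b0 b1 : bool :=
  `[< exists t, [/\ 0 < t < 1, lerp (xcoord b0) (xcoord b1) t = xcoord p
                 & ycoord p < lerp (ycoord b0) (ycoord b1) t] >].

Definition left_of p q : bool := xcoord p < xcoord q.

Definition det2 (x0 y0 x1 y1 x2 y2 : R) :=
  (x1 - x0) * (y2 - y0) - (y1 - y0) * (x2 - x0).

Definition area a b c := det2 (xcoord a) (ycoord a) (xcoord b) (ycoord b) (xcoord c) (ycoord c).

Definition volume a b c d :=
  (zcoord b - zcoord a)
    * det2 0 0 (xcoord c - xcoord a) (ycoord c - ycoord a)
             (xcoord d - xcoord a) (ycoord d - ycoord a)
  - (zcoord c - zcoord a)
    * det2 0 0 (xcoord b - xcoord a) (ycoord b - ycoord a)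
             (xcoord d - xcoord a) (ycoord d - ycoord a)
  + (zcoord d - zcoord a)
    * det2 0 0 (xcoord b - xcoord a) (ycoord b - ycoord a)
             (xcoord c - xcoord a) (ycoord c - ycoord a).

Lemma areaC a b c : area a c b = - area a b c.
Proof. by rewrite /area /det2; ring. Qed.

Lemma volumeC a b c d : volume a b d c = - volume a b c d.
Proof. by rewrite /volume /det2; ring. Qed.

Lemma lerpC u v t : lerp u v (1 - t) = lerp v u t.
Proof. by rewrite /lerp; ring. Qed.

Lemma unit_intervalC t : (0 < 1 - t < 1) = (0 < t < 1).
Proof. by rewrite subr_gt0 andbC; congr (_ && _); lra. Qed.

Lemma crosses_overCl a0 a1 b0 b1 : crosses_over a1 a0 b0 b1 = crosses_over a0 a1 b0 b1.
Proof.
apply/asboolP/asboolP => -[s [t [s01 t01 ex ey ez]]];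
by exists (1 - s), t; rewrite unit_intervalC !lerpC.
Qed.

Lemma crosses_overCr a0 a1 b0 b1 : crosses_over a0 a1 b1 b0 = crosses_over a0 a1 b0 b1.
Proof.
apply/asboolP/asboolP => -[s [t [s01 t01 ex ey ez]]];
by exists s, (1 - t); rewrite unit_intervalC !lerpC.
Qed.

Lemma lies_aboveC p b0 b1 : lies_above p b1 b0 = lies_above p b0 b1.
Proof.
by apply/asboolP/asboolP => -[t [t01 ex ey]];
exists (1 - t); rewrite unit_intervalC !lerpC.
Qed.

Lemma lies_belowC p b0 b1 : lies_below p b1 b0 = lies_below p b0 b1.
Proof.
by apply/asboolP/asboolP => -[t [t01 ex ey]];
exists (1 - t); rewrite unit_intervalC !lerpC.
Qed.

Lemma lerp_eq_sub (a0 a1 b0 b1 s t : R) : lerp a0 a1 s = lerp b0 b1 t ->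
  b0 - a0 = (a1 - a0) * s - (b1 - b0) * t /\
  b1 - a0 = (a1 - a0) * s + (b1 - b0) * (1 - t).
Proof.
rewrite /lerp => e; have e1 : b0 - a0 = (a1 - a0) * s - (b1 - b0) * t.
  apply/eqP; rewrite -subr_eq0.
  have -> : b0 - a0 - ((a1 - a0) * s - (b1 - b0) * t)
    = (b0 + (b1 - b0) * t) - (a0 + (a1 - a0) * s) by ring.
  by rewrite e subrr.
by split=> //; rewrite -(subrK b0 b1) -addrA e1; ring.
Qed.

Lemma area_lerp b0 b1 c t : lerp (xcoord b0) (xcoord b1) t = xcoord c ->
  lerp (ycoord b0) (ycoord b1) t = ycoord c -> area c b0 b1 = 0.
Proof. by rewrite /area /det2 => <- <-; rewrite /lerp; ring. Qed.

Lemma volume_lerp a0 a1 b0 b1 s t :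
  lerp (xcoord a0) (xcoord a1) s = lerp (xcoord b0) (xcoord b1) t ->
  lerp (ycoord a0) (ycoord a1) s = lerp (ycoord b0) (ycoord b1) t ->
  lerp (zcoord a0) (zcoord a1) s = lerp (zcoord b0) (zcoord b1) t -> volume a0 a1 b0 b1 = 0.
Proof.
move=> /lerp_eq_sub[x0 x1] /lerp_eq_sub[y0 y1] /lerp_eq_sub[z0 z1].
by rewrite /volume /det2 !subr0 x0 x1 y0 y1 z0 z1; ring.
Qed.

(** The line through [p] parallel to the second axis meets the segment exactly when
    the first coordinate of [p] is between those of the ends. *)
Lemma lies_above_below p b0 b1 : area p b0 b1 != 0 ->
    xcoord b0 != xcoord b1 -> xcoord b0 != xcoord p -> xcoord b1 != xcoord p ->
  lies_above p b0 b1 (+) lies_below p b0 b1 = left_of b0 p (+) left_of b1 p.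
Proof.
wlog lt01 : b0 b1 / xcoord b0 < xcoord b1 => [hw|].
  move=> ar n01 n0 n1; have [/hw->//|lt10|/eqP] := ltgtP (xcoord b0) (xcoord b1).
    rewrite -lies_aboveC -lies_belowC [RHS]addbC; apply: hw => //; last by rewrite eq_sym.
    by rewrite areaC oppr_eq0.
  by rewrite (negPf n01).
move=> ar _ n0 n1; rewrite /left_of.
pose t := (xcoord p - xcoord b0) / (xcoord b1 - xcoord b0).
have d0 : xcoord b1 - xcoord b0 != 0 by lra.
have tE : lerp (xcoord b0) (xcoord b1) t = xcoord p by rewrite /lerp /t; field.
have tU s : lerp (xcoord b0) (xcoord b1) s = xcoord p -> s = t.
  by rewrite /lerp /t => <-; field.
have yE : lerp (ycoord b0) (ycoord b1) t != ycoord p.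
  apply: contra_neq ar => e; rewrite /area /det2 -tE -e /lerp; ring.
have t01 : (0 < t < 1) = (xcoord b0 < xcoord p) && (xcoord p < xcoord b1).
  have dp : 0 < xcoord b1 - xcoord b0 by lra.
  by rewrite /t ltr_pdivlMr // mul0r ltr_pdivrMr // mul1r subr_gt0 ltrD2r.
have -> : lies_above p b0 b1 = (0 < t < 1) && (lerp (ycoord b0) (ycoord b1) t < ycoord p).
  by apply/asboolP/andP => [[s [s01 /tU <-]]//|[]]; exists t.
have -> : lies_below p b0 b1 = (0 < t < 1) && (ycoord p < lerp (ycoord b0) (ycoord b1) t).
  by apply/asboolP/andP => [[s [s01 /tU <-]]//|[]]; exists t.
rewrite t01.
by case: (ltgtP (lerp _ _ _) _) yE => //= _ _; case: (ltgtP (xcoord b0) (xcoord p)) n0 => // h _;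
   case: (ltgtP (xcoord b1) (xcoord p)) n1 => // h' _ //=; lra.
Qed.

(** The left-hand side counts the crossings of the projections, whichever segment is
    on top.  A point that moves along the first segment enters or leaves the
    region above the second one either through that segment, at a crossing, or
    through the half-line above one of its ends, and then this end lies below
    the first segment. *)
Lemma crossing_parity a0 a1 b0 b1 :
    xcoord a0 != xcoord a1 -> xcoord b0 != xcoord b1 ->
    xcoord a0 != xcoord b0 -> xcoord a0 != xcoord b1 ->
    xcoord a1 != xcoord b0 -> xcoord a1 != xcoord b1 ->
    area a0 b0 b1 != 0 -> area a1 b0 b1 != 0 ->
    area b0 a0 a1 != 0 -> area b1 a0 a1 != 0 -> volume a0 a1 b0 b1 != 0 ->
  crosses_over a0 a1 b0 b1 (+) crosses_over b0 b1 a0 a1 =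
    (lies_above a0 b0 b1 (+) lies_above a1 b0 b1) (+) (lies_below b0 a0 a1 (+) lies_below b1 a0 a1).
Proof.
wlog ltb : b0 b1 / xcoord b0 < xcoord b1 => [hw|].
  move=> na nb n00 n01 n10 n11 s0 s1 s2 s3 vol.
  have [/hw->//|gtb|/eqP] := ltgtP (xcoord b0) (xcoord b1); last by rewrite (negPf nb).
  rewrite -crosses_overCr -(crosses_overCl b0 b1) -(lies_aboveC a0)
    -(lies_aboveC a1) (addbC (lies_below b0 _ _)).
  apply: hw => //; rewrite ?(areaC _ b0) ?oppr_eq0 //; try by rewrite eq_sym.
  by rewrite volumeC oppr_eq0.
move=> na _ n00 n01 n10 n11 s0 s1 s2 s3 vol.
pose k := (ycoord b1 - ycoord b0) / (xcoord b1 - xcoord b0).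
have db : xcoord b1 - xcoord b0 != 0 by lra.
have kE : k * (xcoord b1 - xcoord b0) = ycoord b1 - ycoord b0 by rewrite /k; field.
pose h a := ycoord a - ycoord b0 - k * (xcoord a - xcoord b0).
pose l1 := (xcoord a0 - xcoord b0, xcoord a1 - xcoord a0).
pose l2 := (xcoord b1 - xcoord a0, xcoord a0 - xcoord a1).
pose l3 := (h a0, h a1 - h a0).
have l1E t : aff l1 t = lerp (xcoord a0) (xcoord a1) t - xcoord b0.
  by rewrite /aff /lerp /=; ring.
have l2E t : aff l2 t = xcoord b1 - lerp (xcoord a0) (xcoord a1) t.
  by rewrite /aff /lerp /=; ring.
have l3E t : aff l3 t =
    lerp (ycoord a0) (ycoord a1) t - ycoord b0 - k * (lerp (xcoord a0) (xcoord a1) t - xcoord b0).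
  by rewrite /aff /lerp /l3 /h /=; ring.
have aff1 u v : u + (v - u) * 1 = v by rewrite mulr1 addrC subrK.
have aff0 u v : u + (v - u) * 0 = u by rewrite mulr0 addr0.
have hE a : h a * (xcoord b1 - xcoord b0) = area a b0 b1.
  have -> : h a * (xcoord b1 - xcoord b0)
      = (ycoord a - ycoord b0) * (xcoord b1 - xcoord b0)
         - (xcoord a - xcoord b0) * (k * (xcoord b1 - xcoord b0)).
    by rewrite /h; ring.
  by rewrite kE /area /det2; ring.
have nh a : area a b0 b1 != 0 -> h a != 0.
  by apply: contra_neq => h0; rewrite -hE h0 mul0r.
have pb : 0 < xcoord b1 - xcoord b0 by lra.
have aboveE a : lies_above a b0 b1 =
    [&& 0 < xcoord a - xcoord b0, 0 < xcoord b1 - xcoord a, 0 < h a & true].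
  rewrite andbT; apply/asboolP/and3P => [[t [/andP[t0 t1] ex ey]]|[p0 p1 p2]].
    have hE' : h a = ycoord a - lerp (ycoord b0) (ycoord b1) t.
      by rewrite /h -ex /lerp -kE; ring.
    rewrite hE' -ex; split; rewrite /lerp; last by rewrite subr_gt0.
      by rewrite addrAC subrr add0r mulr_gt0.
    have -> : xcoord b1 - (xcoord b0 + (xcoord b1 - xcoord b0) * t) =
        (xcoord b1 - xcoord b0) * (1 - t) by ring.
    by rewrite mulr_gt0 // subr_gt0.
  exists ((xcoord a - xcoord b0) / (xcoord b1 - xcoord b0)).
  rewrite ltr_pdivlMr // mul0r ltr_pdivrMr // mul1r; split; first by lra.
    by rewrite /lerp; field.
  rewrite /lerp -kE.
  have -> : k * (xcoord b1 - xcoord b0) * ((xcoord a - xcoord b0) / (xcoord b1 - xcoord b0)) =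
      k * (xcoord a - xcoord b0) by field.
  by move: p2; rewrite /h; lra.
rewrite !aboveE.
have e10 : aff l1 0 = xcoord a0 - xcoord b0 by rewrite l1E /lerp aff0.
have e20 : aff l2 0 = xcoord b1 - xcoord a0 by rewrite l2E /lerp aff0.
have e30 : aff l3 0 = h a0 by rewrite /aff aff0.
have e11 : aff l1 1 = xcoord a1 - xcoord b0 by rewrite l1E /lerp aff1.
have e21 : aff l2 1 = xcoord b1 - xcoord a1 by rewrite l2E /lerp aff1.
have e31 : aff l3 1 = h a1 by rewrite /aff aff1.
rewrite -e10 -e20 -e30 -e11 -e21 -e31.
have la t : aff l1 t = 0 -> lerp (xcoord a0) (xcoord a1) t = xcoord b0 by rewrite l1E; lra.
have lb t : aff l2 t = 0 -> lerp (xcoord a0) (xcoord a1) t = xcoord b1 by rewrite l2E; lra.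
have := @boundary_parity3 _ l1 l2 l3; rewrite /all_pos /= => ->; first last.
- move=> t /[dup] /lb xE; rewrite l2E l3E => e2 e3.
  case/eqP: s3; apply: (@area_lerp _ _ _ t) => //.
  have : k * (lerp (xcoord a0) (xcoord a1) t - xcoord b0) = k * (xcoord b1 - xcoord b0) by rewrite xE.
  by lra.
- move=> t /[dup] /la xE; rewrite l1E l3E => e1; rewrite e1 mulr0 => e3.
  by case/eqP: s2; apply: (@area_lerp _ _ _ t) => //; lra.
- by move=> t /la xE; rewrite l2E xE; apply/eqP.
- move=> l; rewrite !inE => /or3P[] /eqP->.
  + by rewrite e10 e11 !subr_eq0.
  + by rewrite e20 e21 !subr_eq0 ![xcoord b1 == _]eq_sym.
  + by rewrite e30 e31 !nh.
have -> : vanishing_under l1 [:: l2; l3] = lies_below b0 a0 a1.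
  + apply: asbool_equiv_eq; split=> -[t []] => [t01|].
      rewrite l1E /all_pos /= andbT l3E => e1 /andP[_ e2].
      exists t; split=> //; first lra.
      by move: e2; rewrite e1; lra.
    move=> t01 e1 e2; exists t; rewrite /all_pos /= l1E l2E l3E e1.
    by split=> //; [lra|apply/and3P; split=> //; lra].
have -> : vanishing_under l2 [:: l1; l3] = lies_below b1 a0 a1.
  + apply: asbool_equiv_eq; split=> -[t []] => [t01|].
      rewrite l2E /all_pos /= andbT l3E => e1 /andP[_ e2].
      have e3 : lerp (xcoord a0) (xcoord a1) t = xcoord b1 by lra.
      exists t; split=> //.
      by move: e2; rewrite e3; lra.
    move=> t01 e1 e2; exists t; rewrite /all_pos /= l1E l2E l3E e1.
    by split=> //; [lra|apply/and3P; split=> //; lra].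
have crossE s t : lerp (xcoord a0) (xcoord a1) s = lerp (xcoord b0) (xcoord b1) t ->
    lerp (ycoord a0) (ycoord a1) s = lerp (ycoord b0) (ycoord b1) t ->
    [/\ aff l1 s = (xcoord b1 - xcoord b0) * t, aff l2 s = (xcoord b1 - xcoord b0) * (1 - t)
      & aff l3 s = 0].
  move=> ex ey; rewrite l1E l2E l3E ex ey; split.
  - by rewrite /lerp; ring.
  - by rewrite /lerp; ring.
  - rewrite /lerp -kE; ring.
have root3 s s' : aff l3 s = 0 -> aff l3 s' = 0 -> s = s'.
  have : h a0 != 0 by rewrite nh.
  rewrite /aff /=; set q := h a1 - _ => h0 es es'.
  have q0 : q != 0 by apply: contraNneq h0 => q0; move: es; rewrite q0 mul0r addr0 => ->.
  by apply: (mulfI q0 (addrI (h a0) _)); rewrite es es'.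
have cross_van s t : 0 < s < 1 -> 0 < t < 1 ->
    lerp (xcoord a0) (xcoord a1) s = lerp (xcoord b0) (xcoord b1) t ->
    lerp (ycoord a0) (ycoord a1) s = lerp (ycoord b0) (ycoord b1) t ->
    vanishing_under l3 [:: l1; l2].
  move=> s01 /andP[t0 t1] ex ey; have [f1 f2 f3] := crossE _ _ ex ey.
  apply/asboolP; exists s; split=> //.
  by rewrite /all_pos /= f1 f2 !mulr_gt0 // subr_gt0.
suff -> : vanishing_under l3 [:: l1; l2] = crosses_over a0 a1 b0 b1 (+) crosses_over b0 b1 a0 a1.
  by case: lies_below; case: lies_below; rewrite ?addbF ?addbT /= ?negbK.
apply/idP/idP; last first.
  case: (boolP (crosses_over a0 a1 b0 b1)) => [/asboolP[s [t [s01 t01 ex ey _]]] _|_] /=.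
    exact: (cross_van s t s01 t01 ex ey).
  case: (boolP (crosses_over b0 b1 a0 a1)) => [/asboolP[t [s [t01 s01 ex ey _]]] _|//].
  exact: (cross_van s t s01 t01 (esym ex) (esym ey)).
case/asboolP => s [s01 f3 /and3P[]]; rewrite l1E l2E => f1 f2 _.
have [t ext] : exists t, lerp (xcoord a0) (xcoord a1) s = lerp (xcoord b0) (xcoord b1) t.
  exists ((lerp (xcoord a0) (xcoord a1) s - xcoord b0) / (xcoord b1 - xcoord b0)).
  by rewrite {2}/lerp; field.
have eyt : lerp (ycoord a0) (ycoord a1) s = lerp (ycoord b0) (ycoord b1) t.
  by move: f3; rewrite l3E ext /lerp -kE; set A := ycoord a0 + _ => ?; lra.
have t01 : 0 < t < 1.
  have [g1 g2 _] := crossE _ _ ext eyt.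
  move: f1 f2; rewrite -l1E -l2E g1 g2 !(pmulr_rgt0 _ pb) subr_gt0.
  by move=> -> ->.
have uniq s' t' : lerp (xcoord a0) (xcoord a1) s' = lerp (xcoord b0) (xcoord b1) t' ->
    lerp (ycoord a0) (ycoord a1) s' = lerp (ycoord b0) (ycoord b1) t' -> s' = s /\ t' = t.
  move=> ex ey; have [g1 _ g3] := crossE _ _ ex ey.
  have ss : s' = s by apply: root3.
  split=> //; have [g1' _ _] := crossE _ _ ext eyt.
  by apply: (mulfI db); rewrite -g1 -g1' ss.
have [ltz|ltz|ez] := ltgtP (lerp (zcoord b0) (zcoord b1) t) (lerp (zcoord a0) (zcoord a1) s).
- have -> : crosses_over a0 a1 b0 b1 by apply/asboolP; exists s, t.
  case: (boolP (crosses_over b0 b1 a0 a1)) => // /asboolP[t' [s' [_ _ ex ey]]].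
  by have [-> ->] := uniq s' t' (esym ex) (esym ey); rewrite ltNge (ltW ltz).
- have -> : crosses_over b0 b1 a0 a1 by apply/asboolP; exists t, s.
  case: (boolP (crosses_over a0 a1 b0 b1)) => // /asboolP[s' [t' [_ _ ex ey]]].
  by have [-> ->] := uniq s' t' ex ey; rewrite ltNge (ltW ltz).
by case/eqP: vol; apply: (volume_lerp ext eyt).
Qed.

End Crossings.

(** * A segment and a triangle *)

Section Triangles.
Variable R : realFieldType.
Implicit Types (p a b c : 'rV[R]_3) (t : R).

(** The shadow is the prism of the points strictly below the open triangle, in the
    direction of projection. *)
Definition in_shadow a0 a1 a2 p : bool :=
  `[< exists l0 l1 l2, [/\ [/\ 0 < l0, 0 < l1, 0 < l2 & l0 + l1 + l2 = 1],
        l0 * xcoord a0 + l1 * xcoord a1 + l2 * xcoord a2 = xcoord p,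
        l0 * ycoord a0 + l1 * ycoord a1 + l2 * ycoord a2 = ycoord p
      & zcoord p < l0 * zcoord a0 + l1 * zcoord a1 + l2 * zcoord a2] >].

Definition pierces b0 b1 a0 a1 a2 : Prop :=
  exists t l0 l1 l2, [/\ 0 < t < 1, [/\ 0 < l0, 0 < l1, 0 < l2 & l0 + l1 + l2 = 1],
        l0 * xcoord a0 + l1 * xcoord a1 + l2 * xcoord a2 = lerp (xcoord b0) (xcoord b1) t,
        l0 * ycoord a0 + l1 * ycoord a1 + l2 * ycoord a2 = lerp (ycoord b0) (ycoord b1) t
      & l0 * zcoord a0 + l1 * zcoord a1 + l2 * zcoord a2 = lerp (zcoord b0) (zcoord b1) t].

(** A point that moves along the segment enters or leaves the shadow of the triangle
    through a side wall, where the segment passes under a side of the triangle,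
    or through the triangle itself, which is excluded.  The four affine
    functions are the barycentric coordinates of the projected point and its
    depth below the plane of the triangle. *)
Lemma crosses_over_triangle a0 a1 a2 b0 b1 :
    area a0 a1 a2 != 0 ->
    (forall b, b \in [:: b0; b1] ->
      [/\ area b a1 a2 != 0, area a0 b a2 != 0, area a0 a1 b != 0
        & volume a0 a1 a2 b != 0]) ->
    (forall a, a \in [:: a0; a1; a2] -> area a b0 b1 != 0) ->
    volume a1 a2 b0 b1 != 0 -> volume a0 a2 b0 b1 != 0 ->
    volume a0 a1 b0 b1 != 0 ->
    ~ pierces b0 b1 a0 a1 a2 ->
  crosses_over a1 a2 b0 b1 (+) (crosses_over a0 a2 b0 b1 (+) crosses_over a0 a1 b0 b1) =
    in_shadow a0 a1 a2 b0 (+) in_shadow a0 a1 a2 b1.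
Proof.
set D := area a0 a1 a2 => D0 endb enda v12 v02 v01 nopierce.
pose w0 p := area p a1 a2 / D.
pose w1 p := area a0 p a2 / D.
pose w2 p := area a0 a1 p / D.
pose g p := w0 p * zcoord a0 + w1 p * zcoord a1 + w2 p * zcoord a2 - zcoord p.
have DE : D = det2 (xcoord a0) (ycoord a0) (xcoord a1) (ycoord a1) (xcoord a2) (ycoord a2) by [].
have wS p : w0 p + w1 p + w2 p = 1.
  apply: (mulIf D0); rewrite !mulrDl !divfK // mul1r DE /area /det2; ring.
have wX p : w0 p * xcoord a0 + w1 p * xcoord a1 + w2 p * xcoord a2 = xcoord p.
  apply: (mulIf D0); rewrite !mulrDl !(mulrAC _ (xcoord _)) !divfK // DE /area /det2; ring.
have wY p : w0 p * ycoord a0 + w1 p * ycoord a1 + w2 p * ycoord a2 = ycoord p.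
  apply: (mulIf D0); rewrite !mulrDl !(mulrAC _ (ycoord _)) !divfK // DE /area /det2; ring.
have gV p : g p * D = - volume a0 a1 a2 p.
  rewrite /g mulrBl !mulrDl !(mulrAC _ (zcoord _)) !divfK // DE /area /volume /det2; ring.
pose L0 := (w0 b0, w0 b1 - w0 b0).
pose L1 := (w1 b0, w1 b1 - w1 b0).
pose L2 := (w2 b0, w2 b1 - w2 b0).
pose Lg := (g b0, g b1 - g b0).
have comb t (c0 c1 c2 : R) : aff L0 t * c0 + aff L1 t * c1 + aff L2 t * c2 =
   lerp (w0 b0 * c0 + w1 b0 * c1 + w2 b0 * c2) (w0 b1 * c0 + w1 b1 * c1 + w2 b1 * c2) t.
  by rewrite /aff /lerp /=; ring.
have aS t : aff L0 t + aff L1 t + aff L2 t = 1.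
  by have := comb t 1 1 1; rewrite !mulr1 !wS => ->; rewrite /lerp subrr mul0r addr0.
have aX t : aff L0 t * xcoord a0 + aff L1 t * xcoord a1 + aff L2 t * xcoord a2 =
    lerp (xcoord b0) (xcoord b1) t.
  by rewrite comb !wX.
have aY t : aff L0 t * ycoord a0 + aff L1 t * ycoord a1 + aff L2 t * ycoord a2 =
    lerp (ycoord b0) (ycoord b1) t.
  by rewrite comb !wY.
have aZ t : aff Lg t = aff L0 t * zcoord a0 + aff L1 t * zcoord a1 + aff L2 t * zcoord a2
    - lerp (zcoord b0) (zcoord b1) t.
  by rewrite comb /aff /Lg /g /lerp /=; ring.
have uniq t l0 l1 l2 : l0 + l1 + l2 = 1 ->
    l0 * xcoord a0 + l1 * xcoord a1 + l2 * xcoord a2 = lerp (xcoord b0) (xcoord b1) t ->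
    l0 * ycoord a0 + l1 * ycoord a1 + l2 * ycoord a2 = lerp (ycoord b0) (ycoord b1) t ->
    [/\ aff L0 t = l0, aff L1 t = l1 & aff L2 t = l2].
  move=> lS; rewrite -aX -aY; set m1 := aff L1 t; set m2 := aff L2 t => lX lY.
  have m0E : aff L0 t = 1 - m1 - m2 by rewrite -(aS t) -/m1 -/m2; ring.
  have l0E : l0 = 1 - l1 - l2 by rewrite -lS; ring.
  move: lX lY; rewrite m0E l0E => lX lY.
  have eX : (m1 - l1) * (xcoord a1 - xcoord a0) + (m2 - l2) * (xcoord a2 - xcoord a0) = 0.
    rewrite -[RHS](subrr ((1 - l1 - l2) * xcoord a0 + l1 * xcoord a1 + l2 * xcoord a2)) {1}lX; ring.
  have eY : (m1 - l1) * (ycoord a1 - ycoord a0) + (m2 - l2) * (ycoord a2 - ycoord a0) = 0.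
    rewrite -[RHS](subrr ((1 - l1 - l2) * ycoord a0 + l1 * ycoord a1 + l2 * ycoord a2)) {1}lY; ring.
  have e1 : m1 = l1.
    apply/eqP; rewrite -subr_eq0 -(mulIr_eq0 _ (mulIf D0)) DE /det2; apply/eqP.
    transitivity (((m1 - l1) * (xcoord a1 - xcoord a0) + (m2 - l2) * (xcoord a2 - xcoord a0))
      * (ycoord a2 - ycoord a0)
      - ((m1 - l1) * (ycoord a1 - ycoord a0) + (m2 - l2) * (ycoord a2 - ycoord a0))
      * (xcoord a2 - xcoord a0)); first by ring.
    by rewrite eX eY !mul0r subrr.
  have e2 : m2 = l2.
    apply/eqP; rewrite -subr_eq0 -(mulIr_eq0 _ (mulIf D0)) DE /det2; apply/eqP.
    transitivity (((m1 - l1) * (ycoord a1 - ycoord a0) + (m2 - l2) * (ycoord a2 - ycoord a0))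
      * (xcoord a1 - xcoord a0)
      - ((m1 - l1) * (xcoord a1 - xcoord a0) + (m2 - l2) * (xcoord a2 - xcoord a0))
      * (ycoord a1 - ycoord a0)); first by ring.
    by rewrite eX eY !mul0r subrr.
  by rewrite e1 e2.
have aff1 l : aff l 1 = l.1 + l.2 by rewrite /aff mulr1.
have aff0 l : aff l 0 = l.1 by rewrite /aff mulr0 addr0.
have L01 : aff L0 1 = w0 b1 by rewrite aff1 /= addrC subrK.
have L11 : aff L1 1 = w1 b1 by rewrite aff1 /= addrC subrK.
have L21 : aff L2 1 = w2 b1 by rewrite aff1 /= addrC subrK.
have Lg1 : aff Lg 1 = g b1 by rewrite aff1 /= addrC subrK.
have shadowE b t : aff L0 t = w0 b -> aff L1 t = w1 b -> aff L2 t = w2 b ->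
    lerp (xcoord b0) (xcoord b1) t = xcoord b -> lerp (ycoord b0) (ycoord b1) t = ycoord b ->
    lerp (zcoord b0) (zcoord b1) t = zcoord b ->
  in_shadow a0 a1 a2 b = all_pos [:: L0; L1; L2; Lg] t.
  move=> E0 E1 E2 EX EY EZ; rewrite /all_pos /= andbT aZ EZ subr_gt0.
  apply/asboolP/and4P => [[l0 [l1 [l2 [[l00 l10 l20 lS] lX lY lZ]]]]|[p0 p1 p2 pz]].
    by have [-> -> ->] : [/\ aff L0 t = l0, aff L1 t = l1 & aff L2 t = l2];
      [apply: uniq; rewrite ?EX ?EY |].
  exists (aff L0 t), (aff L1 t), (aff L2 t).
  by rewrite aS aX aY EX EY.
have lerpE (u v s : R) : lerp u v s = (1 - s) * u + s * v by rewrite /lerp; ring.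
have lerp1 u v : lerp u v 1 = v by rewrite /lerp mulr1 addrC subrK.
have lerp0 u v : lerp u v 0 = u by rewrite /lerp mulr0 addr0.
rewrite (shadowE b0 0) ?aff0 ?lerp0 // (shadowE b1 1) ?lerp1 //.
rewrite boundary_parity4.
- have -> : vanishing_under Lg [:: L0; L1; L2] = false.
    apply/asboolP => -[t [t01 gt /and4P[p0 p1 p2 _]]]; apply: nopierce.
    exists t, (aff L0 t), (aff L1 t), (aff L2 t); split=> //.
    by apply/eqP; rewrite -subr_eq0 -aZ gt.
  rewrite addbF; congr (_ (+) (_ (+) _)); apply/asboolP/asboolP.
  + case=> s [t [/andP[s0 s1] t01]]; rewrite (lerpE (xcoord a1)) (lerpE (ycoord a1))
      (lerpE (zcoord a1)) => ex ey ez.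
    have [E0 E1 E2] : [/\ aff L0 t = 0, aff L1 t = 1 - s & aff L2 t = s].
      by apply: uniq; rewrite ?mul0r ?add0r ?ex ?ey ?subrK.
    exists t; rewrite /all_pos /= andbT aZ E0 E1 E2 mul0r add0r !subr_gt0.
    by split=> //; rewrite s0 s1 ez.
  + case=> t [t01 E0 /and4P[p1 p2 pz _]].
    have E1 : aff L1 t = 1 - aff L2 t by rewrite -(aS t) E0 add0r addrK.
    have := aX t; have := aY t; move: pz; rewrite aZ E0 E1 !mul0r !add0r subr_gt0.
    rewrite -!lerpE => ez ey ex; exists (aff L2 t), t; split=> //.
    by rewrite p2 -subr_gt0 -E1.
  + case=> s [t [/andP[s0 s1] t01]]; rewrite (lerpE (xcoord a0)) (lerpE (ycoord a0))
      (lerpE (zcoord a0)) => ex ey ez.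
    have [E0 E1 E2] : [/\ aff L0 t = 1 - s, aff L1 t = 0 & aff L2 t = s].
      by apply: uniq; rewrite ?mul0r ?addr0 ?ex ?ey ?subrK.
    exists t; rewrite /all_pos /= andbT aZ E0 E1 E2 mul0r addr0 !subr_gt0.
    by split=> //; rewrite s0 s1 ez.
  + case=> t [t01 E1 /and4P[p0 p2 pz _]].
    have E0 : aff L0 t = 1 - aff L2 t by rewrite -(aS t) E1 addr0 addrK.
    have := aX t; have := aY t; move: pz; rewrite aZ E0 E1 !mul0r !addr0 subr_gt0.
    rewrite -!lerpE => ez ey ex; exists (aff L2 t), t; split=> //.
    by rewrite p2 -subr_gt0 -E0.
  + case=> s [t [/andP[s0 s1] t01]]; rewrite (lerpE (xcoord a0)) (lerpE (ycoord a0))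
      (lerpE (zcoord a0)) => ex ey ez.
    have [E0 E1 E2] : [/\ aff L0 t = 1 - s, aff L1 t = s & aff L2 t = 0].
      by apply: uniq; rewrite ?mul0r ?addr0 ?ex ?ey ?subrK.
    exists t; rewrite /all_pos /= andbT aZ E0 E1 E2 mul0r addr0 !subr_gt0.
    by split=> //; rewrite s0 s1 ez.
  + case=> t [t01 E2 /and4P[p0 p1 pz _]].
    have E0 : aff L0 t = 1 - aff L1 t by rewrite -(aS t) E2 addr0 addrK.
    have := aX t; have := aY t; move: pz; rewrite aZ E0 E2 !mul0r !addr0 subr_gt0.
    rewrite -!lerpE => ez ey ex; exists (aff L1 t), t; split=> //.
    by rewrite p1 -subr_gt0 -E0.
- have gn0 b : volume a0 a1 a2 b != 0 -> g b != 0.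
    by apply: contra_neq => g0; rewrite -[LHS]opprK -gV g0 mul0r oppr0.
  have [n00 n10 n20 ng0] := endb b0 (mem_head _ _).
  have [n01 n11 n21 ng1] := endb b1 (mem_last b0 [:: b1]).
  move=> l; rewrite !inE => /or4P[] /eqP->; rewrite aff0 ?L01 ?L11 ?L21 ?Lg1 /=;
    by split; try exact: gn0; rewrite mulf_neq0 ?invr_eq0.
- move=> t E0 E1; have E2 : aff L2 t = 1 by rewrite -(aS t) E0 E1 !add0r.
  have := aX t; have := aY t; rewrite E0 E1 E2 !mul0r !add0r !mul1r => ey ex.
  by case/eqP: (enda a2 (mem_last a0 [:: a1; a2])); apply: area_lerp (esym ex) (esym ey).
- move=> t E0 E2; have E1 : aff L1 t = 1 by rewrite -(aS t) E0 E2 addr0 add0r.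
  have := aX t; have := aY t; rewrite E0 E1 E2 !mul0r !add0r !addr0 !mul1r => ey ex.
  have /eqP[] : area a1 b0 b1 != 0 by apply: enda; rewrite !inE eqxx orbT.
  exact: area_lerp (esym ex) (esym ey).
- move=> t E0; rewrite aZ => Eg; case/eqP: v12.
  have E1 : aff L1 t = 1 - aff L2 t by rewrite -(aS t) E0 add0r addrK.
  have := aX t; have := aY t; move/eqP: Eg; rewrite subr_eq0 E0 E1 !mul0r !add0r.
  by rewrite -!lerpE => /eqP ez ey ex; apply: (volume_lerp ex ey ez).
- move=> t E1 E2; have E0 : aff L0 t = 1 by rewrite -(aS t) E1 E2 !addr0.
  have := aX t; have := aY t; rewrite E0 E1 E2 !mul0r !addr0 !mul1r => ey ex.
  by case/eqP: (enda a0 (mem_head _ _)); apply: area_lerp (esym ex) (esym ey).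
- move=> t E1; rewrite aZ => Eg; case/eqP: v02.
  have E0 : aff L0 t = 1 - aff L2 t by rewrite -(aS t) E1 addr0 addrK.
  have := aX t; have := aY t; move/eqP: Eg; rewrite subr_eq0 E0 E1 !mul0r !addr0.
  by rewrite -!lerpE => /eqP ez ey ex; apply: (volume_lerp ex ey ez).
- move=> t E2; rewrite aZ => Eg; case/eqP: v01.
  have E0 : aff L0 t = 1 - aff L1 t by rewrite -(aS t) E2 addr0 addrK.
  have := aX t; have := aY t; move/eqP: Eg; rewrite subr_eq0 E0 E2 !mul0r !addr0.
  by rewrite -!lerpE => /eqP ez ey ex; apply: (volume_lerp ex ey ez).
Qed.

End Triangles.

(** * General position by perturbation *)

Section Perturbation.
Variable R : realType.
Implicit Types (e : R).

Lemma near_in_seq (T : Type) (U : eqType) (F : set_system T) (s : seq U) (P : U -> T -> Prop) :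
  Filter F -> (forall u, u \in s -> \forall x \near F, P u x) ->
  \forall x \near F, forall u, u \in s -> P u x.
Proof.
move=> FF; elim: s => [|v s IH] h; first exact: filterS filterT.
have h1 := h v (mem_head _ _).
have h2 : \forall x \near F, forall u, u \in s -> P u x.
  by apply: IH => u us; apply: h; rewrite inE us orbT.
by apply: filterS2 h1 h2 => x px ps u; rewrite inE => /predU1P[->|/ps].
Qed.

Lemma near_horner_neq0 (p : {poly R}) : p != 0 -> \forall e \near 0^'+, p.[e] != 0.
Proof.
elim/poly_ind: p => [|p c IH]; first by rewrite eqxx.
have [-> |c0 _] := eqVneq c 0.
  rewrite addr0 => /eqP pX.
  have p0 : p != 0 by apply/eqP => p0; apply: pX; rewrite p0 mul0r.
  near=> e.
  rewrite hornerMX; apply: mulf_neq0; first by near: e; apply: IH.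
  exact: lt0r_neq0.
have cont : (p * 'X + c%:P).[e] @[e --> 0^'+] --> c.
  have {2}<- : (p * 'X + c%:P).[0] = c by rewrite hornerMXaddC mulr0 add0r.
  exact/cvg_at_right_filter/continuous_horner.
have /cvgr_neq0 := cont.
exact.
Unshelve. all: by end_near.
Qed.

Definition det3 (x1 y1 z1 x2 y2 z2 x3 y3 z3 : R) :=
  z1 * det2 0 0 x2 y2 x3 y3 - z2 * det2 0 0 x1 y1 x3 y3 + z3 * det2 0 0 x1 y1 x2 y2.

Lemma det2_perturb (x1 y1 x2 y2 m1 k1 m2 k2 e : R) :
  det2 0 0 (x1 + e * m1) (y1 + e * k1) (x2 + e * m2) (y2 + e * k2) =
  det2 0 0 x1 y1 x2 y2 + (det2 0 0 x1 y1 m2 k2 + det2 0 0 m1 k1 x2 y2) * e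
  + det2 0 0 m1 k1 m2 k2 * e ^+ 2.
Proof. by rewrite /det2; ring. Qed.

Lemma det3_perturb (x1 y1 z1 x2 y2 z2 x3 y3 z3 m1 k1 n1 m2 k2 n2 m3 k3 n3 e : R) :
  det3 (x1 + e * m1) (y1 + e * k1) (z1 + e * n1) (x2 + e * m2) (y2 + e * k2)
     (z2 + e * n2) (x3 + e * m3) (y3 + e * k3) (z3 + e * n3) =
  det3 x1 y1 z1 x2 y2 z2 x3 y3 z3 +
  (det3 m1 k1 n1 x2 y2 z2 x3 y3 z3 + det3 x1 y1 z1 m2 k2 n2 x3 y3 z3
   + det3 x1 y1 z1 x2 y2 z2 m3 k3 n3) * e +
  (det3 m1 k1 n1 m2 k2 n2 x3 y3 z3 + det3 m1 k1 n1 x2 y2 z2 m3 k3 n3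
   + det3 x1 y1 z1 m2 k2 n2 m3 k3 n3) * e ^+ 2 +
  det3 m1 k1 n1 m2 k2 n2 m3 k3 n3 * e ^+ 3.
Proof. by rewrite /det3 /det2; ring. Qed.

Lemma near_cubic_neq0 (c0 c1 c2 c3 : R) : c3 != 0 ->
  \forall e \near 0^'+, c0 + c1 * e + c2 * e ^+ 2 + c3 * e ^+ 3 != 0.
Proof.
move=> c3n; pose p := Poly [:: c0; c1; c2; c3].
have p0 : p != 0.
  apply: contraNneq c3n => p0.
  by have := coef_Poly [:: c0; c1; c2; c3] 3; rewrite -/p p0 coef0 => /esym/eqP.
apply: filterS (near_horner_neq0 p0) => e; congr (_ != _).
by rewrite /p horner_Poly /=; ring.
Qed.

Lemma near_quadratic_neq0 (c0 c1 c2 : R) : c2 != 0 ->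
  \forall e \near 0^'+, c0 + c1 * e + c2 * e ^+ 2 != 0.
Proof.
move=> c2n; apply: filterS2 (near_cubic_neq0 0 c0 c1 c2n) (nbhs_right_gt 0) => e.
move=> + e0; apply: contra_neq => h.
by transitivity (e * (c0 + c1 * e + c2 * e ^+ 2)); [ring | rewrite h mulr0].
Qed.

Definition moment (n : nat) : 'rV[R]_3 := \row_(i < 3) n%:R ^+ i.+1.

Variable (L : countType) (pos : L -> 'rV[R]_3).

Definition perturbed e (l : L) := pos l + e *: moment (pickle l).

Record in_general_position (S : seq L) (P : L -> 'rV[R]_3) : Prop := {
  gp_xcoord : forall a b, uniq [:: a; b] -> {subset [:: a; b] <= S} ->
    xcoord (P a) != xcoord (P b);
  gp_area : forall a b c, uniq [:: a; b; c] -> {subset [:: a; b; c] <= S} ->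
    area (P a) (P b) (P c) != 0;
  gp_volume : forall a b c d, uniq [:: a; b; c; d] ->
    {subset [:: a; b; c; d] <= S} -> volume (P a) (P b) (P c) (P d) != 0 }.

Lemma coords_perturbed e l : let n := (pickle l)%:R in
  [/\ xcoord (perturbed e l) = xcoord (pos l) + e * n,
      ycoord (perturbed e l) = ycoord (pos l) + e * n ^+ 2
    & zcoord (perturbed e l) = zcoord (pos l) + e * n ^+ 3].
Proof. by rewrite /xcoord /ycoord /zcoord !mxE. Qed.

Lemma pickle_sub_neq0 (a b : L) : a != b -> (pickle b)%:R - (pickle a)%:R != 0 :> R.
Proof.
by rewrite subr_eq0 eqr_nat; apply: contra_neq => /(pcan_inj pickleK).
Qed.

(** Each degenerate position is a zero of a polynomial in [e].  Its top coefficient is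
    the same determinant taken on the moment curve, a product of differences of
    the numbers of the labels (Vandermonde), so it does not vanish, and the
    polynomial has no zeros in a punctured neighbourhood of 0. *)
Lemma near_in_general_position (S : seq L) :
  \forall e \near 0^'+, in_general_position S (perturbed e).
Proof.
have Xn a b : uniq [:: a; b] ->
    \forall e \near 0^'+, xcoord (perturbed e a) != xcoord (perturbed e b).
  rewrite /= inE andbT => ab; have := pickle_sub_neq0 ab.
  set m := (pickle a)%:R; set n := (pickle b)%:R => mn.
  have mX : (n - m) *: 'X + (xcoord (pos b) - xcoord (pos a))%:P != 0.
    apply: contraNneq mn => /(congr1 (fun p : {poly R} => p`_1)).
    by rewrite coefD coefZ coefX coefC /= mulr1 addr0 coef0 => ->.
  apply: filterS (near_horner_neq0 mX) => e.
  have [-> _ _] := coords_perturbed e a; have [-> _ _] := coords_perturbed e b.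
  rewrite hornerD hornerZ hornerX hornerC -/m -/n; apply: contra_neq => eX.
  by rewrite -[RHS](subrr (xcoord (pos a) + e * m)) {1}eX; ring.
have dX e a b : xcoord (perturbed e b) - xcoord (perturbed e a) =
    (xcoord (pos b) - xcoord (pos a)) + e * ((pickle b)%:R - (pickle a)%:R).
  have [-> _ _] := coords_perturbed e a; have [-> _ _] := coords_perturbed e b; ring.
have dY e a b : ycoord (perturbed e b) - ycoord (perturbed e a) =
    (ycoord (pos b) - ycoord (pos a)) + e * ((pickle b)%:R ^+ 2 - (pickle a)%:R ^+ 2).
  have [_ -> _] := coords_perturbed e a; have [_ -> _] := coords_perturbed e b; ring.
have dZ e a b : zcoord (perturbed e b) - zcoord (perturbed e a) =
    (zcoord (pos b) - zcoord (pos a)) + e * ((pickle b)%:R ^+ 3 - (pickle a)%:R ^+ 3).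
  have [_ _ ->] := coords_perturbed e a; have [_ _ ->] := coords_perturbed e b; ring.
have An a b c : uniq [:: a; b; c] -> \forall e \near 0^'+,
    area (perturbed e a) (perturbed e b) (perturbed e c) != 0.
  rewrite /= !inE negb_or andbT => /andP[/andP[ab ac] bc].
  have [] := (pickle_sub_neq0 ab, pickle_sub_neq0 ac, pickle_sub_neq0 bc).
  set m := (pickle a)%:R; set n := (pickle b)%:R; set p := (pickle c)%:R.
  move=> [mn mp np].
  have vdm : det2 0 0 (n - m) (n ^+ 2 - m ^+ 2) (p - m) (p ^+ 2 - m ^+ 2)
    = (n - m) * (p - m) * (p - n) by rewrite /det2; ring.
  have c2 : det2 0 0 (n - m) (n ^+ 2 - m ^+ 2) (p - m) (p ^+ 2 - m ^+ 2) != 0.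
    by rewrite vdm !mulf_neq0.
  apply: filterS (near_quadratic_neq0 _ _ c2) => e; apply: contra_neq => h; rewrite -[RHS]h.
  have areaE (x y z : 'rV[R]_3) : area x y z =
      det2 0 0 (xcoord y - xcoord x) (ycoord y - ycoord x) (xcoord z - xcoord x) (ycoord z - ycoord x).
    by rewrite /area /det2 !subr0.
  rewrite areaE !dX !dY -/m -/n -/p det2_perturb.
  by [].
have Vn a b c d : uniq [:: a; b; c; d] -> \forall e \near 0^'+,
    volume (perturbed e a) (perturbed e b) (perturbed e c) (perturbed e d) != 0.
  rewrite /= !inE !negb_or andbT => /and3P[/and3P[ab ac ad] /andP[bc bd] cd].
  have [] := (pickle_sub_neq0 ab, pickle_sub_neq0 ac, pickle_sub_neq0 ad,
              pickle_sub_neq0 bc, pickle_sub_neq0 bd, pickle_sub_neq0 cd).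
  set m := (pickle a)%:R; set n := (pickle b)%:R; set p := (pickle c)%:R.
  set q := (pickle d)%:R.
  move=> [] [] [] [] mn mp mq np nq pq.
  have vdm : det3 (n - m) (n ^+ 2 - m ^+ 2) (n ^+ 3 - m ^+ 3)
                (p - m) (p ^+ 2 - m ^+ 2) (p ^+ 3 - m ^+ 3)
                (q - m) (q ^+ 2 - m ^+ 2) (q ^+ 3 - m ^+ 3)
    = (n - m) * (p - m) * (q - m) * (p - n) * (q - n) * (q - p).
    by rewrite /det3 /det2; ring.
  have c3 : det3 (n - m) (n ^+ 2 - m ^+ 2) (n ^+ 3 - m ^+ 3)
                (p - m) (p ^+ 2 - m ^+ 2) (p ^+ 3 - m ^+ 3)
                (q - m) (q ^+ 2 - m ^+ 2) (q ^+ 3 - m ^+ 3) != 0.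
    by rewrite vdm !mulf_neq0.
  apply: filterS (near_cubic_neq0 _ _ _ c3) => e; apply: contra_neq => h; rewrite -[RHS]h.
  rewrite /volume -/(det3 _ _ _ _ _ _ _ _ _) !dX !dY !dZ -/m -/n -/p -/q det3_perturb.
  by [].
have near_imp (P : bool) (Q : R -> Prop) : (P -> \forall e \near 0^'+, Q e) ->
    \forall e \near 0^'+, P -> Q e.
  by case: P => [h|_]; [apply: filterS (h isT) | apply: nearW].
have h2 : \forall e \near 0^'+, forall a, a \in S -> forall b, b \in S ->
   uniq [:: a; b] -> xcoord (perturbed e a) != xcoord (perturbed e b).
  by do 2![apply: near_in_seq => ? _]; apply/near_imp/Xn.
have h3 : \forall e \near 0^'+, forall a, a \in S -> forall b, b \in S ->
   forall c, c \in S -> uniq [:: a; b; c] ->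
    area (perturbed e a) (perturbed e b) (perturbed e c) != 0.
  by do 3![apply: near_in_seq => ? _]; apply/near_imp/An.
have h4 : \forall e \near 0^'+, forall a, a \in S -> forall b, b \in S ->
   forall c, c \in S -> forall d, d \in S -> uniq [:: a; b; c; d] ->
    volume (perturbed e a) (perturbed e b) (perturbed e c) (perturbed e d) != 0.
  by do 4![apply: near_in_seq => ? _]; apply/near_imp/Vn.
have memS s : {subset s <= S} -> all (fun x => x \in S) s by move=> /allP.
apply: filterS3 h2 h3 h4 => e h2 h3 h4; split.
- by move=> a b u /memS /= /and3P[aS bS _]; apply: h2.
- by move=> a b c u /memS /= /and4P[aS bS cS _]; apply: h3.
- by move=> a b c d u /memS /= /and5P[aS bS cS dS _]; apply: h4.
Qed.
End Perturbation.

(** * Subdivided graphs and their crossing parities *)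

Notation "\xor_ ( i <- r ) F" := (\big[addb/false]_(i <- r) F)
  (at level 41, F at level 41, i, r at level 50).
Notation "\xor_ ( i < n ) F" := (\big[addb/false]_(i < n) F)
  (at level 41, F at level 41, i, n at level 50).

Lemma xor_telescope (g : nat -> bool) n :
  \xor_(k < n) (g k (+) g k.+1) = g 0%N (+) g n.
Proof.
elim: n => [|n IH]; first by rewrite big_ord0 addbb.
by rewrite big_ord_recr /= IH; case: (g 0%N); case: (g n); case: (g n.+1).
Qed.

(** A label [(l, (i, j, k))] names a point of the cone over the subdivided graph: the
    cutting point number [k] of the edge from [i] to [j], at the level [l] of the
    cone.  Level 0 is the graph itself. *)
Definition label : countType := (nat * (nat * nat * nat))%type.

(** The ends of an edge receive labels that depend only on the vertex, so that edges
    with a common vertex have a common end. *)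
Definition base_label (n i j k : nat) : nat * nat * nat :=
  if k == 0%N then (i, i, 0%N) else if k == n then (j, j, 0%N) else (i, j, k).

Definition edge_label n (e : nat * nat) k : label := (0%N, base_label n e.1 e.2 k).
Definition vertex_label (i : nat) : label := (0%N, (i, i, 0%N)).

(** Level [n.+1] holds the apex of the cone. *)
Definition labels (n : nat) : seq label :=
  [seq (l, b) | l <- iota 0 n.+2,
     b <- [seq (p, k) | p <- [seq (i, j) | i <- iota 0 7, j <- iota 0 7], k <- iota 0 n.+1]].

Lemma mem_labels n l i j k : (l <= n.+1)%N -> (i < 7)%N -> (j < 7)%N -> (k <= n)%N ->
  (l, (i, j, k)) \in labels n.
Proof.
move=> ln i7 j7 kn; apply/allpairsP; exists (l, (i, j, k)); split=> //; first by rewrite mem_iota.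
apply/allpairsP; exists ((i, j), k); split=> //; last by rewrite mem_iota.
by apply/allpairsP; exists (i, j); split=> //; rewrite mem_iota.
Qed.

Lemma base_label_vertex n i j k : (base_label n i j k).1.1 \in [:: i; j].
Proof.
rewrite /base_label; case: (k == 0%N) => /=; first by rewrite inE eqxx.
by case: (k == n); rewrite !inE eqxx ?orbT.
Qed.

Lemma base_label_neq n i j k : i != j -> (k < n)%N ->
  base_label n i j k != base_label n i j k.+1.
Proof.
rewrite /base_label /= => ij kn.
have [->|k0] := eqVneq k 0%N; first by case: ifP => _; rewrite !xpair_eqE ?(negPf ij) ?andbF.
rewrite ltn_eqF //; case: ifP => _; rewrite !xpair_eqE ?(negPf ij) ?andbF //.
by rewrite [k == _]ltn_eqF // andbF.
Qed.

Lemma mem_base_label n l i j k : (l <= n.+1)%N -> (i < 7)%N -> (j < 7)%N -> (k <= n)%N ->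
  (l, base_label n i j k) \in labels n.
Proof. by move=> *; rewrite /base_label; do 2?case: ifP => _; rewrite mem_labels. Qed.

Lemma base_label0 n i j : base_label n i j 0 = (i, i, 0%N).
Proof. by []. Qed.

Lemma base_labelN n i j : (0 < n)%N -> base_label n i j n = (j, j, 0%N).
Proof. by rewrite /base_label eqxx; case: n. Qed.

Definition sorted_edge (e : nat * nat) : bool := (e.1 < e.2 < 7)%N.

Section Polygons.
Variables (R : realType) (P : label -> 'rV[R]_3) (n : nat).
Hypothesis n_gt0 : (0 < n)%N.
Hypothesis gp : in_general_position (labels n) P.

Definition over_label (x y : label) (e : nat * nat) : bool :=
  \xor_(k < n) crosses_over (P x) (P y) (P (edge_label n e k)) (P (edge_label n e k.+1)).

Definition path_over (e e' : nat * nat) : bool :=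
  \xor_(k < n) over_label (edge_label n e k) (edge_label n e k.+1) e'.

Definition path_above (i : nat) (e : nat * nat) : bool :=
  \xor_(k < n) lies_above (P (vertex_label i)) (P (edge_label n e k)) (P (edge_label n e k.+1)).

Definition vertex_left_of (i j : nat) : bool :=
  left_of (P (vertex_label i)) (P (vertex_label j)).

Lemma edge_label0 e : edge_label n e 0 = vertex_label e.1.
Proof. by []. Qed.

Lemma edge_labeln e : edge_label n e n = vertex_label e.2.
Proof. by rewrite /edge_label base_labelN. Qed.

Lemma edge_label_in e k : sorted_edge e -> (k <= n)%N -> edge_label n e k \in labels n.
Proof. by case: e => i j /andP[/= ij j7] kn; apply: mem_base_label => //; apply: ltn_trans j7. Qed.

Lemma edge_label_step e k : sorted_edge e -> (k < n)%N ->
  edge_label n e k != edge_label n e k.+1.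
Proof.
case/andP=> ij _ kn; rewrite xpair_eqE eqxx /=.
by apply: base_label_neq => //; rewrite ltn_eqF.
Qed.

Definition vertex_disjoint (e e' : nat * nat) : bool :=
  [&& e.1 != e'.1, e.1 != e'.2, e.2 != e'.1 & e.2 != e'.2].

Lemma edge_label_disjoint e e' k k' :
  vertex_disjoint e e' -> edge_label n e k != edge_label n e' k'.
Proof.
case/and4P=> n11 n12 n21 n22; rewrite xpair_eqE eqxx /=.
apply/negP => /eqP eq_lab.
have := base_label_vertex n e'.1 e'.2 k'; have := base_label_vertex n e.1 e.2 k.
rewrite eq_lab !inE => /orP[] /eqP-> /orP[] /eqP; by apply/eqP.
Qed.

Lemma vertex_disjointC e e' : vertex_disjoint e e' = vertex_disjoint e' e.
Proof.
by rewrite /vertex_disjoint (eq_sym e.1 e'.1) (eq_sym e.1) (eq_sym e.2) (eq_sym e.2);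
 case: (e'.1 == e.1); case: (e'.2 == e.1); case: (e'.1 == e.2).
Qed.

Lemma in_labels_sub s : all (fun l => l \in labels n) s -> {subset s <= labels n}.
Proof. by move/allP. Qed.

(** In the sum of [lies_above_below] along the edge the [left_of] terms telescope. *)
Lemma path_below i e : sorted_edge e -> (i < 7)%N -> i != e.1 -> i != e.2 ->
  \xor_(k < n) lies_below (P (vertex_label i)) (P (edge_label n e k)) (P (edge_label n e k.+1)) =
  path_above i e (+) (vertex_left_of e.1 i (+) vertex_left_of e.2 i).
Proof.
move=> se i7 i1 i2; rewrite /path_above /vertex_left_of -edge_label0 -edge_labeln.
rewrite -(xor_telescope (fun k => left_of (P (edge_label n e k)) (P (vertex_label i)))).
rewrite -big_split /=; apply: eq_bigr => k _.
have dis k' : vertex_label i != edge_label n e k'.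
  by rewrite (@edge_label_disjoint (i, i) _ 0) // /vertex_disjoint /= i1 i2.
have li : vertex_label i \in labels n by apply: mem_labels.
have l0 : edge_label n e k \in labels n by rewrite edge_label_in // ltnW.
have l1 : edge_label n e k.+1 \in labels n by rewrite edge_label_in.
have st := edge_label_step se (ltn_ord k).
rewrite -lies_above_below; first by case: lies_above; case: lies_below.
- by apply: (gp_area gp); [rewrite /= !inE !negb_or !dis st | apply: in_labels_sub; rewrite /= li l0 l1].
- by apply: (gp_xcoord gp); [rewrite /= inE st | apply: in_labels_sub; rewrite /= l0 l1].
- by rewrite eq_sym; apply: (gp_xcoord gp); [rewrite /= inE dis | apply: in_labels_sub; rewrite /= l0 li].
- by rewrite eq_sym; apply: (gp_xcoord gp); [rewrite /= inE dis | apply: in_labels_sub; rewrite /= l1 li].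
Qed.

(** In the sum of [crossing_parity] over the pairs of pieces of the two edges, the terms
    at the interior cutting points cancel.  The [lies_below] terms are
    eliminated in favour of [path_above] and [vertex_left_of], to leave as few kinds of
    unknowns as possible. *)
Lemma path_crossing_parity e e' : sorted_edge e -> sorted_edge e' -> vertex_disjoint e e' ->
  path_over e e' (+) path_over e' e =
  path_above e.1 e' (+) path_above e.2 e' (+)
    (path_above e'.1 e (+) (vertex_left_of e.1 e'.1 (+) vertex_left_of e.2 e'.1) (+)
     (path_above e'.2 e (+) (vertex_left_of e.1 e'.2 (+) vertex_left_of e.2 e'.2))).
Proof.
move=> se se' dis.
have dis' : vertex_disjoint e' e by rewrite vertex_disjointC.
have [/andP[ij j7] /andP[ij' j7']] := (se, se').
have [n11 n12 n21 n22] := and4P dis'.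
rewrite -!path_below // ?(ltn_trans ij') //.
rewrite -(edge_label0 e') -(edge_labeln e').
rewrite -(xor_telescope (fun k' => \xor_(k < n)
  lies_below (P (edge_label n e' k')) (P (edge_label n e k)) (P (edge_label n e k.+1)))).
rewrite /path_above -(edge_label0 e) -(edge_labeln e).
rewrite -(xor_telescope (fun k => \xor_(k' < n)
  lies_above (P (edge_label n e k)) (P (edge_label n e' k')) (P (edge_label n e' k'.+1)))).
rewrite /path_over /over_label [X in _ (+) X]exchange_big -big_split /=.
rewrite [X in _ = _ (+) X](eq_bigr (fun k' : 'I_n => \xor_(k < n)
  (lies_below (P (edge_label n e' k')) (P (edge_label n e k)) (P (edge_label n e k.+1)) (+)
   lies_below (P (edge_label n e' k'.+1)) (P (edge_label n e k)) (P (edge_label n e k.+1)))));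
  last by move=> k' _; rewrite big_split.
rewrite [X in _ = _ (+) X]exchange_big -big_split /=; apply: eq_bigr => k _.
rewrite -!big_split /=; apply: eq_bigr => k' _.
have in0 := edge_label_in se (ltnW (ltn_ord k)).
have in1 := edge_label_in se (ltn_ord k).
have in0' := edge_label_in se' (ltnW (ltn_ord k')).
have in1' := edge_label_in se' (ltn_ord k').
have st := edge_label_step se (ltn_ord k).
have st' := edge_label_step se' (ltn_ord k').
have d l l' : edge_label n e l != edge_label n e' l' by apply: edge_label_disjoint.
have d' l l' : edge_label n e' l != edge_label n e l' by apply: edge_label_disjoint.
apply: crossing_parity; try (apply: (gp_xcoord gp) || apply: (gp_area gp) || apply: (gp_volume gp));
  by [rewrite /= !inE ?negb_or ?d ?d' ?st ?st' |
      apply: in_labels_sub; rewrite /= ?in0 ?in1 ?in0' ?in1'].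
Qed.

(** Cycles modulo 2, in the dual form in which they are used. *)
Definition even_edges (E : seq (nat * nat)) : Prop :=
  forall g : nat -> bool, \xor_(e <- E) (g e.1 (+) g e.2) = false.

Definition loop_over (x y : label) (E : seq (nat * nat)) : bool :=
  \xor_(e <- E) over_label x y e.

Lemma loop_overC x y E : loop_over x y E = loop_over y x E.
Proof.
apply: eq_bigr => e _; apply: eq_bigr => k _; exact: crosses_overCl.
Qed.

Definition avoids (x : label) (E : seq (nat * nat)) : Prop :=
  x \in labels n /\ forall e k, e \in E -> x != edge_label n e k.

Definition unpierced x y z (E : seq (nat * nat)) : Prop :=
  forall e k, e \in E -> (k < n)%N ->
    ~ pierces (P (edge_label n e k)) (P (edge_label n e k.+1)) (P x) (P y) (P z).

(** In the sum of [crosses_over_triangle] over the pieces of the edges of [E], the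
    [in_shadow] terms telescope along each edge and cancel at each vertex. *)
Lemma loop_over_triangle x y z E : all sorted_edge E -> even_edges E ->
    uniq [:: x; y; z] -> avoids x E -> avoids y E -> avoids z E ->
    unpierced x y z E ->
  loop_over y z E (+) (loop_over x z E (+) loop_over x y E) = false.
Proof.
move=> /allP sE evE u [xS xE] [yS yE] [zS zE] np.
rewrite /loop_over -!big_split /=.
rewrite -[RHS](evE (fun i => in_shadow (P x) (P y) (P z) (P (vertex_label i)))).
apply: eq_big_seq => e eE.
rewrite -edge_label0 -edge_labeln
  -(xor_telescope (fun k => in_shadow (P x) (P y) (P z) (P (edge_label n e k)))).
rewrite -!big_split /=; apply: eq_bigr => k _.
have in0 := edge_label_in (sE e eE) (ltnW (ltn_ord k)).
have in1 := edge_label_in (sE e eE) (ltn_ord k).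
have st := edge_label_step (sE e eE) (ltn_ord k).
have dx l : x != edge_label n e l by apply: xE.
have dy l : y != edge_label n e l by apply: yE.
have dz l : z != edge_label n e l by apply: zE.
have dx' l : edge_label n e l != x by rewrite eq_sym.
have dy' l : edge_label n e l != y by rewrite eq_sym.
have dz' l : edge_label n e l != z by rewrite eq_sym.
move: (u); rewrite /= !inE !negb_or andbT => /andP[/andP[xy xz] yz].
apply: crosses_over_triangle; last exact: np.
- by apply: (gp_area gp) => //; apply: in_labels_sub; rewrite /= xS yS zS.
- move=> b; rewrite !inE => /orP[] /eqP->; split;
  (apply: (gp_area gp) || apply: (gp_volume gp));
  by [rewrite /= !inE ?negb_or ?dx ?dy ?dz ?dx' ?dy' ?dz' ?xy ?xz ?yz |
      apply: in_labels_sub; rewrite /= ?xS ?yS ?zS ?in0 ?in1].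
- by move=> b; rewrite !inE => /or3P[] /eqP->;
  apply: (gp_area gp);
  by [rewrite /= !inE ?negb_or ?dx ?dy ?dz ?st |
      apply: in_labels_sub; rewrite /= ?xS ?yS ?zS ?in0 ?in1].
- apply: (gp_volume gp);
  by [rewrite /= !inE ?negb_or ?dx ?dy ?dz ?st ?xy ?xz ?yz |
      apply: in_labels_sub; rewrite /= ?xS ?yS ?zS ?in0 ?in1].
- apply: (gp_volume gp);
  by [rewrite /= !inE ?negb_or ?dx ?dy ?dz ?st ?xy ?xz ?yz |
      apply: in_labels_sub; rewrite /= ?xS ?yS ?zS ?in0 ?in1].
- apply: (gp_volume gp);
  by [rewrite /= !inE ?negb_or ?dx ?dy ?dz ?st ?xy ?xz ?yz |
      apply: in_labels_sub; rewrite /= ?xS ?yS ?zS ?in0 ?in1].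
Qed.

Definition cone_label (l : nat) (e : nat * nat) (k : nat) : label :=
  (l, base_label n e.1 e.2 k).
Definition apex_label : label := (n.+1, (0%N, 0%N, 0%N)).

(** The linking number modulo 2 of two disjoint cycles, read off the diagram. *)
Definition loops_over (E E' : seq (nat * nat)) : bool :=
  \xor_(e <- E) \xor_(e' <- E') path_over e e'.

(** By [loop_over_triangle], the two sides of a triangle of the cone together are
    crossed like the third side.  Pushing a piece of [E] up to the apex in
    this way replaces it by the two paths from its ends to the apex.  The path
    of each end is used once for every piece at that end, that is an even number
    of times around [E]. *)
Lemma loops_over_contractible E E' :
    all sorted_edge E -> all sorted_edge E' -> even_edges E -> even_edges E' ->
    allrel vertex_disjoint E E' ->
    (forall e l k, e \in E -> (l < n)%N -> (k < n)%N ->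
      unpierced (cone_label l e k) (cone_label l e k.+1) (cone_label l.+1 e k.+1) E' /\
      unpierced (cone_label l e k) (cone_label l.+1 e k) (cone_label l.+1 e k.+1) E') ->
    (forall e k, e \in E -> (k < n)%N ->
      unpierced (cone_label n e k) (cone_label n e k.+1) apex_label E') ->
  loops_over E E' = false.
Proof.
move=> sE sE' evE evE' /allrelP dis side top.
pose om x y := loop_over x y E'.
have omC x y : om x y = om y x by exact: loop_overC.
(* The contribution of the path from [b] straight up to the apex. *)
pose rung b := \xor_(l < n) om (l : nat, b) (l.+1, b) (+) om (n, b) apex_label.
have av e l k : e \in E -> (l <= n)%N -> (k <= n)%N -> avoids (cone_label l e k) E'.
  move=> eE ln kn; split.
    have /andP[e1 e2] := allP sE e eE.
    by apply: mem_base_label => //; [apply: leqW | apply: ltn_trans e2].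
  move=> e' k' eE'; have := @edge_label_disjoint e e' k k' (dis _ _ eE eE').
  by rewrite !xpair_eqE eqxx /=; apply: contra => /andP[].
have avt : avoids apex_label E' by split; [apply: mem_labels | ].
have step e k : e \in E -> (k < n)%N -> base_label n e.1 e.2 k != base_label n e.1 e.2 k.+1.
  move=> eE kn; have /andP[e1 _] := allP sE e eE.
  by apply: base_label_neq => //; rewrite ltn_eqF.
have seg e k : e \in E -> (k < n)%N -> om (edge_label n e k) (edge_label n e k.+1) =
    rung (base_label n e.1 e.2 k) (+) rung (base_label n e.1 e.2 k.+1).
  move=> eE kn; rewrite -[edge_label n e k]/(cone_label 0 e k)
    -[edge_label n e k.+1]/(cone_label 0 e k.+1).
  have down l : (l <= n)%N -> om (cone_label 0 e k) (cone_label 0 e k.+1) =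
     om (cone_label l e k) (cone_label l e k.+1) (+)
     \xor_(l' < l) om (cone_label l' e k) (cone_label l'.+1 e k) (+)
     \xor_(l' < l) om (cone_label l' e k.+1) (cone_label l'.+1 e k.+1).
    elim: l => [|l IH] ln; first by rewrite !big_ord0 !addbF.
    rewrite IH 1?ltnW // !big_ord_recr /=.
    have [np1 np2] := side e l k eE ln kn.
    have neq1 : cone_label l e k != cone_label l e k.+1.
      by rewrite xpair_eqE eqxx step.
    have neq2 : cone_label l.+1 e k != cone_label l.+1 e k.+1.
      by rewrite xpair_eqE eqxx step.
    have neql k1 k2 : cone_label l e k1 != cone_label l.+1 e k2.
      by rewrite xpair_eqE ltn_eqF.
    have t1 : om (cone_label l e k.+1) (cone_label l.+1 e k.+1) (+)
      (om (cone_label l e k) (cone_label l.+1 e k.+1) (+)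
       om (cone_label l e k) (cone_label l e k.+1)) = false.
      apply: loop_over_triangle => //; try (apply: av => //; exact: ltnW).
      by rewrite /= !inE !negb_or neq1 !neql.
    have t2 : om (cone_label l.+1 e k) (cone_label l.+1 e k.+1) (+)
      (om (cone_label l e k) (cone_label l.+1 e k.+1) (+)
       om (cone_label l e k) (cone_label l.+1 e k)) = false.
      apply: loop_over_triangle => //; try (apply: av => //; exact: ltnW).
      by rewrite /= !inE !negb_or neq2 !neql.
    by move: t1 t2; do 5![case: (om _ _)]; do 2![case: (\big[_/_]_(_ < _) _)].
  rewrite (down n) // /rung.
  have t3 : om (cone_label n e k.+1) apex_label (+)
    (om (cone_label n e k) apex_label (+) om (cone_label n e k) (cone_label n e k.+1)) = false.
    apply: loop_over_triangle => //; try (apply: av => //; exact: ltnW); last exact: top.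
    rewrite /= !inE !negb_or andbT -andbA; apply/and3P; split.
    - by rewrite xpair_eqE eqxx step.
    - by rewrite xpair_eqE ltn_eqF.
    - by rewrite xpair_eqE ltn_eqF.
  by move: t3; rewrite /cone_label; do 3![case: (om _ _)]; do 2![case: (\big[_/_]_(_ < _) _)].
rewrite /loops_over -[RHS](evE (fun i => rung (i, i, 0%N))).
apply: eq_big_seq => e eE.
rewrite /path_over exchange_big /=.
rewrite -(base_label0 n e.1 e.2) -(base_labelN e.1 e.2 n_gt0).
rewrite -(xor_telescope (fun k => rung (base_label n e.1 e.2 k))).
by apply: eq_bigr => k _; rewrite -seg.
Qed.

End Polygons.

(** * The linking parity of a split pair of cycles *)

Section Metric.
Variable R : realType.
Implicit Types (s t r d : R).

Lemma rV3P (v w : 'rV[R]_3) : xcoord v = xcoord w -> ycoord v = ycoord w -> zcoord v = zcoord w -> v = w.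
Proof.
move=> ex ey ez; apply/rowP => i.
suff [->|[->|->]] : i = 0 \/ i = 1 \/ i = 2 by [].
by case: i => [[|[|[|i]]] lti] //; [left|right; left|right; right]; apply: val_inj.
Qed.

(** The triangle lies in a ball about [c], the segment in a disjoint ball about [c']. *)
Lemma far_not_pierces (c c' a0 a1 a2 b0 b1 : 'rV[R]_3) r :
    (forall a, a \in [:: a0; a1; a2] -> `|a - c| <= r) ->
    (forall b, b \in [:: b0; b1] -> `|b - c'| <= r) ->
    r *+ 2 < `|c - c'| -> ~ pierces b0 b1 a0 a1 a2.
Proof.
move=> ha hb far [t [l0 [l1 [l2 [/andP[t0 t1] [p0 p1 p2 lS] eX eY eZ]]]]].
have eq_pt : l0 *: a0 + l1 *: a1 + l2 *: a2 = b0 + t *: (b1 - b0).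
  apply: rV3P; rewrite /xcoord /ycoord /zcoord !mxE.
  - by move: eX; rewrite /xcoord => ->; rewrite /lerp; ring.
  - by move: eY; rewrite /ycoord => ->; rewrite /lerp; ring.
  - by move: eZ; rewrite /zcoord => ->; rewrite /lerp; ring.
have va : `|l0 *: a0 + l1 *: a1 + l2 *: a2 - c| <= r.
  have -> : l0 *: a0 + l1 *: a1 + l2 *: a2 - c =
      l0 *: (a0 - c) + l1 *: (a1 - c) + l2 *: (a2 - c).
    apply/rowP => i; rewrite !mxE; have e1 : c 0 i = (l0 + l1 + l2) * c 0 i.
      by rewrite lS mul1r.
    by rewrite {1}e1; ring.
  have bnd (l : R) a : 0 < l -> `|a - c| <= r -> `|l *: (a - c)| <= l * r.
    by move=> l_gt0 ar; rewrite normrZ gtr0_norm // ler_wpM2l // ltW.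
  apply: le_trans (ler_normD _ _) _; apply: le_trans (lerD (ler_normD _ _) (lexx _)) _.
  rewrite -[leRHS]mul1r -lS !mulrDl.
  by rewrite !lerD // bnd // ha // !inE eqxx ?orbT.
have vb : `|b0 + t *: (b1 - b0) - c'| <= r.
  have -> : b0 + t *: (b1 - b0) - c' = (1 - t) *: (b0 - c') + t *: (b1 - c').
    by apply/rowP => i; rewrite !mxE; ring.
  apply: le_trans (ler_normD _ _) _; rewrite !normrZ !gtr0_norm ?subr_gt0 //.
  have h0 : (1 - t) * `|b0 - c'| <= (1 - t) * r.
    by rewrite ler_wpM2l ?subr_ge0 ?(ltW t1) // hb // inE eqxx.
  have h1 : t * `|b1 - c'| <= t * r.
    by rewrite ler_wpM2l ?(ltW t0) // hb // !inE eqxx orbT.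
  by lra.
have := ler_distD (b0 + t *: (b1 - b0)) c c'.
rewrite -{1}eq_pt => h; rewrite distrC in va.
have := le_trans h (lerD va vb); rewrite -mulr2n leNgt.
by rewrite far.
Qed.

Lemma compact_unif_continuous (T : pseudoMetricType R) (V : normedModType R)
    (K : set T) (F : T -> V) (e : R) : compact K -> continuous F -> 0 < e ->
  \forall d \near 0^'+, forall p, K p -> forall q, ball p d q -> `|F p - F q| < e.
Proof.
move=> /compact_near_coveringP cK cF e0.
apply: (cK _ _ (fun d p => forall q, ball p d q -> `|F p - F q| < e)) => p Kp.
have /cvgrPdist_lt /(_ (e / 2)) := cF p.
rewrite divr_gt0 // => /(_ isT) /nbhs_ballP[r /= r0 hr].
have r20 : 0 < r / 2 by rewrite divr_gt0.
exists (ball p (r / 2), [set d | 0 < d < r / 2]) => /=.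
  split; first exact: nbhsx_ballx.
  by apply: filterS2 (nbhs_right_gt 0) (nbhs_right_lt r20) => d d0 dr; rewrite /= d0 dr.
move=> [p' d] /= [pp' /andP[d0 dr] q p'q].
have h1 := hr p' (le_ball _ pp'); have h2 : `|F p - F q| < e / 2.
  apply: hr; rewrite [r]splitr; apply: ball_triangle pp' _.
  by apply: le_ball p'q; apply: ltW.
have h3 : `|F p - F p'| < e / 2 by apply: h1; lra.
by rewrite (splitr e) (le_lt_trans (ler_distD (F p) _ _)) // distrC ltrD.
Qed.

Lemma compact_separated (T : topologicalType) (V : normedModType R)
    (K : set T) (F G : T -> V) : compact K -> continuous F -> continuous G ->
  (forall p, K p -> F p != G p) ->
  \forall d \near 0^'+, forall p, K p -> d < `|F p - G p|.
Proof.
move=> /compact_near_coveringP cK cF cG nFG.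
apply: (cK _ _ (fun d p => d < `|F p - G p|)) => p Kp.
have pos : 0 < `|F p - G p| by rewrite normr_gt0 subr_eq0 nFG.
set m := `|F p - G p| in pos.
have c : (fun x => `|F x - G x|) @ p --> m.
  by apply: cvg_norm; apply: cvgB; [exact: cF | exact: cG].
have h : \forall x \near p, m / 2 < `|F x - G x|.
  by have /cvgr_gt := c; apply; lra.
exists ([set x | m / 2 < `|F x - G x|], [set d | d < m / 2]) => /=.
  by split=> //; apply: nbhs_right_lt; lra.
by move=> [x d] /= [h1 h2]; apply: lt_trans h1.
Qed.

(** Retracts the line onto the unit interval, so that paths become continuous functions
    of a real number without a restriction to a subspace. *)
Definition clamp t : R := Num.max 0 (Num.min t 1).

Lemma clamp_in t : 0 <= clamp t <= 1.
Proof. by rewrite /clamp le_max lexx /= ge_max ler01 ge_min lexx orbT. Qed.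

Lemma clamp_id t : 0 <= t <= 1 -> clamp t = t.
Proof. by case/andP=> t0 t1; rewrite /clamp (min_idPl t1) (max_idPr t0). Qed.

Lemma clamp_ge1 t : 1 <= t -> clamp t = 1.
Proof. by move=> t1; rewrite /clamp (min_idPr t1) (max_idPr ler01). Qed.

Lemma continuous_clamp : continuous clamp.
Proof.
move=> t; apply: (@continuous_max R _ (fun=> 0) (fun t => Num.min t 1)).
  exact: cvg_cst.
by apply: (@continuous_min R _ id (fun=> 1)); [exact: cvg_id | exact: cvg_cst].
Qed.

Definition graph_pos (phi : nat -> nat -> R -> 'rV[R]_3) (n : nat) (l : label) :=
  phi l.2.1.1 l.2.1.2 (l.2.2%:R / n%:R).

(** Coning to the centre of the round ball, transported by [h], whose inverse is [g].
    The level [n.+1] of the apex is sent to the centre as level [n] is. *)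
Definition cone_pos (h g : 'rV[R]_3 -> 'rV[R]_3) phi n (l : label) :=
  h ((1 - clamp (l.1%:R / n%:R)) *: g (graph_pos phi n l)).

Lemma graph_pos_edge phi n l i j k : (0 < n)%N ->
  phi i j 0 = phi i i 0 -> phi i j 1 = phi j j 0 ->
  graph_pos phi n (l, base_label n i j k) = phi i j (k%:R / n%:R).
Proof.
move=> n0 p0 p1; rewrite /graph_pos /base_label.
case: eqP => [->|_] /=; first by rewrite mul0r p0.
by case: eqP => [->|_] //=; rewrite mul0r divff ?p1 // pnatr_eq0 -lt0n.
Qed.

Lemma eq_loops_over (P P' : label -> 'rV[R]_3) n E E' :
  (forall b, P (0%N, b) = P' (0%N, b)) -> loops_over P n E E' = loops_over P' n E E'.
Proof.
move=> PP; apply: eq_bigr => e _; apply: eq_bigr => e' _.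
by apply: eq_bigr => k _; apply: eq_bigr => k' _; rewrite !PP.
Qed.

(** The cone over [E] stays inside the sphere, so it is disjoint from [E'], and by
    compactness at a distance [r] from it.  By uniform continuity the triangles of the
    subdivided cone and the pieces of [E'] are small for large [n], and the
    perturbation is small for small [d].  So [E'] pierces none of the triangles, and
    [loops_over_contractible] applies. *)
Lemma near_loops_over_split (phi : nat -> nat -> R -> 'rV[R]_3)
    (h g : 'rV[R]_3 -> 'rV[R]_3) (E E' : seq (nat * nat)) :
    continuous h -> continuous g -> cancel h g -> cancel g h ->
    all sorted_edge E -> all sorted_edge E' -> even_edges E -> even_edges E' ->
    allrel vertex_disjoint E E' ->
    (forall e, e \in E ++ E' -> [/\ continuous (phi e.1 e.2),
       phi e.1 e.2 0 = phi e.1 e.1 0 & phi e.1 e.2 1 = phi e.2 e.2 0]) ->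
    (forall e t, e \in E -> sqnorm (g (phi e.1 e.2 t)) < 1) ->
    (forall e t, e \in E' -> 1 < sqnorm (g (phi e.1 e.2 t))) ->
  \forall n \near \oo, \forall d \near 0^'+,
    loops_over (perturbed (graph_pos phi n) d) n E E' = false.
Proof.
move=> ch cg hK gK sE sE' evE evE' dis phiP inside outside.
pose Phi (e : nat * nat) (p : R * R) := h ((1 - clamp p.1) *: g (phi e.1 e.2 p.2)).
have cPhi e : e \in E ++ E' -> continuous (Phi e).
  move=> /phiP[cphi _ _] p; rewrite /Phi.
  apply: (@continuous_comp _ _ _
    (fun p : R * R => (1 - clamp p.1) *: g (phi e.1 e.2 p.2)) h); last exact: ch.
  apply: cvgZ.
    apply: cvgB; first exact: cvg_cst.
    apply: (@continuous_comp _ _ _ (@fst R R) clamp); last exact: continuous_clamp.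
    exact: cvg_fst.
  apply: (@continuous_comp _ _ _ (fun p : R * R => phi e.1 e.2 p.2) g); last exact: cg.
  apply: (@continuous_comp _ _ _ (@snd R R) (phi e.1 e.2)); last exact: cphi.
  exact: cvg_snd.
have inl e : e \in E -> e \in E ++ E' by rewrite mem_cat => ->.
have inr e : e \in E' -> e \in E ++ E' by rewrite mem_cat => ->; rewrite orbT.
have Phi0 e t : Phi e (0, t) = phi e.1 e.2 t.
  by rewrite /Phi /= clamp_id ?lexx ?ler01 // subr0 scale1r gK.
have cI : compact (`[0, 1] : set R) by exact: segment_compact.
have near_sep : \forall r \near 0^'+, forall e, e \in E -> forall e', e' \in E' ->
    forall p, (((`[0, 1] `*` `[0, 1]) `*` `[0, 1]) : set (R * R * R)) p ->
      r < `|Phi e p.1 - phi e'.1 e'.2 p.2|.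
  apply: near_in_seq => e eE; apply: near_in_seq => e' eE'.
  apply: (@compact_separated _ _ _ (fun p => Phi e p.1) (fun p => phi e'.1 e'.2 p.2)).
  - by apply: compact_setX => //; apply: compact_setX.
  - move=> p; apply: (@continuous_comp _ _ _ (@fst (R * R)%type R) (Phi e)).
      exact: cvg_fst.
    exact: cPhi (inl _ eE) _.
  - move=> p; apply: (@continuous_comp _ _ _ (@snd (R * R)%type R) (phi e'.1 e'.2)).
      exact: cvg_snd.
    by have [cphi _ _] := phiP e' (inr _ eE'); exact: cphi.
  - move=> p _; apply/eqP => /(congr1 g); rewrite /Phi hK => eq_g.
    have := outside e' p.2 eE'; rewrite -eq_g ltNge => /negP; apply.
    have /andP[c0 c1] := clamp_in p.1.1.
    have -> : sqnorm ((1 - clamp p.1.1) *: g (phi e.1 e.2 p.1.2)) =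
        (1 - clamp p.1.1) ^+ 2 * sqnorm (g (phi e.1 e.2 p.1.2)).
      by rewrite /sqnorm big_distrr; apply: eq_bigr => i _; rewrite mxE exprMn.
    rewrite mulr_ile1 ?sqr_ge0 //.
    - by apply: sumr_ge0 => i _; apply: sqr_ge0.
    - by rewrite expr_le1 ?subr_ge0 //; lra.
    - exact/ltW/inside.
have [r [r0 sep]] := filter_ex (filterI (nbhs_right_gt (0 : R)) near_sep).
have near_unif : \forall d \near 0^'+, forall e, e \in E ++ E' ->
    forall p, ((`[0, 1] `*` `[0, 1]) : set (R * R)) p -> forall q, ball p d q ->
      `|Phi e p - Phi e q| < r / 8.
  apply: near_in_seq => e eE; apply: compact_unif_continuous; last by lra.
  - exact: compact_setX.
  - exact: cPhi.
have [d [d0 unif]] := filter_ex (filterI (nbhs_right_gt (0 : R)) near_unif).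
near=> n.
have dn : d^-1 < n%:R by near: n; apply: nbhs_infty_gtr.
have n0 : 0 < n%:R :> R by apply: lt_trans dn; rewrite invr_gt0.
have n_gt0 : (0 < n)%N by rewrite -(ltr0n R).
have nd : n%:R^-1 < d by rewrite -[d]invrK ltf_pV2 // posrE // invr_gt0.
near=> eps.
have eps0 : 0 < eps by [].
pose P := perturbed (cone_pos h g phi n) eps.
have gpP : in_general_position (labels n) P.
  by rewrite /P; near: eps; apply: near_in_general_position.
have small_moment : forall l, l \in labels n ->
    eps * `|moment R (pickle (l : label))| < r / 8.
  near: eps; apply: near_in_seq => l _.
  have m0 : 0 < `|moment R (pickle (l : label))| + 1 by apply: ltr_wpDl.
  apply: filterS2 (nbhs_right_gt 0) (nbhs_right_lt (divr_gt0 (divr_gt0 r0 (ltr0n _ 8)) m0)).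
  move=> x x0; rewrite ltr_pdivlMr //; apply: le_lt_trans.
  by rewrite ler_pM2l // lerDl.
have small l : l \in labels n -> `|P l - cone_pos h g phi n l| < r / 8.
  move=> /small_moment; rewrite /P /perturbed addrAC subrr add0r normrZ.
  by rewrite gtr0_norm.
rewrite (@eq_loops_over _ P) => [|b]; last first.
  by rewrite /P /perturbed /cone_pos /= mul0r clamp_id ?lexx ?ler01 // subr0 scale1r gK.
have frac k : (k <= n)%N -> `[0, 1]%classic (k%:R / n%:R : R).
  move=> kn; rewrite /= in_itv /= divr_ge0 ?ler0n //=.
  by rewrite ler_pdivrMr // mul1r ler_nat.
have fracS k : ball (k%:R / n%:R : R) d (k.+1%:R / n%:R).
  rewrite /ball /= -mulrBl -[k.+1]addn1 natrD opprD addNKr mulN1r normrN.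
  by rewrite gtr0_norm // invr_gt0.
have posE e l k : e \in E ++ E' ->
    cone_pos h g phi n (l, base_label n e.1 e.2 k) = Phi e (l%:R / n%:R, k%:R / n%:R).
  by move=> /phiP[_ p0 p1]; rewrite /cone_pos graph_pos_edge.
have pos0 e k : e \in E ++ E' ->
    cone_pos h g phi n (edge_label n e k) = phi e.1 e.2 (k%:R / n%:R).
  by move=> eE; rewrite [LHS](posE e 0%N) // mul0r Phi0.
have in3 (x y z a : label) : a \in [:: x; y; z] -> [\/ a = x, a = y | a = z].
  by rewrite !inE => /or3P[] /eqP->; [apply: Or31 | apply: Or32 | apply: Or33].
(* The perturbation moves points by less than [r / 8], and neighbouring
   subdivision points of the cone are less than [r / 8] apart; so a triangle of the
   cone is within [r / 4] of one of its unperturbed corners, a piece of [E'] within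
   [r / 4] of its unperturbed first end, and these two points are [r] apart. *)
have unpiercedP x y z c : (forall a, a \in [:: x; y; z] ->
      a \in labels n /\ `|cone_pos h g phi n a - c| < r / 8) ->
    (forall e t, e \in E' -> `[0, 1]%classic t -> r < `|c - phi e.1 e.2 t|) ->
    unpierced P n x y z E'.
  move=> near_c far_c e k eE' kn.
  have se := allP sE' e eE'.
  apply: (@far_not_pierces c (phi e.1 e.2 (k%:R / n%:R)) _ _ _ _ _ (r / 4)).
  - move=> a' a'in; have [a ain ->] : exists2 a, a \in [:: x; y; z] & a' = P a.
      by apply/mapP; rewrite /=.
    have [aS ac] := near_c a ain.
    have := ler_distD (cone_pos h g phi n a) (P a) c; have := small a aS.
    by lra.
  - move=> b'; rewrite !inE => /orP[] /eqP->.
      have := small _ (edge_label_in se (ltnW kn)).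
      by rewrite pos0 ?inr // => sm; apply/ltW/(lt_trans sm); lra.
    have := ler_distD (cone_pos h g phi n (edge_label n e k.+1)) (P (edge_label n e k.+1))
      (phi e.1 e.2 (k%:R / n%:R)).
    have := small _ (edge_label_in se kn).
    have K0 : (`[0, 1] `*` `[0, 1])%classic (0 : R, k%:R / n%:R : R).
      by split; [rewrite /= in_itv /= lexx ler01 | apply/frac/ltnW].
    have B0 : ball (0 : R, k%:R / n%:R : R) d (0, k.+1%:R / n%:R).
      by split; [exact: ballxx | exact: fracS].
    have := unif e (inr _ eE') _ K0 _ B0.
    rewrite pos0 ?inr // !Phi0.
    rewrite [`|phi _ _ (k%:R / _) - _|]distrC; lra.
  - by have := far_c e (k%:R / n%:R) eE' (frac k (ltnW kn)); lra.
apply: loops_over_contractible => //.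
- move=> e l k eE ln kn; have se := allP sE e eE.
  have K0 : (`[0, 1] `*` `[0, 1])%classic (l%:R / n%:R : R, k%:R / n%:R : R).
    by split; apply/frac/ltnW.
  have lab l' k' : (l' <= n)%N -> (k' <= n)%N -> cone_label n l' e k' \in labels n.
    move=> l'n k'n; have /andP[e1 e2] := se.
    by apply: mem_base_label => //; [apply: leqW | apply: ltn_trans e2].
  have cl l' k' : l' \in [:: l; l.+1] -> k' \in [:: k; k.+1] ->
      cone_label n l' e k' \in labels n /\
      `|cone_pos h g phi n (cone_label n l' e k') - Phi e (l%:R / n%:R, k%:R / n%:R)| < r / 8.
    rewrite 2![_ \in [:: _; _]]inE !mem_seq1 => l'l k'k.
    have l'n : (l' <= n)%N by case/orP: l'l => /eqP-> //; apply: ltnW.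
    have k'n : (k' <= n)%N by case/orP: k'k => /eqP-> //; apply: ltnW.
    split; first exact: lab.
    rewrite distrC (posE e) ?inl //; apply: unif (inl _ eE) _ K0 _ _.
    by split; [case/orP: l'l => /eqP-> | case/orP: k'k => /eqP->];
      do ?[exact: fracS | exact: ballxx].
  have far e' t : e' \in E' -> `[0, 1]%classic t ->
      r < `|Phi e (l%:R / n%:R, k%:R / n%:R) - phi e'.1 e'.2 t|.
    by move=> e'E t01; apply: (sep e eE e' e'E (_, t)).
  by split; apply: (unpiercedP _ _ _ _ _ far) => a /in3[] ->;
    apply: cl; rewrite !inE eqxx ?orbT.
- move=> e k eE kn; have se := allP sE e eE.
  have one : n%:R / n%:R = 1 :> R by rewrite divff // gt_eqF.
  have pos1 k' : cone_pos h g phi n (cone_label n n e k') = h 0.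
    by rewrite posE ?inl // /Phi /= one clamp_ge1 ?lexx // subrr scale0r.
  have posa : cone_pos h g phi n (apex_label n) = h 0.
    rewrite /cone_pos clamp_ge1 ?subrr ?scale0r //=.
    by rewrite ler_pdivlMr // mul1r ler_nat.
  have Phi1 : Phi e (1, 0) = h 0.
    by rewrite /Phi /= clamp_ge1 ?lexx // subrr scale0r.
  have lab k' : (k' <= n)%N -> cone_label n n e k' \in labels n.
    move=> k'n; have /andP[e1 e2] := se.
    by apply: mem_base_label => //; apply: ltn_trans e2.
  apply: (unpiercedP _ _ _ (h 0)) => [a|e' t e'E t01].
    case/in3=> ->; rewrite ?pos1 ?posa subrr normr0 divr_gt0 //; split=> //.
    - exact/lab/ltnW.
    - exact: lab.
    - exact: (@mem_labels n n.+1).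
  rewrite -Phi1; apply: (sep e eE e' e'E ((1, 0), t)); split=> //; split;
  by rewrite /= in_itv /= ?lexx ?ler01.
Unshelve. all: by end_near.
Qed.

End Metric.

(** * Parity arguments in the complete graph *)

Local Open Scope nat_scope.

Definition cyc_edges (s : seq nat) : seq (nat * nat) :=
  [seq (minn x (next s x), maxn x (next s x)) | x <- s].

Definition triangles (s : seq nat) : seq (seq nat) :=
  [seq t <- [seq [:: i; p.1; p.2] | i <- s, p <- [seq (j, k) | j <- s, k <- s]]
     | sorted ltn t].

(** The three 4-cycles on four vertices. *)
Definition squares (s : seq nat) : seq (seq nat) :=
  if s is [:: a; b; c; d] then [:: [:: a; b; c; d]; [:: a; b; d; c]; [:: a; c; b; d]]
  else [::].

Definition other_vertices (s : seq nat) : seq nat := [seq x <- iota 0 7 | x \notin s].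

Definition triangle_pairs : seq (seq nat * seq nat) :=
  [seq (t, u) | t <- triangles (iota 0 7), u <- triangles (other_vertices t)].

Definition unordered_triangle_pairs : seq (seq nat * seq nat) :=
  [seq p <- triangle_pairs | head 0 p.1 < head 0 p.2].

Definition triangle_square_pairs : seq (seq nat * seq nat) :=
  [seq (t, u) | t <- triangles (iota 0 7), u <- squares (other_vertices t)].

Definition avoids_vertex (v : nat) (p : seq nat * seq nat) : bool :=
  v \notin p.1 ++ p.2.

(** The copy of [K_{3,3,1}] on the seven vertices is given by its part of size 1 and one
    of the two parts of size 3: the one with the least vertex, in [K331s]. *)
Definition K331 := (nat * seq nat)%type.
Definition K331_edge (k : K331) (e : nat * nat) : bool :=
  [|| e.1 == k.1, e.2 == k.1 | (e.1 \in k.2) != (e.2 \in k.2)].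
Definition in_K331 (k : K331) (p : seq nat * seq nat) : bool :=
  all (K331_edge k) (cyc_edges p.1 ++ cyc_edges p.2).
Definition K331s : seq K331 :=
  [seq (a, head 0 (other_vertices [:: a]) :: t) | a <- iota 0 7,
     t <- [seq t <- [seq [:: x; y] | x <- behead (other_vertices [:: a]),
                                     y <- behead (other_vertices [:: a])] | sorted ltn t]].

Definition all_edges : seq (nat * nat) :=
  [seq e <- [seq (i, j) | i <- iota 0 7, j <- iota 0 7] | e.1 < e.2].

(** Formal unknowns for the quantities of [crossing_data] below, told apart by the first
    number; the last kind stands for [true].  A list of symbols stands for the
    sum of their values.  A linear consequence of the relations between the
    unknowns is checked by computing that in some list all symbols cancel. *)
Definition symbol := (nat * nat * nat * nat * nat)%type.
Definition sym_over (e e' : nat * nat) : symbol := (0, e.1, e.2, e'.1, e'.2).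
Definition sym_above (i : nat) (e : nat * nat) : symbol := (1, i, e.1, e.2, 0).
Definition sym_left (i j : nat) : symbol := (2, i, j, 0, 0).
Definition sym_one : symbol := (3, 0, 0, 0, 0).

Definition lk_symbols (p : seq nat * seq nat) : seq symbol :=
  [seq sym_over e e' | e <- cyc_edges p.1, e' <- cyc_edges p.2].

Definition crossing_relation (e e' : nat * nat) : seq symbol :=
  [:: sym_over e e'; sym_over e' e; sym_above e.1 e'; sym_above e.2 e';
      sym_above e'.1 e; sym_left e.1 e'.1; sym_left e.2 e'.1;
      sym_above e'.2 e; sym_left e.1 e'.2; sym_left e.2 e'.2].

Definition left_relation (i j : nat) : seq symbol := [:: sym_left i j; sym_left j i; sym_one].

Definition crossing_pairs (E : seq (nat * nat)) : seq ((nat * nat) * (nat * nat)) :=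
  [seq p <- [seq (e, e') | e <- E, e' <- E]
     | vertex_disjoint p.1 p.2 && (p.1.1 < p.2.1)].

Definition edges_avoiding (v : nat) : seq (nat * nat) :=
  [seq e <- all_edges | (e.1 != v) && (e.2 != v)].

Definition symbol_le (x y : symbol) : bool :=
  let: (x1, x2, x3, x4, x5) := x in let: (y1, y2, y3, y4, y5) := y in
  if x1 != y1 then x1 <= y1 else if x2 != y2 then x2 <= y2 else
  if x3 != y3 then x3 <= y3 else if x4 != y4 then x4 <= y4 else x5 <= y5.

Fixpoint cancels (l : seq symbol) : bool :=
  match l with
  | [::] => true
  | x :: l1 => if l1 is y :: l' then (x == y) && cancels l' else false
  end.

Definition even_multiset (l : seq symbol) : bool := cancels (sort symbol_le l).

(** For each [sym_left i j] with [j < i] that occurs in the crossing relations, the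
    relation that turns it into [sym_left j i] is added, so that these unknowns can
    cancel. *)
Definition relations (E : seq (nat * nat)) : seq symbol :=
  let c := flatten [seq crossing_relation p.1 p.2 | p <- crossing_pairs E] in
  c ++ flatten [seq (if x is (2, i, j, 0, 0) then if j < i then left_relation i j else [::]
                     else [::]) | x <- c].

(** A pair of disjoint edges of [K_6] is in two of the pairs of disjoint triangles.  If
    one of the edges contains the least vertex, which is in the first triangle of
    each pair, then the two contributions are equal and cancel.  What remains is
    the sum of [W e e' + W e' e] over the pairs of disjoint edges of a [K_5]. *)
Definition K6_edges v := [seq e <- edges_avoiding v | e.1 != head 0 (other_vertices [:: v])].
(** Likewise for [K_{3,3,1}], whose triangles all contain the part of size 1: an edge at
    this vertex contributes twice with each edge disjoint from it, and the sum of
    [W e e' + W e' e] over the pairs of disjoint edges of a [K_{3,3}] remains. *)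
Definition K331_bipartite_edges (k : K331) :=
  [seq e <- edges_avoiding k.1 | K331_edge k e].

Definition K6_parity_check v :=
  even_multiset (sym_one :: flatten (map lk_symbols
      [seq p <- unordered_triangle_pairs | avoids_vertex v p])
                  ++ relations (K6_edges v)).
Definition K331_parity_check k :=
  even_multiset (sym_one :: flatten (map lk_symbols [seq p <- triangle_square_pairs | in_K331 k p])
                  ++ relations (K331_bipartite_edges k)).

Definition lkC_check (p : seq nat * seq nat) :=
  let E := cyc_edges p.1 in let E' := cyc_edges p.2 in
  even_multiset (lk_symbols p ++ lk_symbols (p.2, p.1) ++
    flatten [seq crossing_relation e e' | e <- E, e' <- E']).

(** What is needed of a diagram: [W e e'] for the crossings of [e] over [e'], [U i e]
    for the vertex [i] and the edges below it, [L i j] for the order of the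
    vertices along the first axis. *)
Definition crossing_data (W : nat * nat -> nat * nat -> bool) (U : nat -> nat * nat -> bool)
    (L : nat -> nat -> bool) : Prop :=
  (forall e e', sorted_edge e -> sorted_edge e' -> vertex_disjoint e e' ->
    W e e' (+) W e' e =
    U e.1 e' (+) U e.2 e' (+) (U e'.1 e (+) (L e.1 e'.1 (+) L e.2 e'.1) (+)
      (U e'.2 e (+) (L e.1 e'.2 (+) L e.2 e'.2)))) /\
  (forall i j, i < 7 -> j < 7 -> i != j -> L i j = ~~ L j i).

Section Counting.
Variables (W : nat * nat -> nat * nat -> bool) (U : nat -> nat * nat -> bool)
          (L : nat -> nat -> bool).
Hypothesis data : crossing_data W U L.

Definition value (x : symbol) : bool :=
  match x with
  | (0, a, b, c, d) => W (a, b) (c, d)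
  | (1, i, a, b, _) => U i (a, b)
  | (2, i, j, _, _) => L i j
  | _ => true
  end.

Definition values (l : seq symbol) : bool := \xor_(x <- l) value x.

Definition lk (p : seq nat * seq nat) : bool :=
  \xor_(e <- cyc_edges p.1) \xor_(e' <- cyc_edges p.2) W e e'.

Lemma values_cat l l' : values (l ++ l') = values l (+) values l'.
Proof. exact: big_cat. Qed.

Lemma values_flatten (T : Type) (F : T -> seq symbol) (s : seq T) :
  values (flatten [seq F x | x <- s]) = \xor_(x <- s) values (F x).
Proof.
by elim: s => [|x s IH]; rewrite ?big_nil ?big_cons -?IH -?values_cat //= /values big_nil.
Qed.

Lemma values_lk p : values (lk_symbols p) = lk p.
Proof.
rewrite /values /lk_symbols /lk big_allpairs_dep /=.
by apply: eq_bigr => e _; apply: eq_bigr => e' _; case: e e' => a b [].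
Qed.

Lemma values_cancels l : cancels l -> values l = false.
Proof.
have [n] := ubnP (size l); elim: n l => // n IH [|x [|y l]] //= s.
  by rewrite /values big_nil.
case/andP=> /eqP-> /IH; rewrite /values !big_cons => ->; first by rewrite addbF addbb.
exact: ltnW s.
Qed.

Lemma values_even l : even_multiset l -> values l = false.
Proof.
move=> /values_cancels <-; apply: perm_big.
by rewrite perm_sym perm_sort.
Qed.

Lemma values_crossing e e' : sorted_edge e -> sorted_edge e' -> vertex_disjoint e e' ->
  values (crossing_relation e e') = false.
Proof.
move=> se se' dis; have := data.1 e e' se se' dis.
case: e e' {se se' dis} => a b [c d]; rewrite /values !big_cons big_nil /=.
by do 2![case: (W _ _)]; do 4![case: (U _ _)]; do 4![case: (L _ _)].
Qed.

Lemma values_left i j : i < 7 -> j < 7 -> i != j -> values (left_relation i j) = false.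
Proof.
move=> i7 j7 ij; rewrite /values !big_cons big_nil /= (data.2 i j) //.
by case: (L j i).
Qed.

Lemma xor0 (T : eqType) (s : seq T) (F : T -> bool) :
  {in s, forall x, F x = false} -> \xor_(x <- s) F x = false.
Proof. by move=> F0; rewrite big_seq big1. Qed.

Lemma values_relations E : all sorted_edge E -> values (relations E) = false.
Proof.
move=> /allP sE; rewrite /relations values_cat values_flatten xor0 => [|[e e'] /=]; last first.
  rewrite mem_filter => /andP[/andP[dis _] /allpairsP[[a b] /= [aE bE [ea eb]]]].
  by subst e e'; apply: values_crossing; rewrite ?sE.
rewrite values_flatten xor0 // => x /flattenP[l /mapP[[e e'] ein ->]].
move: ein; rewrite mem_filter => /andP[/andP[dis _] /allpairsP[[a b] /= [aE bE [ea eb]]]].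
have {}aE : e \in E by rewrite ea.
have {}bE : e' \in E by rewrite eb.
have /andP[e12 e27] := sE _ aE; have /andP[e12' e27'] := sE _ bE.
have e17 := ltn_trans e12 e27; have e17' := ltn_trans e12' e27'.
case/and4P: dis => /= d1 d2 d3 d4.
rewrite !inE; do ![case/orP]; move=> /eqP-> //=; try (by rewrite /values big_nil);
  by case: ifP => _; [apply: values_left => //; rewrite eq_sym | rewrite /values big_nil].
Qed.

Lemma xor_odd (T : Type) (F : T -> bool) (s : seq T) :
  \xor_(x <- s) F x = odd (count F s).
Proof. by elim: s => [|x s IH]; rewrite ?big_nil ?big_cons //= IH oddD oddb. Qed.

Lemma double_count (T V : eqType) (ok : T -> V -> bool) (b : V -> bool)
    (K : seq T) (s : seq V) m :
  all (fun x => count (ok^~ x) K == m) s ->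
  \sum_(k <- K) count b [seq x <- s | ok k x] = m * count b s.
Proof.
move=> /allP okm; rewrite -sum1_count big_distrr /=.
rewrite (eq_bigr (fun k => \sum_(x <- s) (ok k x && b x : nat))) => [|k _]; last first.
  rewrite count_filter -sum1_count big_mkcond; apply: eq_bigr => x _ /=.
  by case: (ok k x); case: (b x).
rewrite exchange_big /= [RHS]big_mkcond /=; apply: eq_big_seq => x xs.
rewrite -(eqP (okm x xs)) -sum1_count muln1; case: (b x).
  by rewrite [RHS]big_mkcond; apply: eq_bigr => k _; rewrite andbT; case: (ok k x).
by rewrite big1 // => k _; rewrite andbF.
Qed.

(** The relations have value 0, so the linking parities of the pairs in [ps] sum to 1 when
    their symbols cancel against those of the relations and [sym_one]. *)
Lemma odd_of_relations ps r :
    even_multiset (sym_one :: flatten (map lk_symbols ps) ++ r) ->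
    values r = false ->
  odd (count lk ps).
Proof.
move=> /values_even + r0; rewrite -cat1s values_cat values_cat r0 addbF values_flatten.
rewrite (eq_bigr lk) => [|p _]; last exact: values_lk.
by rewrite xor_odd /values big_cons big_nil; case: odd.
Qed.

Lemma odd_K6 v : v \in iota 0 7 ->
  odd (count lk [seq p <- unordered_triangle_pairs | avoids_vertex v p]).
Proof.
move=> v7; have chk : all K6_parity_check (iota 0 7) by vm_compute.
apply: (odd_of_relations (allP chk v v7)).
have sE : all (fun v => all sorted_edge (K6_edges v)) (iota 0 7) by vm_compute.
exact: values_relations (allP sE v v7).
Qed.

Lemma odd_K331 k : k \in K331s ->
  odd (count lk [seq p <- triangle_square_pairs | in_K331 k p]).
Proof.
move=> kK; have chk : all K331_parity_check K331s by vm_compute.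
apply: (odd_of_relations (allP chk k kK)).
have sE : all (fun k => all sorted_edge (K331_bipartite_edges k)) K331s by vm_compute.
exact: values_relations (allP sE k kK).
Qed.

Lemma lkC_of_relations p :
    lkC_check p ->
    allrel (fun e e' => [&& sorted_edge e, sorted_edge e' & vertex_disjoint e e'])
      (cyc_edges p.1) (cyc_edges p.2) ->
  lk p = lk (p.2, p.1).
Proof.
rewrite /lkC_check; move: (cyc_edges p.1) (cyc_edges p.2) (values_lk p) (values_lk (p.2, p.1)).
move=> E E' lp lp' /values_even; rewrite values_cat values_cat lp lp' => + /allrelP edges.
have -> : [seq crossing_relation e e' | e <- E, e' <- E'] =
    [seq crossing_relation q.1 q.2 | q <- [seq (e, e') | e <- E, e' <- E']].
  by rewrite map_allpairs.
rewrite values_flatten xor0 => [|q /allpairsP[[e e'] /= [e1 e2 ->]] /=].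
  by rewrite addbF; case: lk; case: lk.
by have /and3P[] := edges e e' e1 e2; apply: values_crossing.
Qed.

(** Summing the crossing relation over the pairs of edges of two cycles, all terms but the
    two linking parities cancel. *)
Lemma lkC p : p \in triangle_pairs ++ triangle_square_pairs -> lk p = lk (p.2, p.1).
Proof.
move=> pin; have chk : all lkC_check (triangle_pairs ++ triangle_square_pairs) by vm_compute.
have edges : all (fun p => allrel (fun e e' => [&& sorted_edge e, sorted_edge e' & vertex_disjoint e e'])
   (cyc_edges p.1) (cyc_edges p.2)) (triangle_pairs ++ triangle_square_pairs) by vm_compute.
exact: lkC_of_relations (allP chk p pin) (allP edges p pin).
Qed.

Definition xor_over (m : nat * nat -> bool) (E : seq (nat * nat)) : bool :=
  foldr (fun e b => m e (+) b) false E.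

(** Says that the numbers of oddly linked 4-cycles and triangles of the [K_4] complementary
    to [t] are 0 and 0, 0 and 4, or 2 and 2. *)
Definition K4_counts (m : nat * nat -> bool) (t : seq nat) : bool :=
  let c := count (fun u => xor_over m (cyc_edges u)) (squares (other_vertices t)) in
  let a := count (fun u => xor_over m (cyc_edges u)) (triangles (other_vertices t)) in
  (c == 2 * (c == 2)) && (a == 2 * (c == 2) + 4 * (a == 4)).

Fixpoint bitseqs (n : nat) : seq bitseq :=
  if n is n'.+1 then [seq b :: s | b <- [:: true; false], s <- bitseqs n'] else [:: [::]].

Lemma mem_bitseqs s : s \in bitseqs (size s).
Proof.
elim: s => //= b s IH; rewrite mem_cat cats0.
by case: b; rewrite map_f ?orbT.
Qed.

Definition K4_edges (t : seq nat) := [seq e <- all_edges | (e.1 \notin t) && (e.2 \notin t)].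

Definition K4_check (t : seq nat) : bool :=
  [&& all (fun u => all (fun e => e \in K4_edges t) (cyc_edges u))
        (squares (other_vertices t) ++ triangles (other_vertices t)),
      size (K4_edges t) == 6
    & all (fun s => K4_counts (fun e => nth false s (index e (K4_edges t))) t) (bitseqs 6)].

(** Only the values of [m] on the six edges matter, so the 64 assignments are tried. *)
Lemma K4_countsP m t : K4_check t -> K4_counts m t.
Proof.
case/and3P=> /allP sub sz chk.
pose s := map m (K4_edges t).
have := allP chk s; have -> : s \in bitseqs 6.
  by rewrite -(eqP sz) -(size_map m); apply: mem_bitseqs.
move=> /(_ isT); rewrite /K4_counts.
have agree u : u \in squares (other_vertices t) ++ triangles (other_vertices t) ->
    xor_over (fun e => nth false s (index e (K4_edges t))) (cyc_edges u) =
    xor_over m (cyc_edges u).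
  move=> /sub /allP; elim: (cyc_edges u) => //= e E IH mem.
  rewrite IH => [|x xE]; last by apply: mem; rewrite inE xE orbT.
  have eE : e \in K4_edges t by apply: mem; rewrite inE eqxx.
  by rewrite (nth_map e) ?index_mem // nth_index.
rewrite (@eq_in_count _ _ (fun u => xor_over m (cyc_edges u)) (squares _)); last first.
  by move=> u us; apply: agree; rewrite mem_cat us.
rewrite (@eq_in_count _ _ (fun u => xor_over m (cyc_edges u)) (triangles _)) //.
by move=> u us; apply: agree; rewrite mem_cat us orbT.
Qed.

Lemma lk_xor_over t u :
  lk (t, u) = xor_over (fun e' => \xor_(e <- cyc_edges t) W e e') (cyc_edges u).
Proof.
rewrite /lk exchange_big /=; elim: (cyc_edges u) => [|e E IH]; first by rewrite big_nil.
by rewrite big_cons IH.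
Qed.

Lemma links_at_least_21 :
  21 <= count lk unordered_triangle_pairs + count lk triangle_square_pairs.
Proof.
set N3 := count lk unordered_triangle_pairs; set N4 := count lk triangle_square_pairs.
(* A pair of disjoint triangles misses one vertex, so it lies in exactly one [K_6]. *)
have odd3 : odd N3.
  have := @double_count _ _ avoids_vertex lk (iota 0 7) unordered_triangle_pairs 1.
  have -> : all (fun p => count (avoids_vertex^~ p) (iota 0 7) == 1) unordered_triangle_pairs.
    by vm_compute.
  move=> /(_ isT); rewrite mul1n -/N3 => <-.
  suff odd_sum s : {subset s <= iota 0 7} ->
      odd (\sum_(k <- s) count lk [seq x <- unordered_triangle_pairs | avoids_vertex k x])
      = odd (size s).
    by rewrite odd_sum.
  elim: s => [|v s IH] sub; first by rewrite big_nil.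
  rewrite big_cons oddD odd_K6 ?IH //; first by move=> x xs; apply: sub; rewrite inE xs orbT.
  by apply: sub; rewrite inE eqxx.
(* Each triangle-square pair lies in 6 of the 70 copies of [K_{3,3,1}]. *)
have le4 : 70 <= 6 * N4.
  have := @double_count _ _ in_K331 lk K331s triangle_square_pairs 6.
  have -> : all (fun p => count (in_K331^~ p) K331s == 6) triangle_square_pairs.
    by vm_compute.
  rewrite -/N4 => /(_ isT) <-.
  have -> : 70 = \sum_(k <- K331s) 1 by rewrite sum1_size; vm_compute.
  rewrite [leqLHS]big_seq [leqRHS]big_seq; apply: leq_sum => k kK.
  exact: odd_gt0 (odd_K331 kK).
pose c t := count (fun u => lk (t, u)) (squares (other_vertices t)).
pose a t := count (fun u => lk (t, u)) (triangles (other_vertices t)).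
have ca t : t \in triangles (iota 0 7) ->
    c t = 2 * (c t == 2) /\ a t = 2 * (c t == 2) + 4 * (a t == 4).
  move=> tin; have chk : all K4_check (triangles (iota 0 7)) by vm_compute.
  have := K4_countsP (fun e' => \xor_(e <- cyc_edges t) W e e') (allP chk t tin).
  rewrite /K4_counts -!(eq_count (lk_xor_over t)) => /andP[/eqP c2 /eqP a2].
  by split.
have count_pairs (F : seq nat -> seq (seq nat)) s :
    count lk [seq (t, u) | t <- s, u <- F t] = \sum_(t <- s) count (fun u => lk (t, u)) (F t).
  elim: s => [|t s IH]; first by rewrite big_nil.
  by rewrite big_cons -IH /= count_cat count_map.
have sum4 : N4 = \sum_(t <- triangles (iota 0 7)) c t by exact: count_pairs.
have sum3 : 2 * N3 = \sum_(t <- triangles (iota 0 7)) a t.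
  rewrite -count_pairs -/triangle_pairs.
  pose swap (p : seq nat * seq nat) := (p.2, p.1).
  (* The sum over triangles meets every pair of triangles in both orders. *)
  have pe : perm_eq triangle_pairs
      (unordered_triangle_pairs ++ map swap unordered_triangle_pairs) by vm_compute.
  rewrite (permP pe) count_cat count_map mul2n -addnn; congr (_ + _).
  apply: eq_in_count => p; rewrite mem_filter => /andP[_ pin] /=.
  by apply: lkC; rewrite mem_cat pin.
pose p := \sum_(t <- triangles (iota 0 7)) (c t == 2).
pose q := \sum_(t <- triangles (iota 0 7)) (a t == 4).
have N4E : N4 = 2 * p.
  by rewrite sum4 /p big_distrr; apply: eq_big_seq => t /ca[].
have N3E : 2 * N3 = 2 * p + 4 * q.
  by rewrite sum3 /p /q !big_distrr -big_split; apply: eq_big_seq => t /ca[].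
(* [p] is odd and at least 6, so at least 7, and the sum is [3 * p + 2 * q]. *)
by move: odd3 le4 N4E N3E; clearbody N3 N4 p q; lia.
Qed.

End Counting.

Local Close Scope nat_scope.

(** * Every embedding has at least 21 links *)

(** Every vertex is the first end of one step of the cycle and the second end of
    another one. *)
Lemma even_cyc_edges s : uniq s -> even_edges (cyc_edges s).
Proof.
move=> us g; rewrite /cyc_edges big_map /=.
rewrite (eq_bigr (fun x => g x (+) g (next s x))) => [|x _]; last first.
  by case: (leqP x (next s x)) => _ //; rewrite addbC.
rewrite big_split /=.
have -> : \xor_(x <- s) g (next s x) = \xor_(x <- s) g x; last by rewrite addbb.
rewrite -(big_map (next s) xpredT g); apply: perm_big; apply: uniq_perm => //.
  by rewrite map_inj_uniq //; apply: can_inj (prev_next us).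
move=> x; apply/mapP/idP => [[y ys ->]|xs]; first by rewrite mem_next.
by exists (prev s x); rewrite ?mem_prev // next_prev.
Qed.

Definition cycle_set (s : seq nat) : {set {set 'I_7}} :=
  let S := map (@inord 6) s in [set [set x; next S x] | x in S]%SET.

Definition in_K7 (s : seq nat) : bool := all (fun x => (x < 7)%N) s.

Lemma map_val_inord s : in_K7 s -> map val (map (@inord 6) s) = s.
Proof.
by move=> /allP ss; rewrite -map_comp map_id_in // => x /ss x7; rewrite /= inordK.
Qed.

Lemma uniq_inord s : in_K7 s -> uniq s -> uniq (map (@inord 6) s).
Proof. by move=> ss us; rewrite -(map_inj_uniq val_inj) map_val_inord. Qed.

Lemma next_inord s x : in_K7 s -> uniq s -> x \in s ->
  next (map (@inord 6) s) (inord x) = inord (next s x).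
Proof.
move=> ss us xs; have := next_map val_inj (uniq_inord ss us) (inord x).
rewrite map_val_inord //= inordK; last exact: allP ss x xs.
by move=> ->; rewrite inord_val.
Qed.

Lemma mem_cycle_set s i j : in_K7 s -> uniq s -> (i < j < 7)%N ->
  ([set inord i; inord j]%SET \in cycle_set s) = ((i, j) \in cyc_edges s).
Proof.
move=> ss us /andP[ij j7]; have i7 := ltn_trans ij j7.
have in7 x : x \in s -> (x < 7)%N by exact: allP ss x.
apply/imsetP/mapP => -[x].
  move=> /mapP[y ys ->]; rewrite next_inord // => eqs.
  exists y => //; have n7 : (next s y < 7)%N by rewrite in7 ?mem_next.
  have : inord i \in [set (@inord 6 i); inord j]%SET by rewrite !inE eqxx.
  have : inord j \in [set (@inord 6 i); inord j]%SET by rewrite !inE eqxx orbT.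
  have y7 := in7 _ ys; rewrite eqs !inE -!val_eqE /= !inordK //.
  move=> /orP[] /eqP jE /orP[] /eqP iE; move: ij; rewrite iE jE ?ltnn // => lt_ij.
    by rewrite minnC maxnC (minn_idPl (ltnW lt_ij)) (maxn_idPr (ltnW lt_ij)).
  by rewrite (minn_idPl (ltnW lt_ij)) (maxn_idPr (ltnW lt_ij)).
move=> xs [-> ->]; exists (inord x); first exact: (map_f _ xs).
rewrite next_inord //; case: (leqP x (next s x)) => // _.
by rewrite finset.setUC.
Qed.

Lemma is_graph_cycle_set s : in_K7 s -> uniq s -> (2 < size s)%N ->
  all (fun x => next s x != x) s ->
  is_graph_cycle (complete_graph 7) (cycle_set s).
Proof.
move=> ss us s2 /allP noloop; exists (map (@inord 6) s); split=> //.
- exact: uniq_inord.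
- by rewrite size_map.
- apply: cycle_from_next => [|x /mapP[y ys ->]]; first exact: uniq_inord.
  rewrite next_inord // /complete_graph /= -val_eqE /= !inordK ?(allP ss) ?mem_next //.
  by rewrite eq_sym noloop.
Qed.

Lemma cover_cycle_set s (x : 'I_7) : in_K7 s ->
  x \in finset.cover (cycle_set s) -> val x \in s.
Proof.
move=> ss /bigcupP[B /imsetP[y yS ->]]; rewrite -{2}(map_val_inord ss) mem_map; last exact: val_inj.
by rewrite !inE => /orP[] /eqP->; rewrite ?mem_next.
Qed.

Section LowerBound.
Variable R : realType.

Definition edge_path (f : 'rV[R]_7 -> 'rV[R]_3) (i j : nat) (t : R) : 'rV[R]_3 :=
  f ((1 - clamp t) *: vertex R (inord i) + clamp t *: vertex R (inord j)).

Lemma continuous_edge_path f i j :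
  {within realization (complete_graph 7), continuous f} ->
  (i < j < 7)%N -> continuous (edge_path f i j).
Proof.
move=> /subspace_continuousP cf /andP[ij j7] t.
pose g (t : R) := (1 - clamp t) *: vertex R (inord i) + clamp t *: vertex R (@inord 6 j).
have cg : continuous g.
  move=> u; apply: cvgD; apply: cvgZr_tmp; last exact: continuous_clamp.
  by apply: cvgB; [exact: cvg_cst | exact: continuous_clamp].
have gA u : realization (complete_graph 7) (g u).
  right; exists (inord i), (inord j); split.
    by rewrite /complete_graph /= -val_eqE /= !inordK ?(ltn_trans ij) // ltn_eqF.
  by exists (clamp u) => //=; rewrite in_itv /= clamp_in.
move=> U /(cf _ (gA t)) /cg; rewrite /= !nbhs_simpl /=.
by apply: filterS => u /(_ (gA u)).
Qed.

Lemma edge_path0 f i j : edge_path f i j 0 = edge_path f i i 0.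
Proof. by rewrite /edge_path clamp_id ?lexx ?ler01 // !scale0r. Qed.

Lemma edge_path1 f i j : edge_path f i j 1 = edge_path f j j 0.
Proof.
rewrite /edge_path !clamp_id ?lexx ?ler01 //.
by rewrite subrr subr0 !scale0r scale1r add0r addr0.
Qed.

Lemma edge_path_cycle f s e t : in_K7 s -> uniq s -> e \in cyc_edges s ->
  sorted_edge e -> (f @` cycle_realization (cycle_set s)) (edge_path f e.1 e.2 t).
Proof.
case: e => i j ss us es se;
exists ((1 - clamp t) *: vertex R (inord i) + clamp t *: vertex R (inord j)) => //.
exists (inord i), (inord j); split; first by rewrite mem_cycle_set.
by exists (clamp t) => //=; rewrite in_itv /= clamp_in.
Qed.

Definition cycle_pairs := unordered_triangle_pairs ++ triangle_square_pairs.

Lemma cycle_pairs_sub : {subset cycle_pairs <= triangle_pairs ++ triangle_square_pairs}.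
Proof.
apply: mem_subseq; rewrite /cycle_pairs; apply: cat_subseq; last exact: subseq_refl.
exact: filter_subseq.
Qed.

Definition cycle_check (s : seq nat) : bool :=
  [&& in_K7 s, uniq s, (2 < size s)%N & all (fun x => next s x != x) s].

Definition cycle_pair_check (p : seq nat * seq nat) : bool :=
  [&& cycle_check p.1, cycle_check p.2, all (fun x => x \notin p.2) p.1,
      all sorted_edge (cyc_edges p.1), all sorted_edge (cyc_edges p.2)
    & allrel vertex_disjoint (cyc_edges p.1) (cyc_edges p.2)].

Lemma cycle_pairs_checked : all cycle_pair_check cycle_pairs. Proof. by vm_compute. Qed.

Definition pair_link (p : seq nat * seq nat) : {set {set {set 'I_7}}} :=
  [set cycle_set p.1; cycle_set p.2]%SET.

Definition edge_mask (p : seq nat * seq nat) : bitseq :=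
  let E := cyc_edges p.1 ++ cyc_edges p.2 in [seq e \in E | e <- all_edges].

Lemma uniq_map_inj_in (T V : eqType) (F : T -> V) (s : seq T) :
  uniq (map F s) -> {in s &, injective F}.
Proof.
move=> us x y xs ys eqF; rewrite -(nth_index x xs) -(nth_index x ys); congr (nth x s _).
apply/eqP; rewrite -(@nth_uniq _ (F x) (map F s)) ?size_map ?index_mem //.
by rewrite !(nth_map x) ?index_mem // !nth_index // eqF.
Qed.

Lemma uniq_edge_masks : uniq (map edge_mask cycle_pairs).
Proof. by vm_compute. Qed.

(** A pair of disjoint cycles is determined by the union of their edge sets; that these
    unions are distinct is a computation with [edge_mask]. *)
Lemma pair_link_inj : {in cycle_pairs &, injective pair_link}.
Proof.
move=> p q pin qin eq_pq.
have maskE r : r \in cycle_pairs -> edge_mask r =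
    [seq [set inord e.1; inord e.2]%SET \in finset.cover (pair_link r) | e <- all_edges].
  move=> rin; have /and3P[/and4P[s1 u1 _ _] /and4P[s2 u2 _ _] _] := allP cycle_pairs_checked r rin.
  apply/eq_in_map => -[i j] ein.
  have ij : (i < j < 7)%N by apply: (allP (_ : all sorted_edge all_edges) _ ein).
  rewrite /pair_link /finset.cover finset.bigcup_setU !big_set1 inE.
  by rewrite !mem_cycle_set // mem_cat.
have : edge_mask p = edge_mask q by rewrite !maskE // eq_pq.
exact: uniq_map_inj_in uniq_edge_masks _ _ pin qin.
Qed.

(** There are two cases because either cycle can be the one inside the sphere; the other
    order of the cycles is brought back by [lkC]. *)
Lemma near_even_of_split f p : {within realization (complete_graph 7), continuous f} ->
    p \in cycle_pairs ->
    split_link (f @` cycle_realization (cycle_set p.1)) (f @` cycle_realization (cycle_set p.2)) ->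
  \forall n \near \oo, \forall d \near 0^'+,
    loops_over (perturbed (graph_pos (edge_path f) n) d) n (cyc_edges p.1) (cyc_edges p.2) = false \/
    loops_over (perturbed (graph_pos (edge_path f) n) d) n (cyc_edges p.2) (cyc_edges p.1) = false.
Proof.
move=> cf pin [h [ch [g [cg hK gK]]]].
have /and5P[/and4P[s1 u1 _ _] /and4P[s2 u2 _ _] _ se1 /andP[se2 dis]] := allP cycle_pairs_checked p pin.
have pathP e : sorted_edge e -> [/\ continuous (edge_path f e.1 e.2),
    edge_path f e.1 e.2 0 = edge_path f e.1 e.1 0 &
    edge_path f e.1 e.2 1 = edge_path f e.2 e.2 0].
  by move=> se; split; [exact: continuous_edge_path | exact: edge_path0 | exact: edge_path1].
have side s e t (B : set 'rV[R]_3) : in_K7 s -> uniq s -> all sorted_edge (cyc_edges s) ->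
    f @` cycle_realization (cycle_set s) `<=` h @` B -> e \in cyc_edges s ->
    B (g (edge_path f e.1 e.2 t)).
  move=> ss us se sub es.
  have [x Bx <-] := sub _ (edge_path_cycle f t ss us es (allP se e es)).
  by rewrite hK.
have dis' : allrel vertex_disjoint (cyc_edges p.2) (cyc_edges p.1).
  apply/allrelP => e e' e2 e1; rewrite vertex_disjointC.
  by move/allrelP: dis; apply.
case=> -[sub1 sub2].
  have near1 := @near_loops_over_split R (edge_path f) h g (cyc_edges p.1) (cyc_edges p.2)
    ch cg hK gK se1 se2 (even_cyc_edges u1) (even_cyc_edges u2) dis.
  apply: filterS (near1 _ _ _) => [n|e|e t ein|e t ein].
  - by apply: filterS => d; left.
  - by rewrite mem_cat => /orP[] ein; apply: pathP; [apply: (allP se1)|apply: (allP se2)].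
  - exact: (side _ _ _ [set x | sqnorm x < 1] s1 u1 se1 sub1 ein).
  - exact: (side _ _ _ [set x | 1 < sqnorm x] s2 u2 se2 sub2 ein).
have near2 := @near_loops_over_split R (edge_path f) h g (cyc_edges p.2) (cyc_edges p.1)
  ch cg hK gK se2 se1 (even_cyc_edges u2) (even_cyc_edges u1) dis'.
apply: filterS (near2 _ _ _) => [n|e|e t ein|e t ein].
- by apply: filterS => d; right.
- by rewrite mem_cat => /orP[] ein; apply: pathP; [apply: (allP se2)|apply: (allP se1)].
- exact: (side _ _ _ [set x | sqnorm x < 1] s2 u2 se2 sub1 ein).
- exact: (side _ _ _ [set x | 1 < sqnorm x] s1 u1 se1 sub2 ein).
Qed.

Lemma crossing_data_paths (P : label -> 'rV[R]_3) n : (0 < n)%N ->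
  in_general_position (labels n) P ->
  crossing_data (path_over P n) (path_above P n) (vertex_left_of P).
Proof.
move=> n0 gp; split; first by move=> e e'; apply: path_crossing_parity.
move=> i j i7 j7 ij; rewrite /vertex_left_of /left_of -leNgt.
have : xcoord (P (vertex_label i)) != xcoord (P (vertex_label j)).
  apply: (gp_xcoord gp); first by rewrite /= inE !xpair_eqE eqxx (negPf ij).
  by apply: in_labels_sub; rewrite /= !mem_labels.
by case: ltgtP.
Qed.

(** There are finitely many pairs of cycles, so one [n] and then one [d] serve for all of them.
    The oddly linked pairs then are not split, and there are at least 21 of them. *)
Lemma number_of_links_ge21 (f : 'rV[R]_7 -> 'rV[R]_3) :
  {within realization (complete_graph 7), continuous f} ->
  (21 <= number_of_links (complete_graph 7) f)%N.
Proof.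
move=> cf.
pose even n d (p : seq nat * seq nat) :=
  loops_over (perturbed (graph_pos (edge_path f) n) d) n (cyc_edges p.1) (cyc_edges p.2) = false \/
  loops_over (perturbed (graph_pos (edge_path f) n) d) n (cyc_edges p.2) (cyc_edges p.1) = false.
pose splits p := split_link (f @` cycle_realization (cycle_set p.1))
                            (f @` cycle_realization (cycle_set p.2)).
have near_n : \forall n \near \oo, forall p, p \in cycle_pairs ->
    splits p -> \forall d \near 0^'+, even n d p.
  apply: near_in_seq => p pin; have [sp|nsp] := pselect (splits p); last exact: nearW.
  by apply: filterS (near_even_of_split cf pin sp).
have [n [n0 evn]] := filter_ex (filterI (nbhs_infty_gt 0) near_n).
have near_d : \forall d \near 0^'+, forall p, p \in cycle_pairs -> splits p -> even n d p.
  apply: near_in_seq => p pin; have [sp|nsp] := pselect (splits p); last exact: nearW.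
  by apply: filterS (evn p pin sp).
have near_gp := @near_in_general_position R label (graph_pos (edge_path f) n) (labels n).
have [d [gp evd]] := @filter_ex _ (0^'+ : set_system R) _ _ (filterI near_gp near_d).
set P := perturbed (graph_pos (edge_path f) n) d in gp.
have data := crossing_data_paths n0 gp.
pose link := lk (path_over P n).
have nsplit p : p \in cycle_pairs -> link p -> ~ splits p.
  move=> pin lp sp; have [|] := evd p pin sp; rewrite -/P => e0.
    by move: lp; rewrite /link /lk -/(loops_over P n _ _) e0.
  have pin' := cycle_pairs_sub pin.
  by move: lp; rewrite /link (lkC data pin') /lk /= -/(loops_over P n _ _) e0.
have := links_at_least_21 data; rewrite -count_cat -/cycle_pairs -/link -size_filter => le21.
apply: leq_trans le21 _; rewrite -(size_map pair_link) /number_of_links cardE.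
apply: uniq_leq_size.
  rewrite map_inj_in_uniq ?filter_uniq ?(map_uniq uniq_edge_masks) //.
  move=> p q; rewrite !mem_filter => /andP[_ pin] /andP[_ qin]; exact: pair_link_inj.
move=> _ /mapP[p + ->]; rewrite mem_filter => /andP[lp pin].
rewrite mem_enum inE; apply/asboolP; exists (cycle_set p.1), (cycle_set p.2).
have /and5P[/and4P[s1 u1 z1 l1] /and4P[s2 u2 z2 l2] dis _ _] := allP cycle_pairs_checked p pin.
split=> //; try exact: is_graph_cycle_set; last exact: nsplit.
apply/setP => x; rewrite !inE; apply/negP => /andP[/(cover_cycle_set s1) x1 /(cover_cycle_set s2) x2].
by move: (allP dis _ x1); rewrite x2.
Qed.

End LowerBound.

(** * Gauges and spheres *)

Section Gauges.
Variable R : realType.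
Implicit Types (g a b : 'rV[R]_3 -> R) (x y c : 'rV[R]_3) (t : R).

(** The continuous gauges (Minkowski functionals) of bounded star-shaped neighbourhoods of
    0, convex or not. *)
Record is_gauge g : Prop := {
  gauge_cont : continuous g;
  gaugeZ : forall t x, 0 <= t -> g (t *: x) = t * g x;
  gauge_gt0 : forall x, x != 0 -> 0 < g x }.

Lemma gauge0 g : is_gauge g -> g 0 = 0.
Proof. by move=> gg; rewrite -(scale0r (0 : 'rV[R]_3)) (gaugeZ gg) // mul0r. Qed.

Lemma gauge_ge0 g x : is_gauge g -> 0 <= g x.
Proof.
move=> gg; have [->|x0] := eqVneq x 0; first by rewrite gauge0.
exact/ltW/(gauge_gt0 gg).
Qed.

Lemma gauge_bound g : is_gauge g -> exists2 m, 0 < m & forall x, m * `|x| <= g x.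
Proof.
move=> gg; pose S := [set x : 'rV[R]_3 | `|x| = 1].
have S0 : S !=set0.
  have u0 : (const_mx 1 : 'rV[R]_3) != 0.
    by apply/eqP => /rowP/(_ 0); rewrite !mxE => /eqP; rewrite oner_eq0.
  exists (`|const_mx 1 : 'rV[R]_3|^-1 *: const_mx 1).
  by rewrite /S /= normrZ ger0_norm ?invr_ge0 // mulVf // normr_eq0.
have cS : compact S.
  apply: bounded_closed_compact.
    by exists 1; split=> // M M1 x; rewrite /S /= => ->; apply: ltW.
  have -> : S = (fun x : 'rV[R]_3 => `|x|) @^-1` [set 1] by [].
  apply: preimage_closed; last exact: closed_eq.
  by move=> x _; apply: norm_continuous.
have [c cS' minc] := EVT_min_rV S0 cS (continuous_subspaceT (gauge_cont gg)).
exists (g c).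
  apply: (gauge_gt0 gg); apply/eqP => c0; move: cS'.
  by rewrite inE /S /= c0 normr0 => /esym/eqP; rewrite oner_eq0.
move=> x; have [->|x0] := eqVneq x 0; first by rewrite normr0 mulr0 gauge_ge0.
have nx : 0 < `|x| by rewrite normr_gt0.
rewrite -ler_pdivlMr // mulrC -(gaugeZ gg) ?invr_ge0 //.
apply: minc; rewrite inE /S /= normrZ gtr0_norm ?invr_gt0 // mulVf //.
by rewrite gt_eqF.
Qed.

(** Stretches each ray so that the unit ball of [a] becomes that of [b]. *)
Definition radial a b x := (a x / b x) *: x.

Lemma radialK a b : is_gauge a -> is_gauge b -> cancel (radial a b) (radial b a).
Proof.
move=> ga gb x; rewrite /radial; have [->|x0] := eqVneq x 0; first by rewrite !scaler0.
have pa := gauge_gt0 ga x0; have pb := gauge_gt0 gb x0.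
rewrite (gaugeZ ga) ?(gaugeZ gb) ?divr_ge0 ?ltW // scalerA.
have -> : a x / b x * b x / (a x / b x * a x) * (a x / b x) = 1.
  by field; rewrite !gt_eqF.
by rewrite scale1r.
Qed.

Lemma gauge_radial a b x : is_gauge a -> is_gauge b -> b (radial a b x) = a x.
Proof.
move=> ga gb; have [->|x0] := eqVneq x 0; first by rewrite /radial scaler0 !gauge0.
have pa := gauge_gt0 ga x0; have pb := gauge_gt0 gb x0.
by rewrite /radial (gaugeZ gb) ?divr_ge0 ?ltW // divfK // gt_eqF.
Qed.

(** At 0 the quotient of the gauges has no limit; continuity there comes from
    [gauge_bound], as [b (radial a b x) = a x] tends to 0. *)
Lemma continuous_radial a b : is_gauge a -> is_gauge b -> continuous (radial a b).
Proof.
move=> ga gb x; have [->|x0] := eqVneq x 0; last first.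
  apply: (@cvgZ _ _ _ (nbhs x) _ (fun y => a y / b y) id); last exact: cvg_id.
  apply: (@cvgM _ _ (nbhs x) _ a (fun y => (b y)^-1)); first exact: (gauge_cont ga).
  by apply: (@cvgV _ _ (nbhs x) _ b); [rewrite gt_eqF // (gauge_gt0 gb) | exact: (gauge_cont gb)].
have [m m0 bm] := gauge_bound gb.
have r0 : radial a b 0 = 0 by rewrite /radial scaler0.
rewrite /continuous_at r0; apply/(@cvgrPdist_lt _ _ _ (nbhs (0 : 'rV[R]_3))) => e e0.
have em : 0 < e * m by rewrite mulr_gt0.
have ca : a @ (0 : 'rV[R]_3) --> (0 : R).
  have cont_a : continuous a := gauge_cont ga.
  by have := cont_a (0 : 'rV[R]_3); rewrite /continuous_at gauge0.
have /cvgrPdist_lt/(_ _ em) := ca; apply: filterS => y.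
rewrite !sub0r !normrN [X in X < _]ger0_norm ?gauge_ge0 // => ay.
have := bm (radial a b y); rewrite gauge_radial // => bound.
by rewrite -(ltr_pM2l m0); apply: le_lt_trans bound _; rewrite [m * e]mulrC.
Qed.

Definition euclid x : R := Num.sqrt (sqnorm x).

Lemma euclid_gauge : is_gauge euclid.
Proof.
split.
- have csq : continuous (@sqnorm R).
    rewrite /sqnorm; have h := @continuous_big R 'I_3 +%R 0 xpredT (@add_continuous R^o) 'rV[R]_3
      (index_enum 'I_3) (fun i (y : 'rV[R]_3) => y 0 i ^+ 2).
    apply: h => i _ y.
    by apply: (@cvgM _ _ (nbhs y) _ (fun y => y 0 i) (fun y => y 0 i)); apply: coord_continuous.
  by move=> x; apply: (@continuous_comp _ _ _ (@sqnorm R) Num.sqrt); [exact: csq | exact: sqrt_continuous].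
- move=> t x t0; rewrite /euclid /sqnorm.
  have -> : \sum_i (t *: x) 0 i ^+ 2 = t ^+ 2 * \sum_i x 0 i ^+ 2.
    by rewrite big_distrr; apply: eq_bigr => i _; rewrite mxE exprMn.
  by rewrite sqrtrM ?sqr_ge0 // sqrtr_sqr ger0_norm.
- move=> x x0; rewrite sqrtr_gt0 lt_neqAle sumr_ge0 ?andbT => [|i _]; last exact: sqr_ge0.
  rewrite eq_sym; apply: contra x0 => /eqP s0; apply/eqP/rowP => i; rewrite mxE.
  apply/eqP; rewrite -sqrf_eq0; apply/eqP.
  have := @psumr_eq0P R _ xpredT (fun i => x 0 i ^+ 2) _ s0 i isT; apply.
  by move=> j _; apply: sqr_ge0.
Qed.

(** The sphere is the unit sphere of the gauge, centred at [c]: the image of the round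
    sphere by a radial homeomorphism. *)
Lemma split_by_gauge g c (P Q : set 'rV[R]_3) : is_gauge g ->
    (forall x, P x -> g (x - c) < 1) -> (forall x, Q x -> 1 < g (x - c)) ->
  exists2 h : 'rV[R]_3 -> 'rV[R]_3, homeomorphism h & sphere_separates h P Q.
Proof.
move=> gg inP outQ; pose h x := c + radial euclid g x.
pose k x := radial g euclid (x - c).
have ge := euclid_gauge.
have hk : cancel k h by move=> x; rewrite /h /k radialK // addrC subrK.
have kh : cancel h k by move=> x; rewrite /h /k addrC addKr radialK.
exists h.
  split; first by move=> x; apply: (@cvgD _ _ _ (nbhs x) _ (fun=> c)); [exact: cvg_cst | exact: continuous_radial].
  exists k; split=> // x; apply: (@continuous_comp _ _ _ (fun x => x - c) (radial g euclid)).
    by apply: (@cvgB _ _ _ (nbhs x) _ id (fun=> c)); [exact: cvg_id | exact: cvg_cst].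
  exact: continuous_radial.
have sq x : sqnorm (k x) = g (x - c) ^+ 2.
  rewrite -(gauge_radial (x - c) gg ge) sqr_sqrtr //.
  by apply: sumr_ge0 => i _; apply: sqr_ge0.
split=> x; [move=> /inP gx|move=> /outQ gx]; exists (k x) => //=; rewrite sq.
  by rewrite expr_lt1 ?gauge_ge0.
by rewrite expr_gt1 ?gauge_ge0.
Qed.

End Gauges.

(** * Spheres around flat and bent discs *)

Section Discs.
Variable R : realType.
Implicit Types (x y c : 'rV[R]_3) (t : R).

Record is_semigauge (g : 'rV[R]_3 -> R) : Prop := {
  semigauge_cont : continuous g;
  semigaugeZ : forall t x, 0 <= t -> g (t *: x) = t * g x;
  semigauge_ge0 : forall x, 0 <= g x }.

(** Discs that are star-shaped about [c]: [g] is a gauge along the disc, and [z] an unsigned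
    height over a cone that contains it.  As [z] need not be linear, the disc may be
    bent. *)
Definition is_disc (K : set 'rV[R]_3) : Prop := exists (g z : 'rV[R]_3 -> R) c,
  [/\ is_semigauge g, is_semigauge z,
      forall x, g x = 0 -> z x = 0 -> x = 0
    & forall x, K x <-> g (x - c) <= 1 /\ z (x - c) = 0].

(** The unit ball of [(g + z / d) / (1 + d)] is a neighbourhood of the disc that shrinks to
    the disc when [d] tends to 0.  The segments are compact, so they are outside for
    small [d]. *)
Lemma split_by_disc (K P Q : set 'rV[R]_3) (S : seq ('rV[R]_3 * 'rV[R]_3)) :
    is_disc K -> P `<=` K ->
    (forall x, Q x -> exists2 s, s \in S & segment s.1 s.2 x) ->
    (forall s, s \in S -> segment s.1 s.2 `&` K = set0) ->
  exists2 h : 'rV[R]_3 -> 'rV[R]_3, homeomorphism h & sphere_separates h P Q.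
Proof.
move=> [g [z [c [gg zg def KE]]]] PK QS SK.
(* Off the disc either the height is positive, and [z / d] is large, or [g] exceeds 1. *)
have near_out : \forall d \near 0^'+, forall s, s \in S ->
    forall t, `[0, 1]%classic t ->
    1 + d < g ((1 - t) *: s.1 + t *: s.2 - c) + z ((1 - t) *: s.1 + t *: s.2 - c) / d.
  apply: near_in_seq => s sS.
  pose y t := (1 - t) *: s.1 + t *: s.2 - c.
  have cy : continuous y.
    move=> t; apply: (@cvgB _ _ _ (nbhs t) _ (fun t => (1 - t) *: s.1 + t *: s.2) (fun=> c)).
      apply: (@cvgD _ _ _ (nbhs t) _ (fun t => (1 - t) *: s.1) (fun t => t *: s.2)).
        by apply: cvgZr_tmp; apply: cvgB; [exact: cvg_cst | exact: cvg_id].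
      exact: cvgZr_tmp.
    exact: cvg_cst.
  have /compact_near_coveringP cov : compact (`[0, 1]%classic : set R) by exact: segment_compact.
  apply: (cov _ _ (fun d t => 1 + d < g (y t) + z (y t) / d)) => t t01.
  have out : ~ (g (y t) <= 1 /\ z (y t) = 0).
    move=> /KE Kx; have : (segment s.1 s.2 `&` K) ((1 - t) *: s.1 + t *: s.2).
      by split=> //; exists t.
    by rewrite SK.
  have cgy : g \o y @ t --> g (y t).
    by apply: continuous_comp; [exact: cy | exact: semigauge_cont].
  have czy : z \o y @ t --> z (y t).
    by apply: continuous_comp; [exact: cy | exact: semigauge_cont].
  have [g1|g1] := lerP (g (y t)) 1.
    have z0 : 0 < z (y t).
      rewrite lt_neqAle (semigauge_ge0 zg) andbT eq_sym; apply/eqP => z0; exact: out.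
    have hz : \forall u \near t, z (y t) / 2 < z (y u).
      by have /cvgr_gt := czy; apply; lra.
    exists ([set u | z (y t) / 2 < z (y u)], [set d | 0 < d < Num.min (1 / 2) (z (y t) / 4)]) => /=.
      split=> //.
      have m0 : 0 < Num.min (1 / 2) (z (y t) / 4).
        by rewrite lt_min; apply/andP; split; lra.
      by apply: filterS2 (nbhs_right_gt 0) (nbhs_right_lt m0) => d d0 dm; rewrite /= d0 dm.
    move=> [u d] /= [zu /andP[d0]]; rewrite lt_min => /andP[d1 d2].
    have z2 : 2 < z (y u) / d by rewrite ltr_pdivlMr //; lra.
    by have := semigauge_ge0 gg (y u); lra.
  have hg : \forall u \near t, (1 + g (y t)) / 2 < g (y u).
    by have /cvgr_gt := cgy; apply; lra.
  exists ([set u | (1 + g (y t)) / 2 < g (y u)], [set d | 0 < d < (g (y t) - 1) / 2]) => /=.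
    split=> //; have m0 : 0 < (g (y t) - 1) / 2 by lra.
    by apply: filterS2 (nbhs_right_gt 0) (nbhs_right_lt m0) => d d0 dm; rewrite /= d0 dm.
  move=> [u d] /= [gu /andP[d0 d1]].
  have : 0 <= z (y u) / d by rewrite divr_ge0 ?(semigauge_ge0 zg) // ltW.
  by lra.
have [d [d0 out]] := @filter_ex _ (0^'+ : set_system R) _ _ (filterI (nbhs_right_gt (0 : R)) near_out).
have d1 : 0 < 1 + d by lra.
pose G x := (g x + z x / d) / (1 + d).
apply: (@split_by_gauge R G c).
- split.
  + move=> x; apply: (@cvgM _ _ (nbhs x) _ (fun x => g x + z x / d) (fun=> (1 + d)^-1)).
      apply: (@cvgD _ _ _ (nbhs x) _ g (fun x => z x / d)); first exact: semigauge_cont.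
      apply: (@cvgM _ _ (nbhs x) _ z (fun=> d^-1)); last exact: cvg_cst.
      exact: semigauge_cont.
    exact: cvg_cst.
  + by move=> t x t0; rewrite /G (semigaugeZ gg) // (semigaugeZ zg) // !mulrA mulrDr !mulrA.
  + move=> x x0; rewrite divr_gt0 //.
    have g0 := semigauge_ge0 gg x; have z0 := semigauge_ge0 zg x.
    rewrite lt_neqAle addr_ge0 ?divr_ge0 ?(ltW d0) // andbT eq_sym.
    rewrite paddr_eq0 ?divr_ge0 ?(ltW d0) // mulf_eq0 invr_eq0 (gt_eqF d0) orbF.
    by apply: contra x0 => /andP[/eqP gx /eqP zx]; apply/eqP/def.
- move=> x /PK /KE[g1 z0]; rewrite /G z0 mul0r addr0 ltr_pdivrMr // mul1r.
  by apply: le_lt_trans g1 _; rewrite ltrDl.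
- move=> x /QS[s sS [t t01 <-]].
  by rewrite /G ltr_pdivlMr // mul1r; apply: out.
Qed.

Definition in_hull (a b c : 'rV[R]_3) : set 'rV[R]_3 := [set x | exists l : R * R * R,
  [/\ 0 <= l.1.1, 0 <= l.1.2, 0 <= l.2, l.1.1 + l.1.2 + l.2 = 1
    & x = l.1.1 *: a + l.1.2 *: b + l.2 *: c]].

Definition is_form (f : 'rV[R]_3 -> R) : Prop :=
  continuous f /\ forall t x, f (t *: x) = t * f x.

Definition triple_product (u v w : 'rV[R]_3) : R :=
  det3 (xcoord u) (ycoord u) (zcoord u) (xcoord v) (ycoord v) (zcoord v) (xcoord w) (ycoord w) (zcoord w).

Lemma triple_product_form u v : is_form (triple_product u v).
Proof.
have cXYZ : continuous (@xcoord R) /\ continuous (@ycoord R) /\ continuous (@zcoord R).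
  by split; [|split] => x; apply: coord_continuous.
have [cX [cY cZ]] := cXYZ.
split; last first.
  by move=> t x; rewrite /triple_product /det3 /det2 /xcoord /ycoord /zcoord !mxE; ring.
have -> : triple_product u v = fun w =>
    (ycoord u * zcoord v - zcoord u * ycoord v) * xcoord w
    + ((zcoord u * xcoord v - xcoord u * zcoord v) * ycoord w
    + (xcoord u * ycoord v - ycoord u * xcoord v) * zcoord w).
  by apply/funext => w; rewrite /triple_product /det3 /det2; ring.
move=> x; apply: (@cvgD _ _ _ (nbhs x) _ (fun x => _ * xcoord x) (fun x => _ * ycoord x + _ * zcoord x)).
  by apply: (@cvgM _ _ (nbhs x) _ (fun=> _) (@xcoord R)); [exact: cvg_cst | exact: cX].
apply: (@cvgD _ _ _ (nbhs x) _ (fun x => _ * ycoord x) (fun x => _ * zcoord x)).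
  by apply: (@cvgM _ _ (nbhs x) _ (fun=> _) (@ycoord R)); [exact: cvg_cst | exact: cY].
by apply: (@cvgM _ _ (nbhs x) _ (fun=> _) (@zcoord R)); [exact: cvg_cst | exact: cZ].
Qed.

(** Cramer's rule, with coordinate functions that are continuous linear forms. *)
Lemma frame_coordinates u v w : triple_product u v w != 0 ->
  exists f : ('rV[R]_3 -> R) * ('rV[R]_3 -> R) * ('rV[R]_3 -> R),
  [/\ is_form f.1.1, is_form f.1.2, is_form f.2,
      forall x, x = f.1.1 x *: u + f.1.2 x *: v + f.2 x *: w
    & forall a b c : R, let x := a *: u + b *: v + c *: w in
       [/\ f.1.1 x = a, f.1.2 x = b & f.2 x = c]].
Proof.
set D := triple_product u v w => D0.
have formZ f : is_form f -> is_form (fun x => f x / D).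
  case=> cf fZ; split=> [x|t x]; last by rewrite fZ mulrA.
  by apply: (@cvgM _ _ (nbhs x) _ f (fun=> D^-1)); [exact: cf | exact: cvg_cst].
exists ((fun x => triple_product v w x / D), (fun x => triple_product w u x / D),
        (fun x => triple_product u v x / D)) => /=.
split; try exact/formZ/triple_product_form.
- move=> x; apply: (scalerI D0); rewrite !scalerDr !scalerA !(mulrC D) !divfK //.
  by apply: rV3P; rewrite /D /triple_product /det3 /det2 /xcoord /ycoord /zcoord !mxE; ring.
- move=> a b c; split; apply: (mulIf D0); rewrite divfK //;
  by rewrite /D /triple_product /det3 /det2 /xcoord /ycoord /zcoord !mxE; ring.
Qed.

Lemma scale_max (t p q : R) : 0 <= t -> Num.max (t * p) (t * q) = t * Num.max p q.
Proof. by move=> t0; rewrite maxr_pMr. Qed.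

Lemma continuous_abs (f : 'rV[R]_3 -> R) : continuous f -> continuous (fun x => `|f x|).
Proof.
move=> cf x; apply: (@continuous_comp _ _ _ f (fun r : R => `|r|)); first exact: cf.
exact: (@norm_continuous R R^o).
Qed.

(** About the centroid [c], in the frame [a0 - c], [a1 - c], [n], the corners have the plane
    coordinates [(1, 0)], [(0, 1)] and [(-1, -1)], and the gauge is the maximum of
    the three linear forms that are 1 on a side. *)
Lemma triangle_disc (a0 a1 a2 n : 'rV[R]_3) :
  triple_product (a1 - a0) (a2 - a0) n != 0 -> is_disc (in_hull a0 a1 a2).
Proof.
move=> D0; pose c := 3^-1 *: (a0 + a1 + a2).
have [|[[f1 f2] f3] /= [[c1 Z1] [c2 Z2] [c3 Z3] fE fK]] :=
    @frame_coordinates (a0 - c) (a1 - c) n.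
  have -> : triple_product (a0 - c) (a1 - c) n =
      3^-1 * triple_product (a1 - a0) (a2 - a0) n.
    by rewrite /c /triple_product /det3 /det2 /xcoord /ycoord /zcoord !mxE; field.
  by rewrite mulf_neq0 // invr_eq0 pnatr_eq0.
pose g x := Num.max (f1 x + f2 x) (Num.max (f2 x - f1 x *+ 2) (f1 x - f2 x *+ 2)).
exists g, (fun x => `|f3 x|), c; split.
- split.
  + move=> x; apply: (@continuous_max R _ (fun x => f1 x + f2 x)
      (fun x => Num.max (f2 x - f1 x *+ 2) (f1 x - f2 x *+ 2))).
      by apply: (@cvgD _ R^o _ (nbhs x) _ f1 f2); [exact: c1|exact: c2].
    apply: (@continuous_max R _ (fun x => f2 x - f1 x *+ 2) (fun x => f1 x - f2 x *+ 2)).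
      apply: (@cvgB _ R^o _ (nbhs x) _ f2 (fun x => f1 x *+ 2)); first exact: c2.
      by apply: (@cvgD _ R^o _ (nbhs x) _ f1 f1); exact: c1.
    apply: (@cvgB _ R^o _ (nbhs x) _ f1 (fun x => f2 x *+ 2)); first exact: c1.
    by apply: (@cvgD _ R^o _ (nbhs x) _ f2 f2); exact: c2.
  + move=> t x t0; rewrite /g Z1 Z2 -!mulrnAr -!mulrDr -!mulrBr.
    by rewrite !scale_max.
  + by move=> x; rewrite /g !le_max; lra.
- split.
  + exact: continuous_abs.
  + by move=> t x t0; rewrite Z3 normrM ger0_norm.
  + by move=> x; apply: normr_ge0.
- move=> x g0 /normr0_eq0 f30.
  have : g x <= 0 by rewrite g0.
  rewrite /g !ge_max => /and3P[h1 h2 h3].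
  have f10 : f1 x = 0 by lra.
  have f20 : f2 x = 0 by lra.
  by rewrite (fE x) f10 f20 f30 !scale0r !addr0.
move=> x; split.
  case=> -[[l0 l1] l2] /= [p0 p1 p2 lS xE].
  have xc : x - c = (l0 - l2) *: (a0 - c) + (l1 - l2) *: (a1 - c) + 0 *: n.
    rewrite xE /c; apply/rowP => i; rewrite !mxE.
    have -> : l0 = 1 - l1 - l2 by lra.
    by field.
  have [e1 e2 e3] := fK (l0 - l2) (l1 - l2) 0; rewrite -xc in e1 e2 e3.
  by rewrite /g e1 e2 e3 normr0 !ge_max; split=> //; apply/and3P; split; lra.
case=> + /normr0_eq0 f30; rewrite /g !ge_max => /and3P[h1 h2 h3].
have := fE (x - c); rewrite f30 scale0r addr0.
move: h1 h2 h3; set p := f1 (x - c); set q := f2 (x - c) => h1 h2 h3 xE.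
exists (p + (1 - p - q) / 3, q + (1 - p - q) / 3, (1 - p - q) / 3); split=> /=; [lra|lra|lra|lra|].
rewrite -[x](subrK c) xE /c; apply/rowP => i; rewrite !mxE; by field.
Qed.

(** Two triangles with the common side [q0 q2], not in one plane.  In the frame of [q2],
    [q1] and [q3] about the midpoint of that side, they lie in the half-planes where one
    of the last two coordinates is 0 and the other one nonnegative: the union of
    these is where the minimum of the two coordinates is 0. *)
Lemma quadrilateral_disc (q0 q1 q2 q3 : 'rV[R]_3) :
  triple_product (q1 - q0) (q2 - q0) (q3 - q0) != 0 ->
  is_disc (in_hull q0 q2 q1 `|` in_hull q0 q2 q3).
Proof.
move=> D0; pose c := 2^-1 *: (q0 + q2).
have [|[[f1 f2] f3] /= [[c1 Z1] [c2 Z2] [c3 Z3] fE fK]] :=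
    @frame_coordinates (q2 - c) (q1 - c) (q3 - c).
  have -> : triple_product (q2 - c) (q1 - c) (q3 - c) =
      - 2^-1 * triple_product (q1 - q0) (q2 - q0) (q3 - q0).
    by rewrite /c /triple_product /det3 /det2 /xcoord /ycoord /zcoord !mxE; field.
  by rewrite mulf_neq0 // oppr_eq0 invr_eq0 pnatr_eq0.
exists (fun x => `|f1 x| + `|f2 x - f3 x|), (fun x => `|Num.min (f2 x) (f3 x)|), c; split.
- split.
  + move=> x; apply: (@cvgD _ R^o _ (nbhs x) _ (fun x => `|f1 x|) (fun x => `|f2 x - f3 x|)).
      exact: continuous_abs.
    apply: continuous_abs => y.
    by apply: (@cvgB _ R^o _ (nbhs y) _ f2 f3); [exact: c2|exact: c3].
  + by move=> t x t0; rewrite Z1 Z2 Z3 -mulrBr !normrM ger0_norm // mulrDr.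
  + by move=> x; apply: addr_ge0.
- split.
  + by apply: continuous_abs => x; apply: (@continuous_min R _ f2 f3); [exact: c2|exact: c3].
  + by move=> t x t0; rewrite Z2 Z3 -minr_pMr // normrM ger0_norm.
  + by move=> x; apply: normr_ge0.
- move=> x /eqP; rewrite paddr_eq0 // !normr_eq0 subr_eq0 => /andP[/eqP f10 /eqP f23].
  rewrite f23 minxx => /normr0_eq0 f30.
  by rewrite (fE x) f10 f23 f30 !scale0r !addr0.
move=> x; split.
  have inK p q : 0 <= p -> 0 <= q -> p = 0 \/ q = 0 ->
      forall s, `|s| + p + q <= 1 ->
      x - c = s *: (q2 - c) + p *: (q1 - c) + q *: (q3 - c) ->
      `|f1 (x - c)| + `|f2 (x - c) - f3 (x - c)| <= 1 /\
      `|Num.min (f2 (x - c)) (f3 (x - c))| = 0.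
    move=> p0 q0' pq s sum xc; have [e1 e2 e3] := fK s p q; rewrite -xc in e1 e2 e3.
    rewrite e1 e2 e3; case: pq sum => ->; rewrite ?subr0 ?sub0r ?normrN ?addr0 => sum.
      by rewrite (ger0_norm q0') (min_idPl q0') normr0.
    by rewrite (ger0_norm p0) (min_idPr p0) normr0.
  have bnd (l0 l1 l2 : R) : 0 <= l0 -> 0 <= l1 -> 0 <= l2 -> l0 + l1 + l2 = 1 ->
      `|l1 - l0| + l2 <= 1.
    by move=> p0 p1 p2 lS; case: (ger0P (l1 - l0)) => _; lra.
  case=> -[[[l0 l1] l2] /= [p0 p1 p2 lS xE]].
    apply: (inK l2 0 _ _ _ (l1 - l0)) => //; [by right|by rewrite addr0; apply: bnd|].
    rewrite xE /c; apply/rowP => i; rewrite !mxE; have -> : l0 = 1 - l1 - l2 by lra.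
    by field.
  apply: (inK 0 l2 _ _ _ (l1 - l0)) => //; [by left|by rewrite addr0; apply: bnd|].
  rewrite xE /c; apply/rowP => i; rewrite !mxE; have -> : l0 = 1 - l1 - l2 by lra.
  by field.
case=> + /normr0_eq0.
have := fE (x - c); set s := f1 _; set p := f2 _; set q := f3 _ => xE sum.
have s1 : s <= `|s| by exact: ler_norm.
have s2 : - s <= `|s| by rewrite -normrN; exact: ler_norm.
have [pq|/ltW pq] := leP p q; rewrite ?(min_idPl pq) ?(min_idPr pq) => m0.
  have q_ge0 : 0 <= q by rewrite -m0.
  right; exists ((1 - q - s) / 2, (1 - q + s) / 2, q).
  move: sum; rewrite m0 sub0r normrN (ger0_norm q_ge0) => sum.
  split=> /=; [lra|lra|lra|lra|].
  rewrite -[x](subrK c) xE m0 /c; apply/rowP => i; rewrite !mxE; by field.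
have p_ge0 : 0 <= p by rewrite -m0.
left; exists ((1 - p - s) / 2, (1 - p + s) / 2, p).
move: sum; rewrite m0 subr0 (ger0_norm p_ge0) => sum.
split=> /=; [lra|lra|lra|lra|].
rewrite -[x](subrK c) xE m0 /c; apply/rowP => i; rewrite !mxE; by field.
Qed.

End Discs.

(** * A straight-line embedding with 21 links *)

(** A configuration found by computer search; what matters is [size_linked_pairs] and that no
    four of the points are coplanar. *)
Definition coordinates : seq (seq int) :=
  [:: [:: 0; 0; 1]; [:: 1; 2; 2]; [:: -2; 1; 2]; [:: -1; -2; 1];
      [:: -1; 1; -1]; [:: -1; 1; -2]; [:: 1; 0; 1]].

Definition coordinate (k i : nat) : int := nth 0 (nth [::] coordinates k) i.

Definition int_volume (a b c d : nat) : int :=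
  let x k := coordinate k 0 - coordinate a 0 in
  let y k := coordinate k 1 - coordinate a 1 in
  let z k := coordinate k 2 - coordinate a 2 in
  z b * (x c * y d - y c * x d) - z c * (x b * y d - y b * x d)
    + z d * (x b * y c - y b * x c).

(** The four conditions are those of [segment_same_side] and, for the three corners, of
    [segment_beyond_edges]. *)
Definition missed (t : nat * nat * nat) (e : nat * nat) : bool :=
  let: (a, b, c) := t in let: (p, q) := e in
  [|| 0 < int_volume a b c p * int_volume a b c q,
      int_volume p q a b * int_volume p q b c < 0,
      int_volume p q b c * int_volume p q c a < 0
    | int_volume p q c a * int_volume p q a b < 0].

Definition triangle_mem (t : nat * nat * nat) (i : nat) : bool :=
  [|| i == t.1.1, i == t.1.2 | i == t.2].

Definition disc_check (K : seq (nat * nat * nat)) (s s' : seq nat) : bool :=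
  all (fun e => has (fun t => triangle_mem t e.1 && triangle_mem t e.2) K) (cyc_edges s) &&
  all (fun e => all (fun t => missed t e) K) (cyc_edges s').

Definition non_collinear (a b c : nat) : bool :=
  has (fun d => int_volume a b c d != 0) (iota 0 7).

(** The disc spanned by a cycle.  For a 4-cycle it is bent along the diagonal from the first
    vertex to the third one, so that [rot 1] gives the other choice. *)
Definition disc_triangles (s : seq nat) : seq (nat * nat * nat) :=
  match s with
  | [:: a; b; c] =>
      if non_collinear a b c then [:: (a, b, c)] else [::]
  | [:: a; b; c; d] =>
      if int_volume a b c d != 0 then [:: (a, c, b); (a, c, d)] else [::]
  | _ => [::]
  end.

Definition split_check (p : seq nat * seq nat) : bool :=
  [|| disc_check (disc_triangles p.1) p.1 p.2, disc_check (disc_triangles p.2) p.2 p.1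
    | disc_check (disc_triangles (rot 1 p.2)) p.2 p.1].

Section Embedding.
Variable R : realType.

Lemma volume_affine (p q b x0 x1 x2 : 'rV[R]_3) l0 l1 l2 : l0 + l1 + l2 = 1 ->
  volume p q b (l0 *: x0 + l1 *: x1 + l2 *: x2) =
  l0 * volume p q b x0 + l1 * volume p q b x1 + l2 * volume p q b x2.
Proof.
move=> lS; have -> : l0 = 1 - l1 - l2 by lra.
by rewrite /volume /det2 /xcoord /ycoord /zcoord !mxE; ring.
Qed.

Lemma volume_on_line (p q b : 'rV[R]_3) t : volume p q b ((1 - t) *: p + t *: q) = 0.
Proof. by rewrite /volume /det2 /xcoord /ycoord /zcoord !mxE; ring. Qed.

Lemma segment_same_side (a b c p q : 'rV[R]_3) :
  0 < volume a b c p * volume a b c q -> segment p q `&` in_hull a b c = set0.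
Proof.
move=> pos; apply/seteqP; split=> // x [[t /= t01 <-] [[[l0 l1] l2] /= [_ _ _ lS xE]]].
have := volume_affine a b c a b c lS; rewrite -xE.
have -> : (1 - t) *: p + t *: q = (1 - t) *: p + t *: q + 0 *: q.
  by rewrite scale0r addr0.
rewrite volume_affine; last by lra.
have -> : volume a b c a = 0 by rewrite /volume /det2; ring.
have -> : volume a b c b = 0 by rewrite /volume /det2; ring.
have -> : volume a b c c = 0 by rewrite /volume /det2; ring.
move: pos t01; rewrite in_itv /=; set u := volume _ _ _ p; set v := volume _ _ _ q.
move=> pos /andP[t0 t1]; rewrite !mulr0 !addr0 mul0r addr0 => e0.
have [u0|u0|u0] := ltgtP u 0.
- have v0 : v < 0 by rewrite -(nmulr_rgt0 _ u0).
  by have [t_eq|t_neq] := eqVneq t 0; [move: e0; rewrite t_eq; lra | nra].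
- have v0 : 0 < v by rewrite -(pmulr_rgt0 _ u0).
  by have [t_eq|t_neq] := eqVneq t 0; [move: e0; rewrite t_eq; lra | nra].
- by move: pos; rewrite u0 mul0r ltxx.
Qed.

(** The volume of [p], [q], [b] and [x] is linear in [x] and 0 at the points of the line
    [p q].  At a point of the triangle on this line, the volumes for [a] and [c], weighted with
    its coordinates, therefore cancel, but by hypothesis they have the same sign.  So both
    weights are 0, the point is [b], and [b] is on the line, which is excluded too. *)
Lemma segment_beyond_edges (a b c p q : 'rV[R]_3) :
  volume p q a b * volume p q b c < 0 -> segment p q `&` in_hull a b c = set0.
Proof.
move=> neg; apply/seteqP; split=> // x [[t /= t01 <-] [[[l0 l1] l2] /= [p0 _ p2 lS xE]]].
have := volume_affine p q b a b c lS; rewrite -xE volume_on_line.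
have -> : volume p q b b = 0 by rewrite /volume /det2; ring.
rewrite volumeC; move: neg; set u := volume p q a b; set v := volume p q b c => neg e0.
have v2 : 0 < v * v by rewrite -expr2 exprn_even_gt0 //=; apply: contraTneq neg => ->; rewrite mulr0 ltxx.
have e1 : l0 * (u * v) = l2 * (v * v).
  have -> : l0 * (u * v) = (l0 * u) * v by ring.
  have -> : l0 * u = l2 * v by lra.
  by ring.
have l20 : l2 = 0.
  have : l2 * (v * v) <= 0 by rewrite -e1; apply: mulr_ge0_le0 => //; apply: ltW.
  by rewrite pmulr_lle0 // => h; lra.
have l00 : l0 = 0.
  move: e1; rewrite l20 mul0r => /eqP; rewrite mulf_eq0 => /orP[/eqP//|/eqP uv0].
  by move: neg; rewrite uv0 ltxx.
have l11 : l1 = 1 by lra.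
move: xE; rewrite l00 l20 l11 !scale0r scale1r add0r addr0 => bE.
have : v = 0.
  rewrite /v -bE; rewrite /volume /det2 /xcoord /ycoord /zcoord !mxE; ring.
by move=> v0; move: neg; rewrite v0 mulr0 ltxx.
Qed.

Definition position (k : nat) : 'rV[R]_3 := \row_(i < 3) (coordinate k i)%:~R.

Lemma coords_position k : [/\ xcoord (position k) = (coordinate k 0)%:~R,
  ycoord (position k) = (coordinate k 1)%:~R & zcoord (position k) = (coordinate k 2)%:~R].
Proof. by rewrite /xcoord /ycoord /zcoord !mxE. Qed.

Lemma volume_position a b c d :
  volume (position a) (position b) (position c) (position d) = (int_volume a b c d)%:~R.
Proof.
have [xa ya za] := coords_position a; have [xb yb zb] := coords_position b.
have [xc yc zc] := coords_position c; have [xd yd zd] := coords_position d.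
rewrite /volume /det2 !subr0 xa ya za xb yb zb xc yc zc xd yd zd.
by rewrite /int_volume !(rmorphB, rmorphD, rmorphM).
Qed.

Definition hull (t : nat * nat * nat) : set 'rV[R]_3 :=
  in_hull (position t.1.1) (position t.1.2) (position t.2).

Lemma in_hull_rot (a b c : 'rV[R]_3) : in_hull b c a = in_hull a b c.
Proof.
apply/seteqP; split=> x [[[l0 l1] l2] /= [p0 p1 p2 lS ->]].
  by exists (l2, l0, l1); split=> //=; [lra | rewrite [LHS]addrC addrA].
by exists (l1, l2, l0); split=> //=; [lra | rewrite -addrA [LHS]addrC].
Qed.

Lemma missedP t p q : missed t (p, q) ->
  segment (position p) (position q) `&` hull t = set0.
Proof.
case: t => [[a b] c]; rewrite /missed /hull /=.
rewrite -!(ltr_int R) /= !rmorphM /= -!volume_position.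
case/or4P; first exact: segment_same_side.
- exact: segment_beyond_edges.
- by rewrite -in_hull_rot; apply: segment_beyond_edges.
- by rewrite -2!in_hull_rot; apply: segment_beyond_edges.
Qed.

Lemma segment_hull t i j x : triangle_mem t i -> triangle_mem t j ->
  segment (position i) (position j) x -> hull t x.
Proof.
case: t => [[a b] c]; rewrite /triangle_mem /= => hi hj [s /= + <-].
rewrite in_itv /= => /andP[s0 s1].
have vertexP k (u : R) : 0 <= u -> [|| k == a, k == b | k == c] ->
    exists l : R * R * R, [/\ 0 <= l.1.1, 0 <= l.1.2, 0 <= l.2, l.1.1 + l.1.2 + l.2 = u
      & u *: position k = l.1.1 *: position a + l.1.2 *: position b + l.2 *: position c].
  move=> u0 /or3P[]/eqP->; [exists (u, 0, 0)|exists (0, u, 0)|exists (0, 0, u)];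
  by rewrite /= !scale0r ?addr0 ?add0r; split.
have [|[[l0 l1] l2] /= [p0 p1 p2 lS ->]] := vertexP i (1 - s) _ hi; first by lra.
have [[[m0 m1] m2] /= [r0 r1 r2 mS ->]] := vertexP j s s0 hj.
exists (l0 + m0, l1 + m1, l2 + m2); split=> /=; [lra|lra|lra|lra|].
by apply/rowP => k; rewrite !mxE; ring.
Qed.

Lemma triple_product_volume (a b c d : 'rV[R]_3) :
  triple_product (b - a) (c - a) (d - a) = volume a b c d.
Proof. by rewrite /triple_product /det3 /volume /det2 /xcoord /ycoord /zcoord !mxE; ring. Qed.

Definition disc (s : seq nat) : set 'rV[R]_3 :=
  [set x | exists2 t, t \in disc_triangles s & hull t x].

Lemma is_disc_disc s : disc_triangles s != [::] -> is_disc (disc s).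
Proof.
rewrite /disc; case: s => [|a [|b [|c [|d [|? ?]]]]] //=; case: ifP => // nondeg _.
  have [d _ vol] := hasP nondeg.
  have -> : [set x | exists2 t, t \in [:: (a, b, c)] & hull t x] = hull (a, b, c).
    apply/seteqP; split=> x /=; last by move=> hx; exists (a, b, c); rewrite ?inE.
    by case=> t; rewrite inE => /eqP->.
  apply: (@triangle_disc _ _ _ _ (position d - position a)).
  by rewrite triple_product_volume volume_position intr_eq0.
have -> : [set x | exists2 t, t \in [:: (a, c, b); (a, c, d)] & hull t x] =
    hull (a, c, b) `|` hull (a, c, d).
  apply/seteqP; split=> x /=.
    by case=> t; rewrite !inE => /orP[] /eqP->; [left|right].
  by case=> hx; [exists (a, c, b)|exists (a, c, d)]; rewrite ?inE ?eqxx ?orbT.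
apply: quadrilateral_disc.
by rewrite triple_product_volume volume_position intr_eq0.
Qed.

Definition straight (x : 'rV[R]_7) : 'rV[R]_3 := \sum_(i < 7) x 0 i *: position i.

Lemma straight_vertex i : straight (vertex R i) = position i.
Proof.
rewrite /straight (bigD1 i) //= mxE !eqxx scale1r big1 ?addr0 // => j ji.
by rewrite mxE eqxx (negPf ji) scale0r.
Qed.

Lemma straight_segment t (x y : 'rV[R]_7) :
  straight ((1 - t) *: x + t *: y) = (1 - t) *: straight x + t *: straight y.
Proof.
rewrite /straight !scaler_sumr -big_split /=; apply: eq_bigr => i _.
by rewrite !mxE !scalerA scalerDl.
Qed.

Lemma straight_edge (i j : 'I_7) : straight @` edge i j = segment (position i) (position j).
Proof.
apply/seteqP; split=> x.
  by move=> [y [t t01 <-] <-]; exists t => //; rewrite straight_segment !straight_vertex.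
move=> [t t01 <-]; exists ((1 - t) *: vertex R i + t *: vertex R j); first by exists t.
by rewrite straight_segment !straight_vertex.
Qed.

Lemma segmentC (m : nat) (a b : 'rV[R]_m) : segment a b = segment b a.
Proof.
have sub (u v : 'rV[R]_m) : segment u v `<=` segment v u.
  move=> x [t /= + <-]; rewrite in_itv /= => /andP[t0 t1]; exists (1 - t).
    by rewrite /= in_itv /=; apply/andP; split; lra.
  by rewrite subKr addrC.
by apply/seteqP; split; apply: sub.
Qed.

Lemma straight_cycle s x : in_K7 s -> uniq s ->
  (straight @` cycle_realization (cycle_set s)) x ->
  exists2 e, e \in cyc_edges s & segment (position e.1) (position e.2) x.
Proof.
move=> ss us [y [i [j [ijC yij]]] xE].
have {yij}xij : segment (position i) (position j) x.
  by rewrite -straight_edge; exists y.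
case/imsetP: ijC => u /mapP[k ks ->]; rewrite next_inord // => ijE.
have vk : (@inord 6 k : nat) = k by rewrite inordK // (allP ss).
have vn : (@inord 6 (next s k) : nat) = next s k by rewrite inordK // (allP ss) // mem_next.
exists (minn k (next s k), maxn k (next s k)); first by apply/mapP; exists k.
have -> : segment (position (minn k (next s k))) (position (maxn k (next s k)))
    = segment (position k) (position (next s k)).
  by case: leqP => // _; rewrite segmentC.
have : i \in [set i; j]%SET by rewrite !inE eqxx.
have : j \in [set i; j]%SET by rewrite !inE eqxx orbT.
rewrite ijE !inE => /orP[] /eqP jE /orP[] /eqP iE; move: xij; rewrite iE jE ?vk ?vn //.
- have : inord (next s k) \in [set @inord 6 k; inord (next s k)]%SET by rewrite !inE eqxx orbT.
  rewrite -ijE iE jE !inE orbb => /eqP/(congr1 (@nat_of_ord 7)).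
  by rewrite vk vn => ->.
- by rewrite segmentC.
- have : inord k \in [set @inord 6 k; inord (next s k)]%SET by rewrite !inE eqxx.
  rewrite -ijE iE jE !inE orbb => /eqP/(congr1 (@nat_of_ord 7)).
  by rewrite vk vn => <-.
Qed.

Lemma disc_checkP q s s' : cycle_check s -> cycle_check s' ->
    disc_check (disc_triangles q) s s' ->
  exists2 h : 'rV[R]_3 -> 'rV[R]_3, homeomorphism h &
    sphere_separates h (straight @` cycle_realization (cycle_set s))
                       (straight @` cycle_realization (cycle_set s')).
Proof.
case/and4P=> ss us s2 _ /and4P[ss' us' _ _] /andP[/allP inside /allP outside].
have nonempty : disc_triangles q != [::].
  apply/eqP => K0; move: inside; rewrite K0 /cyc_edges; case: s s2 {ss us} => // x s _.
  by move=> /(_ _ (mem_head _ _)).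
apply: (@split_by_disc R (disc q) _ _ [seq (position e.1, position e.2) | e <- cyc_edges s']).
- exact: is_disc_disc.
- move=> x /straight_cycle[] // e es xe.
  have /hasP[t tK /andP[t1 t2]] := inside e es.
  by exists t => //; apply: segment_hull t1 t2 xe.
- move=> x /straight_cycle[] // e es xe.
  by exists (position e.1, position e.2) => //; apply/mapP; exists e.
- move=> _ /mapP[e es ->] /=; apply/seteqP; split=> // x [xe [t tK xt]].
  have /allP/(_ t tK) := outside e es; case: e {es} xe => i j xe /missedP <-.
  by split.
Qed.

Lemma split_checkP p : p \in cycle_pairs -> split_check p ->
  split_link (straight @` cycle_realization (cycle_set p.1))
             (straight @` cycle_realization (cycle_set p.2)).
Proof.
move=> pin; have /and3P[g1 g2 _] := allP cycle_pairs_checked p pin.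
case/or3P=> [/(disc_checkP g1 g2)|/(disc_checkP g2 g1)|/(disc_checkP g2 g1)] [h hh sep].
- by exists h => //; left.
- by exists h => //; right.
- by exists h => //; right.
Qed.

Lemma split_linkC (P Q : set 'rV[R]_3) : split_link P Q -> split_link Q P.
Proof. by case=> h hh [sep|sep]; exists h => //; [right|left]. Qed.

Definition general_position_check (r : seq nat) : bool :=
  all (fun a => all (fun b => all (fun c => all (fun d =>
    uniq [:: a; b; c; d] ==> (int_volume a b c d != 0)) r) r) r) r.

Lemma positions_in_general_position : general_position_check (iota 0 7).
Proof. by vm_compute. Qed.

Lemma positions_affinely_independent (a b c d : 'I_7) (l0 l1 l2 l3 : R) :
    uniq [:: a; b; c; d] -> l0 + l1 + l2 + l3 = 0 ->
    l0 *: position a + l1 *: position b + l2 *: position c + l3 *: position d = 0 ->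
  [/\ l0 = 0, l1 = 0, l2 = 0 & l3 = 0].
Proof.
move=> us lS comb.
have vol : volume (position a) (position b) (position c) (position d) != 0.
  have in7 (x : 'I_7) : val x \in iota 0 7 by rewrite mem_iota ltn_ord.
  rewrite volume_position intr_eq0 -(map_inj_uniq val_inj) in us *.
  have /allP/(_ _ (in7 b))/allP/(_ _ (in7 c))/allP/(_ _ (in7 d)) :=
    allP positions_in_general_position _ (in7 a).
  by move/implyP; apply.
have tp : triple_product (position b - position a) (position c - position a) (position d - position a) != 0.
  by rewrite triple_product_volume.
have [f /= [_ _ _ _ fK]] := frame_coordinates tp.
have e0 : l1 *: (position b - position a) + l2 *: (position c - position a)
    + l3 *: (position d - position a) = 0.
  rewrite -comb; have -> : l0 = - l1 - l2 - l3 by lra.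
  by apply/rowP => i; rewrite !mxE; ring.
have [f1 f2 f3] := fK l1 l2 l3.
have [g1 g2 g3] := fK 0 0 0.
move: f1 f2 f3 g1 g2 g3; rewrite e0 !scale0r !addr0 => -> -> -> h1 h2 h3.
by split=> //; lra.
Qed.

(** Two points of the realization are on two edges, hence in the face of the simplex spanned
    by four vertices, and [straight] is affine and injective on this face since no four of the
    seven positions are coplanar. *)
Lemma straight_inj : {in realization (complete_graph 7) &, injective straight}.
Proof.
have onedge x : realization (complete_graph 7) x ->
    exists (i j : 'I_7) (s : R), x = (1 - s) *: vertex R i + s *: vertex R j.
  case=> [[i _ <-]|[i [j [_ [t _ <-]]]]]; last by exists i, j, t.
  by exists i, i, 0; rewrite subr0 scale1r scale0r addr0.
move=> x y; rewrite !inE => /onedge[i [j [s xE]]] /onedge[k [l [t yE]]] fxy.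
(* Some of the ends of the two edges may coincide; other vertices fill up the list. *)
pose W := undup [:: i; j; k; l] ++ [seq m <- enum 'I_7 | m \notin [:: i; j; k; l]].
have uW : uniq W.
  rewrite cat_uniq undup_uniq filter_uniq ?enum_uniq // andbT andTb.
  by apply/hasPn => m; rewrite mem_filter mem_undup => /andP[].
have sW : (4 <= size W)%N.
  have : (size (enum 'I_7) <= size W)%N.
    apply: uniq_leq_size => [|m _]; first exact: enum_uniq.
    by rewrite mem_cat mem_undup mem_filter mem_enum andbT orbN.
  by rewrite size_enum_ord; apply: leq_trans.
have sub m : m \in [:: i; j; k; l] -> m \in take 4 W.
  rewrite -mem_undup take_cat; case: ltnP => [|_ min]; last by rewrite mem_cat min.
  by rewrite ltnNge (leq_trans (size_undup _)).
have [a [b [c [d tW]]]] : exists a b c d, take 4 W = [:: a; b; c; d].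
  by case: W sW {uW sub} => [|a [|b [|c [|d W]]]] // _; exists a, b, c, d; rewrite /= take0.
have us : uniq [:: a; b; c; d] by rewrite -tW take_uniq.
pose z := x - y.
have z0 m : m \notin [:: a; b; c; d] -> z 0 m = 0.
  rewrite -tW => mW; have : m \notin [:: i; j; k; l] by apply: contra mW; apply: sub.
  rewrite !inE !negb_or => /and4P[mi mj mk ml].
  by rewrite /z xE yE !mxE !eqxx (negPf mi) (negPf mj) (negPf mk) (negPf ml) !mulr0; ring.
have sumE (V : lmodType R) (F : 'I_7 -> V) : \sum_m z 0 m *: F m =
    z 0 a *: F a + z 0 b *: F b + z 0 c *: F c + z 0 d *: F d.
  rewrite (bigID (mem [:: a; b; c; d])) /= [X in _ + X]big1 => [|m /z0->]; last exact: scale0r.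
  rewrite addr0 -big_uniq //= !big_cons big_nil addr0 !addrA //.
have zsum : z 0 a + z 0 b + z 0 c + z 0 d = 0.
  have -> : z 0 a + z 0 b + z 0 c + z 0 d = \sum_m z 0 m.
    have := sumE R^o (fun=> 1); rewrite /GRing.scale /= !mulr1 => <-.
    by apply: eq_bigr => m _; rewrite mulr1.
  have vsum (u : 'I_7) : \sum_m vertex R u 0 m = 1.
    rewrite (bigD1 u) //= mxE !eqxx big1 ?addr0 // => m mu.
    by rewrite mxE eqxx (negPf mu).
  have lsum (u v : 'I_7) (r : R) : \sum_m ((1 - r) *: vertex R u + r *: vertex R v) 0 m = 1.
    rewrite (eq_bigr (fun m => (1 - r) * vertex R u 0 m + r * vertex R v 0 m)) => [|m _].
    by rewrite big_split /= -!big_distrr /= !vsum; ring.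
    by rewrite !mxE.
  rewrite (eq_bigr (fun m => x 0 m - y 0 m)) => [|m _]; last by rewrite /z !mxE.
  by rewrite big_split /= sumrN xE yE !lsum subrr.
have zcomb : z 0 a *: position a + z 0 b *: position b + z 0 c *: position c + z 0 d *: position d = 0.
  transitivity (straight x - straight y); last by rewrite fxy subrr.
  rewrite -(sumE _ (fun m => position m)) /straight -sumrB; apply: eq_bigr => m _.
  by rewrite !mxE scalerBl.
have [za zb zc zd] := positions_affinely_independent us zsum zcomb.
apply/eqP; rewrite -subr_eq0; apply/eqP/rowP => m; rewrite [RHS]mxE.
have [|/z0//] := boolP (m \in [:: a; b; c; d]).
by rewrite !inE => /or4P[]/eqP->.
Qed.

Lemma tame_straight : tame_embedding (complete_graph 7) straight.
Proof.
split; last 1 first.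
- exists id; first by split; [move=> x; exact: cvg_id | exists id; split=> // x; exact: cvg_id].
  move=> i j _; rewrite image_id straight_edge.
  exists [:: (position i, position j)]; apply/seteqP; split=> x.
    by move=> xs; exists (position i, position j); rewrite /= ?inE.
  by case=> e; rewrite /= inE => /eqP->.
- apply: continuous_subspaceT; rewrite /straight.
  apply: (@continuous_big 'rV[R]_3 'I_7 +%R 0 xpredT (@add_continuous _) 'rV[R]_7
    (index_enum 'I_7) (fun i (x : 'rV[R]_7) => x 0 i *: position i)) => i _ x.
  by apply: (@cvgZr_tmp _ _ _ (nbhs x) _ (fun x : 'rV[R]_7 => x 0 i)); apply: coord_continuous.
- exact: straight_inj.
Qed.

Definition same_cycle (s t : seq nat) : bool := perm_eq (cyc_edges s) (cyc_edges t).

Lemma same_cycle_set s t : in_K7 s -> uniq s -> in_K7 t -> uniq t ->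
  same_cycle s t -> cycle_set s = cycle_set t.
Proof.
have sub s' t' : in_K7 s' -> uniq s' -> in_K7 t' -> uniq t' ->
    {subset cyc_edges s' <= cyc_edges t'} -> cycle_set s' \subset cycle_set t'.
  move=> ss us st ut sub; apply/fintype.subsetP => A /imsetP[u /mapP[k ks ->]].
  rewrite next_inord // => ->.
  have /sub/mapP[m mt [mn mx]] : (minn k (next s' k), maxn k (next s' k)) \in cyc_edges s'.
    by apply/mapP; exists k.
  apply/imsetP; exists (inord m); first exact: map_f.
  rewrite next_inord //.
  by move: mn mx; case: (leqP k (next s' k)) => _; case: (leqP m (next t' m)) => _ -> -> //;
    rewrite finset.setUC.
move=> ss us st ut /perm_mem st_mem; apply/eqP; rewrite finset.eqEsubset.
by apply/andP; split; apply: sub => // e; rewrite st_mem.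
Qed.

Definition vertex_seqs (n : nat) : seq (seq nat) :=
  iter n (fun r => [seq x :: s | x <- iota 0 7, s <- r]) [:: [::]].

Lemma mem_vertex_seqs n s : size s = n -> in_K7 s -> s \in vertex_seqs n.
Proof.
elim: n s => [|n IH] [|x s] // [sz] /andP[x7 ss]; rewrite /vertex_seqs iterS -/(vertex_seqs n).
by apply/allpairsP; exists (x, s); split; rewrite ?mem_iota //; apply: IH.
Qed.

(** As an edge set, a cycle of length 3 or 4 depends neither on its starting point nor on its
    direction, so it is one of those listed by [triangles] and [squares]; this is checked on
    all sequences of three and four vertices. *)
Definition canonical_check3 : bool :=
  all (fun s => uniq s ==> same_cycle s (sort leq s)) (vertex_seqs 3).
Definition canonical_check4 : bool :=
  all (fun s => uniq s ==> has (same_cycle s) (squares (sort leq s))) (vertex_seqs 4).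

Lemma canonical3 : canonical_check3. Proof. by vm_compute. Qed.
Lemma canonical4 : canonical_check4. Proof. by vm_compute. Qed.

Lemma graph_cycleP (C : {set {set 'I_7}}) : is_graph_cycle (complete_graph 7) C ->
  exists s, [/\ in_K7 s, uniq s, (2 < size s)%N, C = cycle_set s
    & forall x, x \in s -> inord x \in finset.cover C].
Proof.
case=> S [uS zS _ CE]; exists (map val S).
have inordS : map (@inord 6) (map val S) = S.
  by rewrite -map_comp map_id_in // => x _; rewrite /= inord_val.
split.
- by apply/allP => _ /mapP[x _ ->]; apply: ltn_ord.
- by rewrite map_inj_uniq //; apply: val_inj.
- by rewrite size_map.
- by rewrite /cycle_set inordS.
- move=> _ /mapP[x xS ->]; rewrite inord_val CE; apply/bigcupP.
  exists [set x; next S x]%SET; last by rewrite !inE eqxx.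
  by apply/imsetP; exists x.
Qed.

Lemma mem_triangles r a b c : a \in r -> b \in r -> c \in r -> sorted ltn [:: a; b; c] ->
  [:: a; b; c] \in triangles r.
Proof.
move=> ar br cr st; rewrite /triangles mem_filter st andTb.
apply/allpairsP; exists (a, (b, c)); split=> //.
by apply/allpairsP; exists (b, c).
Qed.

Lemma sort_triangle s r : uniq s -> size s = 3%N -> {subset s <= r} ->
  sort leq s \in triangles r.
Proof.
move=> us sz sub.
have : sorted ltn (sort leq s).
  by rewrite ltn_sorted_uniq_leq sort_uniq us sort_sorted //; apply: leq_total.
have : {subset sort leq s <= r} by move=> x; rewrite mem_sort; apply: sub.
have : size (sort leq s) = 3%N by rewrite size_sort.
case: (sort leq s) => [|a [|b [|c [|]]]] // _ sub' st.
by apply: mem_triangles st; apply: sub'; rewrite !inE eqxx ?orbT.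
Qed.

Lemma mem_other_vertices t x : (x \in other_vertices t) = (x \notin t) && (x < 7)%N.
Proof. by rewrite mem_filter mem_iota. Qed.

Lemma sort_other_vertices t s : t \in triangles (iota 0 7) -> uniq s -> size s = 4%N ->
  {subset s <= other_vertices t} -> sort leq s = other_vertices t.
Proof.
move=> tin us sz sub.
have chk : all (fun t => (size (other_vertices t) == 4%N) && sorted ltn (other_vertices t))
    (triangles (iota 0 7)).
  by vm_compute.
have /andP[/eqP zr sr] := allP chk t tin.
have eqi : other_vertices t =i s.
  have [] := uniq_min_size us sub; rewrite ?zr ?sz // => _ h x; by rewrite h.
apply: (irr_sorted_eq ltn_trans ltnn) => //; last by move=> x; rewrite mem_sort eqi.
by rewrite ltn_sorted_uniq_leq sort_uniq us sort_sorted //; apply: leq_total.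
Qed.

Definition swap_check : bool := all (fun p =>
  (p \in unordered_triangle_pairs) || ((p.2, p.1) \in unordered_triangle_pairs)) triangle_pairs.

Lemma unordered_or_swapped t u : (t, u) \in triangle_pairs ->
  (t, u) \in unordered_triangle_pairs \/ (u, t) \in unordered_triangle_pairs.
Proof.
have : swap_check by vm_compute.
rewrite /swap_check; move: triangle_pairs unordered_triangle_pairs => l l' /allP chk.
by move=> /chk/orP.
Qed.

Lemma cycles_in_pairs s s' : in_K7 s -> uniq s -> in_K7 s' -> uniq s' ->
    size s = 3%N -> (2 < size s')%N -> (size s + size s' <= 7)%N -> {subset s' <= other_vertices s} ->
  exists p, [/\ p \in cycle_pairs, cycle_set s = cycle_set p.1 & cycle_set s' = cycle_set p.2] \/
            [/\ p \in cycle_pairs, cycle_set s = cycle_set p.2 & cycle_set s' = cycle_set p.1].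
Proof.
move=> ss us ss' us' z3 z' z7 sub; set t := sort leq s.
have tin : t \in triangles (iota 0 7).
  by apply: sort_triangle => // x xs; rewrite mem_iota (allP ss).
have restE : other_vertices t = other_vertices s by apply: eq_filter => x; rewrite mem_sort.
have st : in_K7 t by apply/allP => x; rewrite mem_sort => /(allP ss).
have ut : uniq t by rewrite sort_uniq.
have Cs : cycle_set s = cycle_set t.
  apply: same_cycle_set => //.
  by have /implyP := allP canonical3 s (mem_vertex_seqs z3 ss); apply.
have [z3'|z4'] : size s' = 3%N \/ size s' = 4%N by lia.
  set t' := sort leq s'.
  have st' : in_K7 t' by apply/allP => x; rewrite mem_sort => /(allP ss').
  have Cs' : cycle_set s' = cycle_set t'.
    apply: same_cycle_set => //; first by rewrite sort_uniq.
    by have /implyP := allP canonical3 s' (mem_vertex_seqs z3' ss'); apply.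
  have tt' : (t, t') \in triangle_pairs.
    apply/allpairsPdep; exists t, t'; split=> //; rewrite restE.
    exact: sort_triangle.
  have [pin|pin] := unordered_or_swapped tt'; [exists (t, t'); left|exists (t', t); right];
  by split=> //; rewrite mem_cat pin.
have /implyP/(_ us')/hasP[u uin su] := allP canonical4 s' (mem_vertex_seqs z4' ss').
have tu : (t, u) \in cycle_pairs.
  rewrite mem_cat; apply/orP; right; apply/allpairsPdep; exists t, u; split=> //.
  by rewrite -(sort_other_vertices tin us' z4') // => x xs; rewrite restE; apply: sub.
exists (t, u); left; split=> //.
have /and3P[_ /and4P[su' uu _ _] _] := allP cycle_pairs_checked _ tu.
exact: same_cycle_set.
Qed.

(** The pairs without a certificate.  As there are 21 of them, the lower bound shows that they
    are linked indeed. *)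
Definition linked_pairs : seq (seq nat * seq nat) := [seq p <- cycle_pairs | ~~ split_check p].

Lemma size_linked_pairs : size linked_pairs = 21%N.
Proof. by vm_compute. Qed.

(** Two disjoint cycles on seven vertices are two triangles or a triangle and a 4-cycle, so they
    form one of [cycle_pairs]. *)
Lemma straight_links P : is_link (complete_graph 7) straight P ->
  P \in [seq pair_link p | p <- linked_pairs].
Proof.
case=> C [D [/graph_cycleP[s [ss us zs CE sC]] /graph_cycleP[s' [ss' us' zs' DE sD]] dis PE nsp]].
have disj x : x \in s -> x \in s' -> False.
  by move=> /sC xC /sD xD; move/setP: dis => /(_ (inord x)); rewrite !inE xC xD.
have z7 : (size s + size s' <= 7)%N.
  rewrite -size_cat -[7%N](size_iota 0); apply: uniq_leq_size.
    rewrite cat_uniq us us' andbT; apply/hasPn => x xs'; apply/negP => xs.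
    exact: disj xs xs'.
  by move=> x; rewrite mem_cat mem_iota => /orP[/(allP ss)|/(allP ss')].
have linked p : p \in cycle_pairs -> ~ split_link (straight @` cycle_realization (cycle_set p.1))
     (straight @` cycle_realization (cycle_set p.2)) -> p \in linked_pairs.
  move=> pin np; rewrite mem_filter pin andbT; apply/negP => chk.
  exact/np/split_checkP.
have sub : {subset s' <= other_vertices s}.
  move=> x xs'; rewrite mem_other_vertices (allP ss' x xs') andbT; apply/negP => xs.
  exact: disj xs xs'.
have sub' : {subset s <= other_vertices s'}.
  move=> x xs; rewrite mem_other_vertices (allP ss x xs) andbT; apply/negP => xs'.
  exact: disj xs xs'.
suff [p [[pin e1 e2]|[pin e1 e2]]] :
    exists p, [/\ p \in cycle_pairs, cycle_set s = cycle_set p.1 & cycle_set s' = cycle_set p.2] \/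
            [/\ p \in cycle_pairs, cycle_set s = cycle_set p.2 & cycle_set s' = cycle_set p.1].
- apply/mapP; exists p; last by rewrite PE CE DE e1 e2.
  by apply: linked => //; rewrite -e1 -e2 -CE -DE.
- apply/mapP; exists p; last by rewrite PE CE DE e1 e2 /pair_link finset.setUC.
  by apply: linked => // sp; apply: nsp; rewrite CE DE e1 e2; apply: split_linkC.
have [z3|z3] := eqVneq (size s) 3%N; first exact: cycles_in_pairs.
have z3' : size s' = 3%N by lia.
have [|p [[pin e1 e2]|[pin e1 e2]]] := cycles_in_pairs ss' us' ss us z3' zs _ sub'.
- by rewrite addnC.
- by exists p; right.
- by exists p; left.
Qed.

Lemma number_of_straight_links : (number_of_links (complete_graph 7) straight <= 21)%N.
Proof.
rewrite -size_linked_pairs -(size_map pair_link) /number_of_links cardE.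
apply: uniq_leq_size => [|P]; first exact: enum_uniq.
by rewrite mem_enum inE => /asboolP; apply: straight_links.
Qed.

End Embedding.

Theorem theorem1 (R : realType) : mnl R (complete_graph 7) = 21%N.
Proof.
rewrite /mnl; set counts := [set _ | _ in _].
have lower f : tame_embedding (complete_graph 7) f ->
    (21 <= number_of_links (complete_graph 7) f)%N.
  by case=> cf _ _; apply: number_of_links_ge21.
have in21 : (counts `&` lbound counts) 21%N.
  split.
    exists (@straight R); first exact: tame_straight.
    apply/eqP; rewrite eqn_leq number_of_straight_links lower //; exact: tame_straight.
  by move=> _ [f tf <-]; rewrite leEnat; apply: lower.
have [c1 lb1] := xgetI 0%N in21.
have [c2 lb2] := in21.
by apply/eqP; rewrite eqn_leq; apply/andP; split; [have := lb1 _ c2 | have := lb2 _ c1]; rewrite leEnat.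
Qed.
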